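(* There exists a deterministic algorithm which, given simple graphs $G$ and $H$, an integer $k\ge1$ and a prime $p$ (in binary), decides whether $\hom(F,G)\equiv\hom(F,H)\pmod p$ for every graph $F$ that is the underlying graph of a member of $\mathcal P_k$. The algorithm runs in time $n^{O(k)}(k\log p)^{O(1)}$, where $n=\max\{|V(G)|,|V(H)|\}$.
   Context: $\hom(F,G)$ is the number of homomorphisms $F\to G$ (maps $V(F)\to V(G)$ sending edges to edges). A $(k,k)$-bilabelled graph is $\boldsymbol F=(F,\boldsymbol u,\boldsymbol v)$, $\boldsymbol u,\boldsymbol v\in V(F)^k$, with underlying graph $F$. Series composition $\boldsymbol F\cdot\boldsymbol F'$: disjoint union with $v_i$ identified with $u'_i$, multiple edges removed, labels $(\boldsymbol u,\boldsymbol v')$. Parallel composition $\boldsymbol F\odot\boldsymbol F'$: identify $u_i$ with $u'_i$, $v_i$ with $v'_i$, multiple edges removed. For $\sigma\in\mathfrak S_{2k}$, $\boldsymbol F^\sigma$ has in-labels $(w_{\sigma(1)},\dots,w_{\sigma(k)})$, out-labels $(w_{\sigma(k+1)},\dots,w_{\sigma(2k)})$, $\boldsymbol w=\boldsymbol u\boldsymbol v$. $\mathscr C_k$ = cyclic group of rotations of $(1,\dots,k,2k,\dots,k+1)$. Bilabelled minors: via edge contraction, edge deletion, deletion of unlabelled vertices. $\boldsymbol C_k$: vertices $[2k]$, in-labels $(1,\dots,k)$, out-labels $(k+1,\dots,2k)$, edges $\{i,i+1\}$ ($i\in[2k]\setminus\{k,2k\}$), $\{1,k+1\},\{k,2k\}$;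 $\boldsymbol M_k$: same vertices/labels, edges $\{i,i+k\}$. $\mathcal Q_k^P,\mathcal Q_k^S$ = bilabelled minors of $\boldsymbol C_k,\boldsymbol M_k$; $\mathcal Q_k$ their union. $\mathcal P_k$ = smallest class containing $\mathcal Q_k$, closed under series composition, $\boldsymbol F\mapsto\boldsymbol F\odot\boldsymbol Q$ ($\boldsymbol Q\in\mathcal Q_k^P$), and $\boldsymbol F\mapsto\boldsymbol F^\sigma$ ($\sigma\in\mathscr C_k$). *)

(* Defs.v *)
From mathcomp Require Import all_boot.
Set Implicit Arguments.
Unset Strict Implicit.
Unset Printing Implicit Defensive.

(* A bilabelled graph: vertices are 0, ..., bg_n - 1; bg_e is the (symmetric) *)
(* adjacency relation (loops are allowed, since identifications in series /  *)
(* parallel composition may create them); bg_in / bg_out are the in- and     *)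
(* out-label tuples (of length k for (k,k)-bilabelled graphs).                *)
Record bgraph := BG {
  bg_n : nat;
  bg_e : nat -> nat -> bool;
  bg_in : seq nat;
  bg_out : seq nat }.

Definition hom (F : bgraph) (nG : nat) (E : rel 'I_nG) : nat :=
  #|[set f : {ffun 'I_(bg_n F) -> 'I_nG} |
      [forall a : 'I_(bg_n F), forall b : 'I_(bg_n F),
          bg_e F a b ==> E (f a) (f b)]]|.

(* --- the basic graphs C_k and M_k (0-indexed: vertex i here = i+1 in the paper) *)
Definition sym_edges (N : nat) (P : nat -> nat -> bool) : nat -> nat -> bool :=
  fun x y => (x < N) && (y < N) && (P x y || P y x).

Definition C_bg (k : nat) : bgraph :=
  BG k.*2
     (sym_edges k.*2 (fun x y =>
        ((y == x.+1) && (x != k.-1) && (x.+1 < k.*2))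
        || ((x == 0) && (y == k))
        || ((x == k.-1) && (y == k.*2.-1))))
     (iota 0 k) (iota k k).

Definition M_bg (k : nat) : bgraph :=
  BG k.*2 (sym_edges k.*2 (fun x y => (x < k) && (y == x + k)))
     (iota 0 k) (iota k k).

Definition del_edge (F : bgraph) (a b : nat) : bgraph :=
  BG (bg_n F)
     (fun x y => bg_e F x y && ~~ (((x == a) && (y == b)) || ((x == b) && (y == a))))
     (bg_in F) (bg_out F).

(* renumbering after removing vertex w *)
Definition down (w x : nat) : nat := if w < x then x.-1 else x.
Definition up (w x : nat) : nat := if x < w then x else x.+1.

Definition del_vertex (F : bgraph) (w : nat) : bgraph :=
  BG (bg_n F).-1
     (fun x y => bg_e F (up w x) (up w y))
     (map (down w) (bg_in F)) (map (down w) (bg_out F)).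

(* contraction of the edge {a,b}, a < b: b is merged into a, the edge itself *)
(* disappears and parallel edges are merged.                                  *)
Definition contract (F : bgraph) (a b : nat) : bgraph :=
  let f x := if x == b then a else x in
  BG (bg_n F).-1
     (fun x y => [exists s : 'I_(bg_n F), exists t : 'I_(bg_n F),
        [&& bg_e F s t, ~~ (((s : nat) \in [:: a; b]) && ((t : nat) \in [:: a; b])),
            down b (f (s : nat)) == x & down b (f (t : nat)) == y]])
     (map (fun x => down b (f x)) (bg_in F))
     (map (fun x => down b (f x)) (bg_out F)).

Inductive bminor (B : bgraph) : bgraph -> Prop :=
| bm_refl : bminor B B
| bm_del_edge F a b : bminor B F -> bg_e F a b -> a < bg_n F -> b < bg_n F ->
    bminor B (del_edge F a b)
| bm_contract F a b : bminor B F -> bg_e F a b -> a < b -> b < bg_n F ->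
    bminor B (contract F a b)
| bm_del_vertex F w : bminor B F -> w < bg_n F ->
    w \notin bg_in F ++ bg_out F -> bminor B (del_vertex F w).

Definition QP (k : nat) (F : bgraph) : Prop := bminor (C_bg k) F.
Definition QS (k : nat) (F : bgraph) : Prop := bminor (M_bg k) F.

(* --- gluing: quotient of a graph on 0..N-1 by the equivalence relation    *)
(* generated by a list of pairs; multiple edges merged, loops kept.          *)
Definition glue (N : nat) (E : nat -> nat -> bool) (pairs : seq (nat * nat))
    (lin lout : seq nat) : bgraph :=
  let R : rel 'I_N := fun x y =>
      (((x : nat), (y : nat)) \in pairs) || (((y : nat), (x : nat)) \in pairs) in
  let rt : 'I_N -> 'I_N := root R in
  let rs := undup [seq rt x | x <- enum 'I_N] in
  let cls (x : nat) : nat :=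
      if (insub x : option 'I_N) is Some y then index (rt y) rs else 0 in
  BG (size rs)
     (fun a b => [exists s : 'I_N, exists t : 'I_N,
                   [&& E s t, cls s == a & cls t == b]])
     (map cls lin) (map cls lout).

Definition dunion_e (F F' : bgraph) : nat -> nat -> bool :=
  fun x y => let n := bg_n F in
   if (x < n) && (y < n) then bg_e F x y
   else if (n <= x) && (n <= y) then bg_e F' (x - n) (y - n) else false.

Definition series (F F' : bgraph) : bgraph :=
  let n := bg_n F in
  glue (n + bg_n F') (dunion_e F F')
       (zip (bg_out F) (map (addn n) (bg_in F')))
       (bg_in F) (map (addn n) (bg_out F')).

Definition parallel (F F' : bgraph) : bgraph :=
  let n := bg_n F in
  glue (n + bg_n F') (dunion_e F F')
       (zip (bg_in F) (map (addn n) (bg_in F')) ++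
        zip (bg_out F) (map (addn n) (bg_out F')))
       (bg_in F) (bg_out F).

(* The rotation by r of the cycle (1,...,k,2k,...,k+1) (0-indexed: the cycle *)
(* (0,...,k-1,2k-1,...,k)); these are exactly the elements of \mathscr C_k.  *)
Definition cyc (k : nat) : seq nat := iota 0 k ++ rev (iota k k).
Definition rot_perm (k r : nat) (x : nat) : nat :=
  nth 0 (cyc k) ((index x (cyc k) + r) %% k.*2).

Definition permute (k r : nat) (F : bgraph) : bgraph :=
  let w := bg_in F ++ bg_out F in
  BG (bg_n F) (bg_e F)
     [seq nth 0 w (rot_perm k r i) | i <- iota 0 k]
     [seq nth 0 w (rot_perm k r i) | i <- iota k k].

Inductive Pk (k : nat) : bgraph -> Prop :=
| Pk_QP F : QP k F -> Pk k F
| Pk_QS F : QS k F -> Pk k F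
| Pk_series F F' : Pk k F -> Pk k F' -> Pk k (series F F')
| Pk_parallel F Q : Pk k F -> QP k Q -> Pk k (parallel F Q)
| Pk_perm F r : Pk k F -> Pk k (permute k r F).

Definition Pk_hom_equiv_mod (k p nG : nat) (EG : rel 'I_nG)
    (nH : nat) (EH : rel 'I_nH) : Prop :=
  forall F, Pk k F -> hom F EG = hom F EH %[mod p].

(* States 'I_(tm_Q.+1) (start state 0), tape symbols 'I_(tm_S.+4) with       *)
(* 0 = blank, 1 = '0', 2 = '1', 3 = '#'; moves 'I_3 : 0 left, 1 stay, 2 right. *)
Record TM := mkTM {
  tm_Q : nat;
  tm_S : nat;
  tm_delta : 'I_tm_Q.+1 -> 'I_tm_S.+4 -> 'I_tm_Q.+1 * 'I_tm_S.+4 * 'I_3;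
  tm_acc : 'I_tm_Q.+1;
  tm_rej : 'I_tm_Q.+1 }.

Record conf (M : TM) := Conf {
  c_state : 'I_(tm_Q M).+1;
  c_left : seq 'I_(tm_S M).+4;   (* cells left of the head, nearest first *)
  c_head : 'I_(tm_S M).+4;
  c_right : seq 'I_(tm_S M).+4 }. (* cells right of the head, nearest first *)

Arguments Conf {M}.
Definition blank (M : TM) : 'I_(tm_S M).+4 := ord0.

Definition halted (M : TM) (c : conf M) : bool :=
  (c_state c == tm_acc M) || (c_state c == tm_rej M).

Definition step (M : TM) (c : conf M) : conf M :=
  if @halted M c then c else
  let: (q', s', mv) := tm_delta (c_state c) (c_head c) in
  if (mv : nat) == 0 then
    Conf q' (behead (c_left c)) (head (blank M) (c_left c)) (s' :: c_right c)
  else if (mv : nat) == 1 then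
    Conf q' (c_left c) s' (c_right c)
  else
    Conf q' (s' :: c_left c) (head (blank M) (c_right c)) (behead (c_right c)).

(* input alphabet {'0','1','#'} as 'I_3 *)
Definition in_sym (M : TM) (b : 'I_3) : 'I_(tm_S M).+4 := inord b.+1.

Definition init (M : TM) (w : seq 'I_3) : conf M :=
  Conf ord0 [::] (head (blank M) (map (in_sym M) w)) (behead (map (in_sym M) w)).

Definition run (M : TM) (w : seq 'I_3) (t : nat) : conf M := iter t (@step M) (init M w).

Definition c0 : 'I_3 := @Ordinal 3 0 isT.
Definition c1 : 'I_3 := @Ordinal 3 1 isT.
Definition csep : 'I_3 := @Ordinal 3 2 isT.
Definition bit (b : bool) : 'I_3 := if b then c1 else c0.

(* binary representation, most significant bit first (empty for 0) *)
Fixpoint bin_aux (fuel n : nat) : seq bool :=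
  match fuel with
  | 0 => [::]
  | f.+1 => if n == 0 then [::] else rcons (bin_aux f n./2) (odd n)
  end.
Definition bin (n : nat) : seq bool := bin_aux n n.
Definition enc_nat (n : nat) : seq 'I_3 := map bit (bin n).

Definition enc_graph (n : nat) (E : rel 'I_n) : seq 'I_3 :=
  nseq n c1 ++ [:: csep] ++
  flatten [seq [seq bit (E i j) | j <- enum 'I_n] | i <- enum 'I_n] ++ [:: csep].

Definition enc_input (nG : nat) (EG : rel 'I_nG) (nH : nat) (EH : rel 'I_nH)
    (k p : nat) : seq 'I_3 :=
  enc_graph EG ++ enc_graph EH ++ enc_nat k ++ [:: csep] ++ enc_nat p.

(* Main.v *)
From mathcomp Require Import all_boot all_algebra.
From mathcomp Require Import zify.
Require Import Defs.
Set Implicit Arguments.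
Unset Strict Implicit.
Unset Printing Implicit Defensive.
Import GRing.Theory.

(** The homomorphism tensors of the members of P_k, over G and over H together
    and modulo p, span a subspace of F_p^N with N = n_G^(2k) + n_H^(2k), and
    hom(F, G) - hom(F, H) is a fixed linear functional of the tensor of F.  Series
    composition is the matrix product, composition with a minor of C_k is a product
    of masks "two cyclically consecutive labels are equal (adjacent)", and the
    elements of the cyclic group rotate the labels.  Hence the span is the least
    subspace that contains the tensors of the minors of M_k and is closed under the
    product, the rotation by one and the two masks on the first two labels.  It is
    computed by adding, as long as possible, a vector outside the current span;
    fraction-free elimination needs no inverses, and pivots are distinct, so N
    additions suffice.

    For the running time, functions on encoded data are shown to be computable in
    polynomially many steps of a machine with four stacks, by closure under pairing,
    case distinction and iteration with size-bounded iterates.  Data are binary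
    trees in Polish notation on one stack, so that building and splitting a pair
    amounts to pushing and popping one symbol.  The four stacks are the tracks of
    the Turing machine tape. *)


(** * Structured programs for Turing machines *)

(** Polynomial time in the input length is the wrong measure here: [k] is given in binary, while
    there are about [n^(2k)] coordinates. The predicate [TB B f] therefore carries a budget [B]
    besides the encoded size. It is spent on writing [k] in unary and listing the words of length
    [k]; all later work is polynomial in the size of these data. As such bounds range over all
    encoded arguments, the size estimates for the algorithm must hold for ill-formed data too, and
    they are kept apart from its correctness.

    Labels are listed along the cycle of C_k, that is, with the out-labels reversed. The cyclic
    group then just rotates lists; the price is a [rev] in the matrix product.

    All vertices of C_k and M_k are labelled. Hence the tensor of a minor is 0/1-valued, given by
    equations for the contracted edges and adjacencies for the surviving ones.

    Correctness takes two inclusions. Each operation is realised inside the class, so the basis lies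
    in the span of the tensors; and the span of the final basis is closed, so it contains all
    tensors. Each inclusion yields one direction of the equivalence. *)

Section StructuredTM.
Variables (Sg : finType) (blk : Sg) (emb : 'I_3 -> Sg).
Hypotheses (emb_inj : injective emb) (emb_blk : forall i, emb i != blk).

Inductive com :=
| Act of (Sg -> Sg * 'I_3)
| Seq of com & com
| If of pred Sg & com & com
| While of pred Sg & com.

Definition tape := ((nat -> Sg) * nat)%type.
Definition upd (g : nat -> Sg) i x := fun j => if j == i then x else g j.
Definition mvpos (m : 'I_3) p :=
  if m == 0 :> nat then p.-1 else if m == 1 :> nat then p else p.+1.

(** The count is that of the compiled code: the first branch of [If] pays for the test and for the
    jump over the other branch, a turn of [While] for the test and the jump back. The premise of
    [E_act] keeps the head on cells indexed by [nat], although the machine's tape is infinite on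
    both sides. *)
Inductive exec : com -> tape -> tape -> nat -> Prop :=
| E_act (f : Sg -> Sg * 'I_3) g p : ((f (g p)).2 = 0 :> nat -> 0 < p) ->
    exec (Act f) (g, p) (upd g p (f (g p)).1, mvpos (f (g p)).2 p) 1
| E_seq c1 c2 t t' t'' n m : exec c1 t t' n -> exec c2 t' t'' m ->
    exec (Seq c1 c2) t t'' (n + m)
| E_ift (b : pred Sg) c1 c2 t t' n : b (t.1 t.2) -> exec c1 t t' n ->
    exec (If b c1 c2) t t' n.+2
| E_iff (b : pred Sg) c1 c2 t t' n : ~~ b (t.1 t.2) -> exec c2 t t' n ->
    exec (If b c1 c2) t t' n.+1
| E_whf (b : pred Sg) c t : ~~ b (t.1 t.2) -> exec (While b c) t t 1
| E_wht (b : pred Sg) c t t' t'' n m : b (t.1 t.2) -> exec c t t' n ->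
    exec (While b c) t' t'' m -> exec (While b c) t t'' (n + m).+2.

Definition instr := Sg -> nat * Sg * 'I_3.
Definition stay : 'I_3 := @Ordinal 3 1 isT.
Definition jump a : instr := fun x => (a, x, stay).
Definition branch (b : pred Sg) a a' : instr :=
  fun x => (if b x then a else a', x, stay).

Fixpoint len c :=
  match c with
  | Act _ => 1
  | Seq c1 c2 => len c1 + len c2
  | If _ c1 c2 => (len c1 + len c2).+2
  | While _ c => (len c).+2
  end.

Fixpoint comp c a : seq instr :=
  match c with
  | Act f => [:: fun x => (a.+1, (f x).1, (f x).2)]
  | Seq c1 c2 => comp c1 a ++ comp c2 (a + len c1)
  | If b c1 c2 =>
      branch b a.+1 (a + (len c1).+2) :: comp c1 a.+1 ++
      jump (a + (len c1 + len c2).+2) :: comp c2 (a + (len c1).+2)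
  | While b c =>
      branch b a.+1 (a + (len c).+2) :: comp c a.+1 ++ [:: jump a]
  end.

Lemma size_comp c a : size (comp c a) = len c.
Proof.
elim: c a => [f|c1 IH1 c2 IH2|b c1 IH1 c2 IH2|b c IH] a //=.
- by rewrite size_cat IH1 IH2.
- by rewrite size_cat /= IH1 IH2 addnS.
- by rewrite size_cat /= IH addn1.
Qed.

(** The machine format imposes the codes 0 to 3 for the blank and the input symbols. All other
    symbols are shifted past them, whence an alphabet of [#|Sg| + 4] letters. *)
Definition encs (x : Sg) : 'I_(#|Sg|).+4 :=
  if x == blk then ord0 else
  if [pick i | emb i == x] is Some i then inord i.+1 else inord (enum_rank x).+4.

Definition decs (s : 'I_(#|Sg|).+4) : Sg :=
  match nat_of_ord s with
  | 0 => blk | 1 => emb c0 | 2 => emb c1 | 3 => emb csep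
  | n.+4 => nth blk (enum Sg) n
  end.

Lemma encsK : cancel encs decs.
Proof.
move=> x; rewrite /encs; case: eqP => [->|_] //.
case: pickP => [i /eqP <-|_].
  rewrite /decs inordK; last by rewrite ltnS (leq_trans (ltn_ord i)).
  by case: i => -[|[|[|i]]] // lti; congr (emb _); apply: val_inj.
rewrite /decs inordK; last by rewrite !ltnS ltn_ord.
by rewrite -[RHS](enum_rankK x) (enum_val_nth blk).
Qed.

(** States are program addresses; the first two addresses past the end are the accepting and the
    rejecting state. *)
Definition mk_tm (prog : seq instr) : TM :=
  @mkTM (size prog).+1 #|Sg|
    (fun q s =>
       let: (q', x, m) := nth (jump 0) prog q (decs s) in (inord q', encs x, m))
    (inord (size prog)) (inord (size prog).+1).

Section Simulation.
Variable prog : seq instr.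
Notation M := (mk_tm prog).

Definition sim (t : tape) (c : conf M) :=
  [/\ forall j, nth (blank M) (c_left c) j =
        encs (if j < t.2 then t.1 (t.2 - j.+1) else blk),
      c_head c = encs (t.1 t.2) &
      forall j, nth (blank M) (c_right c) j = encs (t.1 (t.2 + j.+1))].

Definition at_ a t (c : conf M) := c_state c = inord a /\ sim t c.

Definition reach a t n a' t' := forall c : conf M, at_ a t c ->
  at_ a' t' (iter n (@step M) c).

Lemma reach_trans a t n a' t' n' a'' t'' :
  reach a t n a' t' -> reach a' t' n' a'' t'' -> reach a t (n + n') a'' t''.
Proof. by move=> h h' c ac; rewrite addnC iterD; apply/h'/h. Qed.

Lemma encs_blk : encs blk = ord0. Proof. by rewrite /encs eqxx. Qed.

Lemma reach_step a g p q x m :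
  a < size prog -> nth (jump 0) prog a (g p) = (q, x, m) ->
  (m = 0 :> nat -> 0 < p) ->
  reach a (g, p) 1 q (upd g p x, mvpos m p).
Proof.
move=> lta ea hm c [/= cs [/= cl ch cr]].
have sa : (c_state c : nat) = a by rewrite cs inordK //=; lia.
rewrite /step /halted -!val_eqE /= sa !inordK; [|lia..].
rewrite (_ : (a == _) || (a == _) = false); last by lia.
rewrite ch encsK ea /=.
rewrite /at_ /sim /mvpos /upd.
case: eqP => [m0|m0] /=.
  have p0 := hm m0; split=> //; split=> [j|| [|j]] /=.
  - rewrite nth_behead cl /=; congr encs.
    case: ltnP => [ltj|lej]; last by case: ltnP => //; lia.
    case: ltnP => [ltj2|]; last lia.
    have -> : p.-1 - j.+1 == p = false by apply/eqP; lia.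
    by congr g; lia.
  - rewrite -nth0 cl p0; have -> : p.-1 == p = false by apply/eqP; lia.
    by rewrite subn1.
  - by have -> : p.-1 + 1 == p by lia.
  - rewrite cr; have -> : p.-1 + j.+2 == p = false by apply/eqP; lia.
    by congr (encs (g _)); lia.
case: eqP => [m1|m1] /=.
  split=> //; split=> [j||j] /=.
  - rewrite cl; case: ltnP => // ltj; have -> // : p - j.+1 == p = false by apply/eqP; lia.
  - by rewrite eqxx.
  - rewrite cr; have -> // : p + j.+1 == p = false by apply/eqP; lia.
split=> //; split=> [[|j]||j] /=.
- by rewrite subSS subn0 eqxx.
- rewrite cl ltnS subSS; case: ltnP => // ltj.
  by have -> : p - j.+1 == p = false by apply/eqP; lia.
- by rewrite -nth0 cr; have -> : p.+1 == p = false by [apply/eqP; lia]; rewrite addn1.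
- rewrite nth_behead cr; have -> : p.+1 + j.+1 == p = false by apply/eqP; lia.
  by congr (encs (g _)); lia.
Qed.

(** Without functional extensionality the two tapes agree only pointwise; [sim] inspects nothing but
    values. *)
Lemma sim_id g p c : sim (upd g p (g p), p) c -> sim (g, p) c.
Proof.
have e j : upd g p (g p) j = g j by rewrite /upd; case: eqP => [->|].
by case=> cl ch cr; split=> [j||j] /=; rewrite ?cl ?ch ?cr /= e.
Qed.

Lemma reach_stay a g p q :
  a < size prog -> nth (jump 0) prog a (g p) = (q, g p, stay) ->
  reach a (g, p) 1 q (g, p).
Proof.
move=> lta ea c ac; have [] := reach_step lta ea _ ac => // cs /sim_id cs'.
by split.
Qed.

Definition holds_at a (l : seq instr) :=
  forall i, i < size l -> a + i < size prog /\
    nth (jump 0) prog (a + i) = nth (jump 0) l i.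

Lemma holds_cat a l l' :
  holds_at a (l ++ l') -> holds_at a l /\ holds_at (a + size l) l'.
Proof.
move=> h; split=> i lti; first by have := h i; rewrite size_cat nth_cat lti; apply; lia.
have := h (size l + i); rewrite size_cat nth_cat (_ : size l + i < size l = false) ?addnA; last lia.
by rewrite addKn; apply; lia.
Qed.

Lemma holds_cons a x l :
  holds_at a (x :: l) ->
  [/\ a < size prog, nth (jump 0) prog a = x & holds_at a.+1 l].
Proof.
move=> h; have [] := h 0 isT; rewrite addn0 => lta na; split=> // i lti.
by have := h i.+1; rewrite /= ltnS addnS -addSn; apply.
Qed.

(** Induction on the derivation rather than on the program: the remaining turns of a loop are a
    smaller derivation for the same code at the same address. *)
Lemma comp_reach c t t' n : exec c t t' n ->
  forall a, holds_at a (comp c a) -> reach a t n (a + len c) t'.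
Proof.
elim=> {c t t' n}.
- move=> f g p hp a /holds_cons[lta na _]; rewrite addn1.
  by apply: reach_step lta _ hp; rewrite na.
- move=> c1 c2 t t' t'' n m _ IH1 _ IH2 a /holds_cat[h1 h2].
  rewrite size_comp in h2; rewrite /= addnA.
  exact: reach_trans (IH1 _ h1) (IH2 _ h2).
- move=> b c1 c2 [g p] t' n bt _ IH a /holds_cons[lta na /holds_cat[h1]].
  rewrite size_comp => /holds_cons[lta' na' _].
  rewrite (_ : n.+2 = 1 + (n + 1)); last lia.
  apply: reach_trans (_ : reach _ _ _ a.+1 (g, p)) _.
    by apply: reach_stay lta _; rewrite na /branch bt.
  apply: reach_trans (IH _ h1) _; case: t' {IH} => g' p'.
  by apply: reach_stay lta' _; rewrite na'.
- move=> b c1 c2 [g p] t' n bt _ IH a /holds_cons[lta na /holds_cat[_]].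
  rewrite size_comp => /holds_cons[_ _ h2].
  rewrite -[n.+1]add1n; apply: reach_trans (_ : reach _ _ _ (a + (len c1).+2) (g, p)) _.
    by apply: reach_stay lta _; rewrite na /branch (negbTE bt).
  rewrite (_ : (a.+1 + len c1).+1 = a + (len c1).+2) in h2; last lia.
  have := IH _ h2; rewrite /= (_ : a + (len c1).+2 + len c2 = a + (len c1 + len c2).+2) //; lia.
- move=> b c [g p] bt a /holds_cons[lta na _].
  by apply: reach_stay lta _; rewrite na /branch (negbTE bt).
- move=> b c [g p] t' t'' n m bt _ IH1 _ IH2 a h.
  have /holds_cons[lta na /holds_cat[h1]] := h.
  rewrite size_comp => /holds_cons[lta' na' _].
  rewrite (_ : (n + m).+2 = 1 + (n + (1 + m))); last lia.
  apply: reach_trans (_ : reach _ _ _ a.+1 (g, p)) _.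
    by apply: reach_stay lta _; rewrite na /branch bt.
  apply: reach_trans (IH1 _ h1) _; apply: reach_trans (IH2 _ h).
  by case: t' {IH1 IH2} => g' p'; apply: reach_stay lta' _; rewrite na'.
Qed.

End Simulation.

(** The whole program has length [len c + 1], so the closing branch jumps to the accepting or to the
    rejecting state of [mk_tm]. *)
Definition decider (c : com) (b : pred Sg) : TM :=
  mk_tm (comp c 0 ++ [:: branch b (len c).+1 (len c).+2]).

(** The word starts at cell 1, which leaves cell 0 free for the end marker of the stack machine. *)
Definition input_tape (w : seq 'I_3) : tape :=
  (fun j => if j is i.+1 then nth blk (map emb w) i else blk, 1).

Lemma encs_emb i : encs (emb i) = inord i.+1.
Proof.
rewrite /encs (negbTE (emb_blk i)).
by case: pickP => [j /eqP/emb_inj ->|/(_ i)]; rewrite ?eqxx.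
Qed.

Lemma sim_init prog w : sim (input_tape w) (init (mk_tm prog) w).
Proof.
have nE j : nth (blank (mk_tm prog)) (map (in_sym (mk_tm prog)) w) j =
            encs (nth blk (map emb w) j).
  elim: w j => [|x w IH] [|j] //=; rewrite ?encs_blk //.
  by rewrite encs_emb.
split=> [j||j] /=.
- by rewrite nth_nil; case: j => [|j]; rewrite /= encs_blk.
- by rewrite -nth0 nE.
- by rewrite nth_behead nE.
Qed.

Lemma decider_correct c b w t' n T :
  exec c (input_tape w) t' n -> n < T ->
  let cf := run (decider c b) w T in
  halted cf /\ (c_state cf = tm_acc (decider c b) <-> b (t'.1 t'.2)).
Proof.
move=> hex ltT; rewrite /decider.
set prog := comp c 0 ++ _; set M := mk_tm prog.
have szp : size prog = (len c).+1 by rewrite /prog size_cat size_comp addn1.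
have hall : holds_at prog 0 prog by move=> i; rewrite add0n.
have [h1] := holds_cat hall; rewrite size_comp => /holds_cons[lta na _].
have := comp_reach hex h1; rewrite add0n => hr.
have : at_ (prog := prog) (if b (t'.1 t'.2) then (len c).+1 else (len c).+2) t'
          (iter (n + 1) (@step M) (init M w)).
  apply: (reach_trans hr (_ : @reach prog (len c) t' 1 _ t')).
    case: t' {hex hr} => g' p' /=; apply: reach_stay; first by rewrite add0n in lta.
    by move: na; rewrite add0n => ->.
  split; last exact: sim_init.
  by apply: val_inj; rewrite /= inordK.
case=> st _; set cf0 := iter _ _ _ in st.
have stE : (c_state cf0 : nat) = if b (t'.1 t'.2) then (len c).+1 else (len c).+2.
  by rewrite st inordK //= szp; case: ifP; lia.
have hcf0 : halted cf0.
  rewrite /halted -!val_eqE /= stE !inordK ?szp; [|lia..].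
  by case: ifP; rewrite eqxx ?orbT.
(* A halted configuration is a fixed point of [step], so every larger time bound serves as well. *)
have stp m : iter m (@step M) cf0 = cf0.
  by elim: m => // m IH; rewrite iterS IH /step hcf0.
rewrite /run (_ : T = T - (n + 1) + (n + 1)); last lia.
rewrite iterD -/cf0 stp; split=> //.
split=> [/(congr1 val) /=|hb].
  by rewrite stE inordK ?szp; [case: ifP => //; lia | lia].
by apply: val_inj; rewrite /= stE hb inordK szp //; lia.
Qed.

End StructuredTM.

(** * Stack machines *)

(** [None] is an empty cell of a track, [Some None] the separator, [Some (Some b)] a bit. A tape
    symbol is a column of four tracks or, in cell 0, [inr y]: this marks the left end and stores the
    symbol [y] popped last, the only thing that stack programs test. *)
Definition csym := option (option bool).
Definition cell := (csym * csym * csym * csym)%type.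
Definition sgm : finType := (cell + csym)%type.
Definition cblank : sgm := inl (None, None, None, None).
Definition bsym (i : 'I_3) : option bool :=
  match nat_of_ord i with 0 => Some false | 1 => Some true | _ => None end.
Definition cemb (i : 'I_3) : sgm := inl (None, Some (bsym i), None, None).

Lemma cemb_inj : injective cemb.
Proof.
by move=> [[|[|[|i]]] hi] [[|[|[|j]]] hj] //= _; apply: val_inj.
Qed.

Lemma cemb_blank i : cemb i != cblank. Proof. by []. Qed.

Inductive idx := iA | iB | iC | iD.

Definition getq {T} (i : idx) (q : T * T * T * T) : T :=
  let: (a, b, c, d) := q in
  match i with iA => a | iB => b | iC => c | iD => d end.

Definition setq {T} (i : idx) (x : T) (q : T * T * T * T) : T * T * T * T :=
  let: (a, b, c, d) := q in
  match i with
  | iA => (x, b, c, d) | iB => (a, x, c, d)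
  | iC => (a, b, x, d) | iD => (a, b, c, x)
  end.

Definition stk := seq (option bool).
Definition stks := (stk * stk * stk * stk)%type.

Inductive scom :=
| SPush of idx & option bool
| SPop of idx
| SSeq of scom & scom
| SIf of pred csym & scom & scom
| SWhile of pred csym & scom.

Inductive sexec : scom -> csym * stks -> csym * stks -> nat -> Prop :=
| X_push fl (s : stks) i x :
    sexec (SPush i x) (fl, s) (fl, setq i (x :: getq i s) s) 1
| X_pop fl (s : stks) i :
    sexec (SPop i) (fl, s) (ohead (getq i s), setq i (behead (getq i s)) s) 1
| X_seq c1 c2 t t' t'' n m : sexec c1 t t' n -> sexec c2 t' t'' m ->
    sexec (SSeq c1 c2) t t'' (n + m)
| X_ift (b : pred csym) c1 c2 t t' n : b t.1 -> sexec c1 t t' n ->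
    sexec (SIf b c1 c2) t t' n.+1
| X_iff (b : pred csym) c1 c2 t t' n : ~~ b t.1 -> sexec c2 t t' n ->
    sexec (SIf b c1 c2) t t' n.+1
| X_whf (b : pred csym) c t : ~~ b t.1 -> sexec (SWhile b c) t t 1
| X_wht (b : pred csym) c t t' t'' n m : b t.1 -> sexec c t t' n ->
    sexec (SWhile b c) t' t'' m -> sexec (SWhile b c) t t'' (n + m).+1.

Definition marker (x : sgm) := if x is inr _ then true else false.
Definition getc (i : idx) (x : sgm) : csym := if x is inl q then getq i q else None.
Definition putc (i : idx) (y : csym) (x : sgm) : sgm :=
  if x is inl q then inl (setq i y q) else x.

(** As elements of ['I_3], the constants [c0], [c1] and [csep] are 0, 1 and 2; here they denote the
    moves left, stay and right. *)
Definition goL : com sgm := Act (fun x => (x, c0)).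
Definition goR : com sgm := Act (fun x => (x, csep)).
Definition scan i : com sgm :=
  Seq goR (While (fun x : sgm => getc i x != None) goR).
Definition home : com sgm := While (fun x : sgm => ~~ marker x) goL.
Definition setflag (y : csym) : com sgm := Act (fun _ => (inr y, c1)).
Definition popk i x : com sgm :=
  Seq (Act (fun q => (putc i None q, c0))) (Seq home (setflag (Some x))).

Definition push_com i x : com sgm :=
  Seq (scan i) (Seq (Act (fun q => (putc i (Some x) q, c0))) home).
(** The top of stack [i] is just before the first empty cell of its track; finding the marker there
    means that the stack is empty. The popped symbol travels to cell 0 in the control state, hence
    one copy of [popk] for each of its three values. *)
Definition pop_com i : com sgm :=
  Seq (scan i) (Seq goL
    (If marker (setflag None)
    (If (fun q => getc i q == Some (Some true)) (popk i (Some true))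
    (If (fun q => getc i q == Some (Some false)) (popk i (Some false))
       (popk i None))))).

Definition onflag (b : pred csym) : pred sgm :=
  fun x => if x is inr y then b y else false.

Fixpoint tr (c : scom) : com sgm :=
  match c with
  | SPush i x => push_com i x
  | SPop i => pop_com i
  | SSeq c1 c2 => Seq (tr c1) (tr c2)
  | SIf b c1 c2 => If (onflag b) (tr c1) (tr c2)
  | SWhile b c => While (onflag b) (tr c)
  end.

Definition dig (s : stk) j : csym := nth None (map Some (rev s)) j.
Definition cellat (s : stks) j : cell :=
  (dig (getq iA s) j, dig (getq iB s) j, dig (getq iC s) j, dig (getq iD s) j).

Definition rep (t : csym * stks) (g : nat -> sgm) :=
  g 0 = inr t.1 /\ forall j, g j.+1 = inl (cellat t.2 j).

Lemma dig_cons x s j :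
  dig (x :: s) j = if j == size s then Some x else dig s j.
Proof.
rewrite /dig rev_cons map_rcons nth_rcons size_map size_rev.
case: ltngtP => // ltj; by rewrite [RHS]nth_default // size_map size_rev ltnW.
Qed.

Lemma dig_out s j : size s <= j -> dig s j = None.
Proof. by move=> h; rewrite /dig nth_default // size_map size_rev. Qed.

Lemma dig_in s j : j < size s -> dig s j != None.
Proof.
by move=> h; rewrite /dig (nth_map None) // size_rev.
Qed.

Lemma getc_cellat i s j : getc i (inl (cellat s j)) = dig (getq i s) j.
Proof. by case: i. Qed.

Lemma upd_id (g : nat -> sgm) p : upd g p (g p) =1 g.
Proof. by move=> j; rewrite /upd; case: eqP => [->|]. Qed.

Lemma rep_ext t g g' : g' =1 g -> rep t g -> rep t g'.
Proof. by move=> e [r0 r]; split=> [|j]; rewrite e. Qed.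

Lemma exec_goR g p : exec goR (g, p) (upd g p (g p), p.+1) 1.
Proof. exact: (@E_act sgm (fun x => (x, csep))). Qed.

Lemma exec_goL g p : exec goL (g, p.+1) (upd g p.+1 (g p.+1), p) 1.
Proof. exact: (@E_act sgm (fun x => (x, c0))). Qed.

Lemma exec_scan t i g : rep t g -> exists g',
  [/\ exec (scan i) (g, 0) (g', (size (getq i t.2)).+1) (3 * size (getq i t.2)).+2
    & rep t g'].
Proof.
move=> rg.
have loop d p g1 : rep t g1 -> p + d = size (getq i t.2) -> exists g',
    exec (While (fun x : sgm => getc i x != None) goR) (g1, p.+1)
      (g', (size (getq i t.2)).+1) (3 * d).+1 /\ rep t g'.
  elim: d p g1 => [|d IH] p g1 r1 pd.
    exists g1; split=> //; rewrite -pd addn0; apply: E_whf.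
    by case: r1 => _ r1; rewrite /= r1 getc_cellat negbK dig_out // -pd addn0.
  have [||g2 [e2 r2]] := IH p.+1 (upd g1 p.+1 (g1 p.+1)).
  - exact: rep_ext (upd_id _ _) r1.
  - by lia.
  exists g2; split=> //.
  rewrite (_ : (3 * d.+1).+1 = (1 + (3 * d).+1).+2); last lia.
  apply: E_wht e2; last exact: exec_goR.
  by case: r1 => _ r1; rewrite /= r1 getc_cellat dig_in //; lia.
have [g' [e' r']] := loop _ 0 _ (rep_ext (upd_id g 0) rg) (add0n _).
exists g'; split=> //; rewrite -[_.+2]add1n; apply: E_seq e'; exact: exec_goR.
Qed.

Lemma exec_home t p g : rep t g -> exists g',
  exec home (g, p) (g', 0) (3 * p).+1 /\ rep t g'.
Proof.
elim: p g => [|p IH] g rg.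
  by exists g; split=> //; apply: E_whf => /=; case: rg => ->.
have [|g' [e' r']] := IH (upd g p.+1 (g p.+1)); first exact: rep_ext (upd_id _ _) rg.
exists g'; split=> //.
rewrite (_ : (3 * p.+1).+1 = (1 + (3 * p).+1).+2); last lia.
apply: E_wht e'; last exact: exec_goL.
by case: rg => _ rg; rewrite /= rg.
Qed.

Lemma cellat_push i x s j : cellat (setq i (x :: getq i s) s) j =
  if j == size (getq i s) then setq i (Some x) (cellat s j) else cellat s j.
Proof.
by case: s => -[[a b] c] d; case: i; rewrite /cellat /= dig_cons; case: eqP.
Qed.

Lemma cellat_pop i x z s j : getq i s = x :: z -> cellat (setq i z s) j =
  if j == size z then setq i None (cellat s j) else cellat s j.
Proof.
by case: s => -[[a b] c] d; case: i => /= ->; rewrite /cellat /= dig_cons;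
  case: eqP => // ->; rewrite [dig z _]dig_out.
Qed.

Lemma exec_push fl s i x g : rep (fl, s) g -> exists g' n,
  [/\ exec (push_com i x) (g, 0) (g', 0) n,
      rep (fl, setq i (x :: getq i s) s) g' & n <= 6 * size (getq i s) + 10].
Proof.
move=> rg; have [g1 [e1 [r0 r1]]] := exec_scan i rg.
set z := size (getq i s) in e1 *.
set g2 := upd g1 z.+1 (putc i (Some x) (g1 z.+1)).
have r2 : rep (fl, setq i (x :: getq i s) s) g2.
  split=> [|j]; rewrite /g2 /upd //= eqSS cellat_push -/z.
  by case: eqP => [->|nj]; rewrite r1.
have [g3 [e3 r3]] := exec_home z r2.
have e2 : exec (Act (fun q => (putc i (Some x) q, c0))) (g1, z.+1) (g2, z) 1.
  exact: (@E_act sgm (fun q => (putc i (Some x) q, c0))).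
exists g3, ((3 * z).+2 + (1 + (3 * z).+1)); split=> //; last lia.
exact: E_seq e1 (E_seq e2 e3).
Qed.

Lemma exec_setflag fl' fl s g : rep (fl, s) g ->
  exec (setflag fl') (g, 0) (upd g 0 (inr fl'), 0) 1 /\
  rep (fl', s) (upd g 0 (inr fl')).
Proof.
move=> [r0 r1]; split; first exact: (@E_act sgm (fun _ => (inr fl', c1))).
by split.
Qed.

Lemma exec_popk fl s i x y z g : getq i s = x :: z -> rep (fl, s) g -> exists g',
  exec (popk i y) (g, (size z).+1) (g', 0) (3 * size z).+3 /\
  rep (Some y, setq i z s) g'.
Proof.
move=> ez [r0 r1]; set g2 := upd g (size z).+1 (putc i None (g (size z).+1)).
have r2 : rep (fl, setq i z s) g2.
  split=> [|j]; rewrite /g2 /upd //= eqSS (cellat_pop _ ez).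
  by case: eqP => [->|nj]; rewrite r1.
have [g3 [e3 r3]] := exec_home (size z) r2.
have [e4 r4] := exec_setflag (Some y) r3.
eexists; split; last exact: r4.
rewrite (_ : (3 * size z).+3 = 1 + ((3 * size z).+1 + 1)); last lia.
apply: E_seq (E_seq e3 e4).
by apply: (@E_act sgm (fun q => (putc i None q, c0))).
Qed.

Lemma exec_pop fl s i g : rep (fl, s) g -> exists g' n,
  [/\ exec (pop_com i) (g, 0) (g', 0) n,
      rep (ohead (getq i s), setq i (behead (getq i s)) s) g' &
      n <= 6 * size (getq i s) + 20].
Proof.
move=> rg; have [g1 [e1 r1]] := exec_scan i rg; rewrite /= in e1.
have r2 := rep_ext (upd_id g1 (size (getq i s)).+1) r1.
have e2 := exec_goL g1 (size (getq i s)).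
move: (upd _ _ _) r2 e2 => g2 r2 e2.
case E: (getq i s) e1 e2 => [|x z] e1 e2.
  have [e3 r3] := exec_setflag None r2.
  exists (upd g2 0 (inr None)); eexists; split.
  - apply: E_seq e1 (E_seq e2 _); apply: E_ift e3.
    by case: r2 => r2 _; rewrite /= r2.
  - rewrite (_ : setq _ _ _ = s) //; case: s E {rg r1 r2 r3} => -[[a b] c] d.
    by case: i {e1} => /= ->.
  - by [].
have gz : g2 (size z).+1 = inl (cellat s (size z)) by case: r2.
have dz : getc i (g2 (size z).+1) = Some x.
  by rewrite gz getc_cellat E dig_cons eqxx.
have [g3 [e3 r3]] := exec_popk x E r2.
exists g3.
suff [n [e4 n4]] : exists n, exec (If marker (setflag None)
    (If (fun q => getc i q == Some (Some true)) (popk i (Some true))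
    (If (fun q => getc i q == Some (Some false)) (popk i (Some false))
       (popk i None)))) (g2, (size z).+1) (g3, 0) n /\ n <= (3 * size z).+3 + 5.
  exists ((3 * (size z).+1).+2 + (1 + n)); split=> //=; last lia.
  by apply: E_seq e1 (E_seq e2 e4).
clear e1 e2 r3; case: x E dz e3 => [[]|] E dz e3.
- eexists; split; first by [apply: E_iff; [rewrite /= gz|apply: E_ift e3; rewrite /= dz]].
  by lia.
- eexists; split; first by [apply: E_iff; [rewrite /= gz|apply: E_iff; [rewrite /= dz|
     apply: E_ift e3; rewrite /= dz]]].
  by lia.
- eexists; split; first by [apply: E_iff; [rewrite /= gz|apply: E_iff; [rewrite /= dz|
     apply: E_iff e3; rewrite /= dz]]].
  by lia.
Qed.

Definition ssize (s : stks) :=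
  size (getq iA s) + size (getq iB s) + size (getq iC s) + size (getq iD s).

Lemma size_getq i s : size (getq i s) <= ssize s.
Proof. by rewrite /ssize; case: s => -[[a b] c] d; case: i => /=; lia. Qed.

Lemma ssize_setq i x s : ssize (setq i x s) + size (getq i s) = ssize s + size x.
Proof. by rewrite /ssize; case: s => -[[a b] c] d; case: i => /=; lia. Qed.

Lemma sexec_size c t t' n : sexec c t t' n -> ssize t'.2 <= ssize t.2 + n.
Proof.
elim=> {c t t' n}; try by move=> *; lia.
- move=> fl s i x; rewrite [(_, _).2]/= [X in _ <= X + _]/= -(leq_add2r (size (getq i s))).
  by rewrite ssize_setq addn1 addSnnS.
- move=> fl s i; rewrite [(_, _).2]/= [X in _ <= X + _]/= -(leq_add2r (size (getq i s))).
  by rewrite ssize_setq size_behead; apply: leq_add; [exact: leq_addr | exact: leq_pred].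
Qed.

(** [Z] bounds the total height of the stacks during the whole run, as a step adds at most one
    symbol. A push or pop walks to the top of a stack and back at three machine steps per cell and
    direction, which gives the factor [6 * Z + 20]. *)
Lemma tr_correct c t t' n : sexec c t t' n -> forall g Z, rep t g ->
  ssize t.2 + n <= Z -> exists g' m,
  [/\ exec (tr c) (g, 0) (g', 0) m, rep t' g' & m <= n * (6 * Z + 20)].
Proof.
elim=> {c t t' n} /=.
- move=> fl s i x g Z rg hZ; have [g' [m [e r hm]]] := exec_push i x rg.
  exists g', m; split=> //; apply: leq_trans hm _.
  by move: (leq_trans (size_getq i s) (leq_addr 1 _)); move: (size _) => z hz; lia.
- move=> fl s i g Z rg hZ; have [g' [m [e r hm]]] := exec_pop i rg.
  exists g', m; split=> //; apply: leq_trans hm _.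
  by move: (leq_trans (size_getq i s) (leq_addr 1 _)); move: (size _) => z hz; lia.
- move=> c1 c2 t t' t'' n m h1 IH1 h2 IH2 g Z rg hZ.
  have [|g1 [m1 [e1 r1 b1]]] := IH1 _ Z rg; first lia.
  have [|g2 [m2 [e2 r2 b2]]] := IH2 _ Z r1; first by have := sexec_size h1; lia.
  exists g2, (m1 + m2); split=> //; first exact: E_seq e1 e2.
  by lia.
- move=> b c1 c2 t t' n bt h IH g Z rg hZ.
  have [|g1 [m1 [e1 r1 b1]]] := IH _ Z rg; first lia.
  exists g1, m1.+2; split=> //; last by rewrite mulSn; lia.
  by apply: E_ift e1; case: rg => /= ->.
- move=> b c1 c2 t t' n bt h IH g Z rg hZ.
  have [|g1 [m1 [e1 r1 b1]]] := IH _ Z rg; first lia.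
  exists g1, m1.+1; split=> //; last by rewrite mulSn; lia.
  by apply: E_iff e1; case: rg => /= ->.
- move=> b c t bt g Z rg hZ; exists g, 1; split=> //; last lia.
  by apply: E_whf; case: rg => /= ->.
- move=> b c t t' t'' n m bt h1 IH1 h2 IH2 g Z rg hZ.
  have [|g1 [m1 [e1 r1 b1]]] := IH1 _ Z rg; first lia.
  have [|g2 [m2 [e2 r2 b2]]] := IH2 _ Z r1; first by have := sexec_size h1; lia.
  exists g2, (m1 + m2).+2; split=> //; last by rewrite mulSn mulnDl; lia.
  by apply: E_wht e1 e2; case: rg => /= ->.
Qed.

Definition boot : com sgm := Seq goL (setflag None).

Definition stk_decider (c : scom) (b : pred csym) : TM :=
  decider cblank cemb (Seq boot (tr c)) (onflag b).

Lemma stk_decider_correct c b w t' n T :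
  sexec c (None, ([::], rev (map bsym w), [::], [::])) t' n ->
  n * (6 * (size w + n) + 20) + 2 < T ->
  let cf := run (stk_decider c b) w T in
  halted cf /\ (c_state cf = tm_acc (stk_decider c b) <-> b t'.1).
Proof.
move=> hc hT.
have r0 : rep (None, ([::], rev (map bsym w), [::], [::]))
    (upd (upd (input_tape cblank cemb w).1 1 ((input_tape cblank cemb w).1 1)) 0 (inr None)).
  split=> // j; rewrite /upd /= /cellat /dig /= revK.
  have -> : (if j.+1 == 1 then nth cblank [seq cemb i | i <- w] 0 else nth cblank [seq cemb i | i <- w] j)
     = nth cblank [seq cemb i | i <- w] j by case: j.
  rewrite -map_comp nth_nil; have [ltj|lej] := ltnP j (size w).
    by rewrite !(nth_map c0).
  by rewrite !nth_default ?size_map.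
have [|g' [m [e' r' hm]]] := tr_correct hc r0 (Z := size w + n).
  by rewrite /ssize /= size_rev size_map; lia.
have e0 : exec boot (input_tape cblank cemb w)
   (upd (upd (input_tape cblank cemb w).1 1 ((input_tape cblank cemb w).1 1)) 0 (inr None), 0) 2.
  apply: (@E_seq _ _ _ _ _ _ 1 1); first exact: exec_goL.
  exact: (@E_act sgm (fun _ => (inr None, c1))).
have := decider_correct cemb_inj cemb_blank (onflag b) (E_seq e0 e').
case: r' => r' _; rewrite /= r' /=; apply; lia.
Qed.

(** * Trees on a stack *)

Inductive tree := Lf | Nd of tree & tree.

Fixpoint code (x : tree) : stk :=
  match x with
  | Lf => [:: Some false]
  | Nd a b => Some true :: code a ++ code b
  end.

Lemma size_code x : 0 < size (code x). Proof. by case: x. Qed.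

Definition mem4 (a b c d : stk) : stks := (a, b, c, d).
Definition istrue : pred csym := fun y => y == Some (Some true).
Definition isbit : pred csym := fun y => y != None.

Lemma X_seq_eq c1 c2 t t' t'' n m k :
  sexec c1 t t' n -> sexec c2 t' t'' m -> k = n + m -> sexec (SSeq c1 c2) t t'' k.
Proof. by move=> h1 h2 ->; apply: X_seq h1 h2. Qed.

(* The unary counter on [iC] holds the number of subtrees of the Polish word on
   [iA] still to be read. *)
Definition mvbody X : scom :=
  SSeq (SPop iA)
    (SSeq (SIf istrue (SSeq (SPush iC (Some true))
                         (SSeq (SPush iC (Some true)) (SPush X (Some true))))
                      (SPush X (Some false)))
          (SPop iC)).
Definition mv X : scom :=
  SSeq (SPush iC (Some true)) (SSeq (SPop iC) (SWhile istrue (mvbody X))).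

Definition out2 X (a r c : stk) (u : stk) : stks :=
  match X with iB => mem4 a r c u | _ => mem4 a u c r end.

(** Stated with a continuation: any run of the loop that follows the reading of [x] can be prefixed
    by that reading. In the induction, the right subtree becomes part of the continuation of the
    left one. *)
Lemma mv_loop X x : X = iB \/ X = iD ->
  exists2 k, k <= 8 * size (code x) & forall rest r u cc sf n,
  sexec (SWhile istrue (mvbody X))
    (ohead cc, out2 X rest (rev (code x) ++ r) (behead cc) u) sf n ->
  sexec (SWhile istrue (mvbody X))
    (Some (Some true), out2 X (code x ++ rest) r cc u) sf (k + n).
Proof.
move=> hX; elim: x => [|a [ka ha IHa] b [kb hb IHb]].
  (* Loop test, pop, test of the symbol, push, and pop of the counter. *)
  exists 5 => // rest r u cc sf n h; rewrite (_ : 5 + n = (4 + n).+1) //.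
  case: hX h => -> /= h; apply: X_wht h => //;
  apply: (X_seq_eq (X_pop _ _ _)); [|reflexivity| |reflexivity] => /=;
  by apply: (X_seq_eq (X_iff _ _ (X_push _ _ _ _)) (X_pop _ _ _)).
exists (7 + ka + kb); first by rewrite /= size_cat; lia.
move=> rest r u cc sf n h; rewrite -!addnA [7 + _](_ : _ = (6 + (ka + (kb + n))).+1) //.
apply: (@X_wht _ _ _ (Some (Some true), out2 X (code a ++ (code b ++ rest)) (Some true :: r) (Some true :: cc) u)) => //.
  rewrite /= catA; case: hX => -> /=;
  apply: (X_seq_eq (X_pop _ _ _)); [|reflexivity| |reflexivity] => /=;
  by apply: (X_seq_eq (X_ift _ _ (X_seq (X_push _ _ _ _)
       (X_seq (X_push _ _ _ _) (X_push _ _ _ _)))) (X_pop _ _ _)).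
apply: IHa; apply: IHb; rewrite /= in h *.
by move: h; rewrite rev_cons rev_cat cat_rcons -!catA.
Qed.

Lemma mv_correct X x : X = iB \/ X = iD ->
  exists2 k, k <= 8 * size (code x) + 3 & forall fl rest u,
  exists fl', sexec (mv X) (fl, out2 X (code x ++ rest) [::] [::] u)
     (fl', out2 X rest (rev (code x)) [::] u) k.
Proof.
move=> hX; have [k hk h] := mv_loop x hX.
exists (2 + (k + 1)); first lia.
move=> fl rest u; exists None.
have /h : sexec (SWhile istrue (mvbody X))
    (ohead [::], out2 X rest (rev (code x) ++ [::]) (behead [::]) u)
    (None, out2 X rest (rev (code x)) [::] u) 1.
  by rewrite cats0; apply: X_whf.
move=> {}h; rewrite -[2 + _]/(1 + (1 + (k + 1))).
by rewrite /mv; case: hX h => -> /= h; apply: X_seq_eq (X_push _ _ _ _) _ erefl;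
  apply: X_seq_eq (X_pop _ _ _) _ erefl; exact: h.
Qed.

Definition xbody X (o : bool -> scom) : scom :=
  SSeq (SIf istrue (o true) (o false)) (SPop X).
Definition xfer X (o : bool -> scom) : scom :=
  SSeq (SPop X) (SWhile isbit (xbody X o)).

Section Xfer.
Variables (X : idx) (o : bool -> scom) (S : stk -> stk -> stks) (K : nat).
Hypothesis SX : forall w v, getq X (S w v) = w.
Hypothesis SX' : forall x w v, setq X w (S (x :: w) v) = S w v.
Hypothesis SX0 : forall v, setq X [::] (S [::] v) = S [::] v.
Hypothesis So : forall fl b w v, sexec (o b) (fl, S w v) (fl, S w (Some b :: v)) K.

(** [S w v] abstracts the layout: [w] is left on the source and [v] has been written. This covers
    every source and destination, including the simultaneous copy to two stacks. *)
Lemma xfer_correct (w : seq bool) fl v : exists fl',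
  sexec (xfer X o) (fl, S (map Some w) v) (fl', S [::] (rev (map Some w) ++ v))
     ((K + 3) * size w + 2).
Proof.
exists None.
have loop : sexec (SWhile isbit (xbody X o))
    (ohead (map Some w), setq X (behead (map Some w)) (S (map Some w) v))
    (None, S [::] (rev (map Some w) ++ v)) ((K + 3) * size w + 1).
  elim: w v => [|b w IH] v /=; first by rewrite SX0 muln0; apply: X_whf.
  rewrite SX' mulnS (_ : _ + _ + 1 = (K.+1 + 1 + ((K + 3) * size w + 1)).+1); last lia.
  apply: (@X_wht _ _ _ (ohead (map Some w), setq X (behead (map Some w)) (S (map Some w) (Some b :: v)))) => //; last first.
    by rewrite rev_cons cat_rcons.
  apply: (@X_seq _ _ _ (Some (Some b), S (map Some w) (Some b :: v))).
    case: b; [exact: X_ift | exact: X_iff].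
  have := X_pop (Some (Some b)) (S (map Some w) (Some b :: v)) X.
  by rewrite SX.
have := X_pop fl (S (map Some w) v) X; rewrite SX => hp.
by apply: X_seq_eq hp loop _; lia.
Qed.
End Xfer.

Lemma code_bits x : exists w : seq bool, code x = map Some w.
Proof.
elim: x => [|a [u eu] b [v ev]]; first by exists [:: false].
by exists (true :: u ++ v); rewrite /= eu ev map_cat.
Qed.

(** The calling convention: between operations only [iA] holds data, the other stacks are empty
    scratch space, and the flag is arbitrary. *)
Definition sx (P : scom) (A A' : stk) n := forall fl, exists fl',
  sexec P (fl, mem4 A [::] [::] [::]) (fl', mem4 A' [::] [::] [::]) n.

Lemma sx_seq P Q A A' A'' n m :
  sx P A A' n -> sx Q A' A'' m -> sx (SSeq P Q) A A'' (n + m).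
Proof.
by move=> h1 h2 fl; have [f1 e1] := h1 fl; have [f2 e2] := h2 f1; exists f2; apply: X_seq e1 e2.
Qed.

Definition outA (b : bool) := SPush iA (Some b).
Definition outB (b : bool) := SPush iB (Some b).
Definition outAD (b : bool) := SSeq (SPush iA (Some b)) (SPush iD (Some b)).

Lemma x_seqE P Q t t' t'' n m k :
  (exists f, sexec P t (f, t') n) -> (forall f, exists f', sexec Q (f, t') (f', t'') m) ->
  k = n + m -> exists f, sexec (SSeq P Q) t (f, t'') k.
Proof.
by move=> [f1 e1] h ->; have [f2 e2] := h f1; exists f2; apply: X_seq e1 e2.
Qed.

Definition DROP := SSeq (mv iB) (SSeq (SPop iB) (SWhile isbit (SPop iB))).
(** Moving a tree away reverses its code and the transfer back restores it; emptying [iB] before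
    [iD] leaves the second tree on top. *)
Definition SWAP := SSeq (mv iB) (SSeq (mv iD) (SSeq (xfer iB outA) (xfer iD outA))).
(** The copy made on [iD] is already in the right order, so it goes through [iB] to be reversed
    twice on its way to [iA]. *)
Definition DUP := SSeq (mv iB) (SSeq (xfer iB outAD) (SSeq (xfer iD outB) (xfer iB outA))).

Lemma drop_correct x :
  exists2 n, n <= 20 * size (code x) & forall rest, sx DROP (code x ++ rest) rest n.
Proof.
have [k hk h] := mv_correct x (or_introl (erefl iB)).
exists (k + (1 + (2 * size (code x) + 1))); first by have := size_code x; lia.
move=> rest fl; apply: x_seqE (h fl rest [::]) _ erefl => {}fl /=.
exists None; rewrite -(size_rev (code x)); have [w ->] := code_bits x; rewrite -map_rev.
apply: X_seq (X_pop _ _ _) _ => /=.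
elim: (rev w) => [|b s IH] /=; first by apply: X_whf.
rewrite (_ : _ + 1 = (1 + (2 * size (map Some s) + 1)).+1); last by rewrite /=; lia.
by apply: X_wht (X_pop _ _ _) _ => //; exact: IH.
Qed.

Lemma swap_correct x y :
  exists2 n, n <= 20 * (size (code x) + size (code y)) &
    forall rest, sx SWAP (code x ++ code y ++ rest) (code y ++ code x ++ rest) n.
Proof.
have [k hk h] := mv_correct x (or_introl (erefl iB)).
have [k' hk' h'] := mv_correct y (or_intror (erefl iD)).
have [u eu] := code_bits x; have [v ev] := code_bits y.
rewrite eu ev !size_map in hk hk' h h' *.
exists (k + (k' + (4 * size u + 2 + (4 * size v + 2)))).
  have := size_code x; have := size_code y; rewrite eu ev !size_map; lia.
move=> rest fl.
apply: x_seqE (h fl _ [::]) _ erefl => {}fl /=.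
apply: x_seqE (h' fl rest (rev (map Some u))) _ erefl => {}fl /=.
rewrite -!map_rev -(size_rev u) -(size_rev v).
apply: (@x_seqE _ _ _ (mem4 (map Some u ++ rest) [::] [::] (map Some (rev v)))) _ _ erefl.
  have := @xfer_correct iB outA (fun w a => mem4 a w [::] (map Some (rev v))) 1
   _ _ _ _ (rev u) fl rest.
  rewrite -map_rev revK; apply=> // *; exact: X_push.
move=> {}fl.
have := @xfer_correct iD outA (fun w a => mem4 a [::] [::] w) 1
   _ _ _ _ (rev v) fl (map Some u ++ rest).
rewrite -map_rev revK; apply=> // *; exact: X_push.
Qed.

Lemma dup_correct x :
  exists2 n, n <= 40 * size (code x) &
    forall rest, sx DUP (code x ++ rest) (code x ++ code x ++ rest) n.
Proof.
have [k hk h] := mv_correct x (or_introl (erefl iB)).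
have [u eu] := code_bits x; rewrite eu !size_map in hk h *.
exists (k + (5 * size u + 2 + (4 * size u + 2 + (4 * size u + 2)))).
  have := size_code x; rewrite eu !size_map; lia.
move=> rest fl.
apply: x_seqE (h fl _ [::]) _ erefl => {}fl /=; rewrite -!map_rev.
apply: (@x_seqE _ _ _ (mem4 (map Some u ++ rest) [::] [::] (map Some u))) _ _ erefl.
  pose S w v := mem4 (v ++ rest) w [::] v.
  have So f b w v : sexec (outAD b) (f, S w v) (f, S w (Some b :: v)) 2.
    by apply: (X_seq (n := 1) (m := 1)); [apply: X_push|apply: X_push].
  have := @xfer_correct iB outAD S 2 _ _ _ So (rev u) fl [::].
  case=> // fl' e.
  by exists fl'; move: e; rewrite -map_rev revK cats0 size_rev.
move=> {}fl.
apply: (@x_seqE _ _ _ (mem4 (map Some u ++ rest) (map Some (rev u)) [::] [::])) _ _ erefl.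
  have := @xfer_correct iD outB (fun w v => mem4 (map Some u ++ rest) v [::] w) 1
    _ _ _ _ u fl [::].
  rewrite -map_rev cats0; apply=> // *; exact: X_push.
move=> {}fl; rewrite -(size_rev u).
have := @xfer_correct iB outA (fun w a => mem4 a w [::] [::]) 1
   _ _ _ _ (rev u) fl (map Some u ++ rest).
rewrite -map_rev revK; apply=> // *; exact: X_push.
Qed.

(** * Functions computable within a polynomial bound *)

Class Enc (A : Type) := enc : A -> tree.

#[export] Instance enc_bool : Enc bool := fun b => if b then Nd Lf Lf else Lf.
(** Unary is affordable for labels, lengths and [k]; residues are bit lists. With this choice [n]
    has the code of a list of [n] times [false], and several conversions are free. *)
#[export] Instance enc_unary : Enc nat :=
  fix f n := if n is m.+1 then Nd Lf (f m) else Lf.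
#[export] Instance enc_prod A B (eA : Enc A) (eB : Enc B) : Enc (A * B) :=
  fun x => Nd (enc x.1) (enc x.2).
#[export] Instance enc_seq A (eA : Enc A) : Enc (seq A) :=
  fix f s := if s is x :: s' then Nd (enc x) (f s') else Lf.

Definition sz {A} {eA : Enc A} (a : A) := size (code (enc a)).

Section Bdd.
Variables (A : Type) (be : A -> nat).
(** The base is at least 2, so a single power absorbs constants, sums and products: these are the
    functions bounded by a polynomial in [be]. *)
Definition bdd (T : A -> nat) := exists d, forall a, T a <= (be a).+2 ^ d.

Lemma bdd_le T T' : (forall a, T a <= T' a) -> bdd T' -> bdd T.
Proof. by move=> h [d hd]; exists d => a; apply: leq_trans (h a) (hd a). Qed.

Lemma bdd_c c : bdd (fun => c).
Proof.
exists c => a; apply: leq_trans (ltnW (ltn_expl c (isT : 1 < 2))) _.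
by case: c => // c; rewrite leq_exp2r.
Qed.

Lemma bdd_self : bdd be.
Proof. by exists 1 => a; rewrite expn1; lia. Qed.

Lemma bdd_add T T' : bdd T -> bdd T' -> bdd (fun a => T a + T' a).
Proof.
move=> [d hd] [d' hd']; exists (d + d').+1 => a.
have hx : 0 < (be a).+2 by [].
have h1 : T a <= (be a).+2 ^ (d + d').
  by apply: leq_trans (hd a) _; rewrite leq_pexp2l // leq_addr.
have h2 : T' a <= (be a).+2 ^ (d + d').
  by apply: leq_trans (hd' a) _; rewrite leq_pexp2l // leq_addl.
rewrite expnS; nia.
Qed.

Lemma bdd_mul T T' : bdd T -> bdd T' -> bdd (fun a => T a * T' a).
Proof.
by move=> [d hd] [d' hd']; exists (d + d') => a; rewrite expnD leq_mul.
Qed.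

Lemma bdd_exp T e : bdd T -> bdd (fun a => T a ^ e).
Proof.
move=> hT; elim: e => [|e IH].
  by apply: bdd_le (bdd_c 1) => a; rewrite expn0.
by apply: bdd_le (bdd_mul hT IH) => a; rewrite expnS.
Qed.
End Bdd.

Lemma bdd_comp A A' (be : A -> nat) (be' : A' -> nat) T (g : A -> A') :
  bdd be' T -> bdd be (fun a => be' (g a)) -> bdd be (fun a => T (g a)).
Proof.
move=> [d hd] hb.
apply: (@bdd_le _ _ _ (fun a => (be' (g a) + 2) ^ d)) => [a|].
  by rewrite addn2.
by apply: bdd_exp; apply: bdd_add hb (bdd_c _ _).
Qed.

Ltac bd := repeat first
  [ exact: bdd_self | exact: bdd_c | assumption
  | apply: bdd_add | apply: bdd_mul | apply: bdd_exp ].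

Lemma bdd_wk A (be be' : A -> nat) T :
  (forall a, be a <= be' a) -> bdd be T -> bdd be' T.
Proof.
move=> h hT; apply: (@bdd_comp _ _ be' be T id hT).
by apply: bdd_le h (bdd_self _).
Qed.

Definition cmp {A C} {eA : Enc A} {eC : Enc C} P (a : A) (c : C) n :=
  forall rest, sx P (code (enc a) ++ rest) (code (enc c) ++ rest) n.

Lemma cmp_sz A C {eA : Enc A} {eC : Enc C} P (a : A) (c : C) n :
  cmp P a c n -> sz c <= sz a + n.
Proof.
move/(_ [::] None) => [fl /sexec_size]; by rewrite !cats0 /ssize /= !addn0.
Qed.

Lemma sz_gt0 A {eA : Enc A} (a : A) : 0 < sz a. Proof. exact: size_code. Qed.

Lemma sz_pair A C {eA : Enc A} {eC : Enc C} (a : A) (c : C) :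
  sz (a, c) = (sz a + sz c).+1.
Proof. by rewrite /sz /= size_cat. Qed.

Lemma sz_cons A {eA : Enc A} (a : A) s : sz (a :: s) = (sz a + sz s).+1.
Proof. by rewrite /sz /= size_cat. Qed.

(** One program serves all arguments and, through [cmp], runs above any further contents of the
    stack. With [B = 0] this is polynomial time. *)
Definition TB {A C} {eA : Enc A} {eC : Enc C} (B : A -> nat) (f : A -> C) :=
  exists P T, bdd (fun a => sz a + B a) T /\
    forall a, exists2 n, n <= T a & cmp P a (f a) n.
Notation PT := (TB (fun => 0)).

Lemma TB_sz A C {eA : Enc A} {eC : Enc C} (B : A -> nat) (f : A -> C) :
  TB B f -> bdd (fun a => sz a + B a) (fun a => sz (f a)).
Proof.
move=> [P [T [bT h]]].
apply: (@bdd_le _ _ _ (fun a => (sz a + B a) + T a)); last exact: bdd_add (bdd_self _) bT.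
by move=> a; have [n hn hc] := h a; have := cmp_sz hc; lia.
Qed.

Lemma TB_wk A C {eA : Enc A} {eC : Enc C} (B B' : A -> nat) (f : A -> C) :
  (forall a, B a <= B' a) -> TB B f -> TB B' f.
Proof.
move=> hB [P [T [bT h]]]; exists P, T; split=> //; apply: bdd_wk bT => a.
by have := hB a; lia.
Qed.

Lemma PT_TB A C {eA : Enc A} {eC : Enc C} (B : A -> nat) (f : A -> C) :
  PT f -> TB B f.
Proof. exact: TB_wk. Qed.

Definition NOP := SSeq (SPush iA None) (SPop iA).

(** Programs see only codes, so a change of type that keeps the code costs nothing. *)
Lemma TB_cast A C E {eA : Enc A} {eC : Enc C} {eE : Enc E} (B : A -> nat)
    (f : A -> C) (g : A -> E) :
  (forall a, enc (f a) = enc (g a)) -> TB B f -> TB B g.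
Proof.
move=> e [P [T [bT h]]]; exists P, T; split=> // a; have [n hn hc] := h a.
by exists n => // rest; rewrite -e.
Qed.

Lemma TB_ext A C {eA : Enc A} {eC : Enc C} (B : A -> nat) (f g : A -> C) :
  f =1 g -> TB B f -> TB B g.
Proof. by move=> e; apply: TB_cast => a; rewrite e. Qed.

Lemma TB_id A {eA : Enc A} (B : A -> nat) : TB B (fun a => a).
Proof.
exists NOP, (fun => 2); split; first exact: bdd_c.
move=> a; exists 2 => // rest fl; exists (Some None).
exact: (X_seq (n := 1) (X_push _ _ _ _) (X_pop _ _ _)).
Qed.

Lemma TB_compB A C E {eA : Enc A} {eC : Enc C} {eE : Enc E} (B : A -> nat) (B' : C -> nat)
    (g : C -> E) (f : A -> C) :
  TB B' g -> TB B f -> bdd (fun a => sz a + B a) (fun a => B' (f a)) ->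
  TB B (fun a => g (f a)).
Proof.
move=> [Q [U [bU hU]]] hf bf; have [P [T [bT hT]]] := hf.
exists (SSeq P Q), (fun a => T a + U (f a)); split.
  apply: bdd_add bT _; apply: bdd_comp bU _.
  by apply: bdd_add (TB_sz hf) bf.
move=> a; have [n hn cn] := hT a; have [m hm cm] := hU (f a).
exists (n + m); first lia.
by move=> rest; apply: sx_seq (cn rest) (cm rest).
Qed.

Lemma TB_comp A C E {eA : Enc A} {eC : Enc C} {eE : Enc E} (B : A -> nat)
    (g : C -> E) (f : A -> C) :
  PT g -> TB B f -> TB B (fun a => g (f a)).
Proof. by move=> hg hf; apply: TB_compB hg hf (bdd_c _ 0). Qed.

Lemma sx_pop x A : sx (SPop iA) (x :: A) A 1.
Proof. by move=> fl; exists (Some x); apply: (X_pop fl (mem4 (x :: A) [::] [::] [::])). Qed.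

Lemma sx_push x A : sx (SPush iA x) A (x :: A) 1.
Proof. by move=> fl; exists fl; apply: (X_push fl (mem4 A [::] [::] [::])). Qed.

(** The argument is duplicated, [g] consumes the upper copy and, after a swap, [f] the other one;
    the tag of the pair is pushed last. *)
Lemma TB_pair A C E {eA : Enc A} {eC : Enc C} {eE : Enc E} (B : A -> nat)
    (f : A -> C) (g : A -> E) :
  TB B f -> TB B g -> TB B (fun a => (f a, g a)).
Proof.
move=> hf hg; have [P [T [bT hT]]] := hf; have [Q [U [bU hU]]] := hg.
exists (SSeq DUP (SSeq Q (SSeq SWAP (SSeq P (SPush iA (Some true)))))).
exists (fun a => (40 * (sz a + B a) + (U a + (20 * (sz (g a) + (sz a + B a)) + (T a + 1))))); split.
  by have bg := TB_sz hg; bd.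
move=> a; have [n hn cn] := hT a; have [m hm cm] := hU a.
have [k hk ck] := dup_correct (enc a); have [l hl cl] := swap_correct (enc (g a)) (enc a).
exists (k + (m + (l + (n + 1)))); first by rewrite /sz in hk hl *; lia.
move=> rest; apply: sx_seq (ck rest) _; apply: sx_seq (cm _) _.
apply: sx_seq (cl rest) _; apply: sx_seq (cn _) _.
by rewrite /= -catA; apply: sx_push.
Qed.

Lemma PT_snd A C {eA : Enc A} {eC : Enc C} : PT (fun t : A * C => t.2).
Proof.
exists (SSeq (SPop iA) DROP), (fun a => 1 + 20 * (sz a + 0)); split.
  by bd.
move=> [a c] /=; have [k hk ck] := drop_correct (enc a).
exists (1 + k); first by rewrite sz_pair /sz in hk *; lia.
by move=> rest; rewrite /= -catA; apply: sx_seq (sx_pop _ _) _.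
Qed.

Lemma PT_fst A C {eA : Enc A} {eC : Enc C} : PT (fun t : A * C => t.1).
Proof.
exists (SSeq (SPop iA) (SSeq SWAP DROP)), (fun a => 1 + (20 * (sz a + 0) + 20 * (sz a + 0))); split.
  by bd.
move=> [a c] /=; have [k hk ck] := drop_correct (enc c).
have [l hl cl] := swap_correct (enc a) (enc c).
exists (1 + (l + k)); first by rewrite sz_pair /sz in hk hl *; lia.
move=> rest; rewrite /= -catA; apply: sx_seq (sx_pop _ _) _.
by apply: sx_seq (cl _) (ck _).
Qed.

Lemma TB_fst A C E {eA : Enc A} {eC : Enc C} {eE : Enc E} (B : E -> nat) (f : E -> A * C) :
  TB B f -> TB B (fun e => (f e).1).
Proof. exact: TB_comp PT_fst. Qed.

Lemma TB_snd A C E {eA : Enc A} {eC : Enc C} {eE : Enc E} (B : E -> nat) (f : E -> A * C) :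
  TB B f -> TB B (fun e => (f e).2).
Proof. exact: TB_comp PT_snd. Qed.

Fixpoint pushes (s : stk) : scom :=
  if s is x :: s' then SSeq (pushes s') (SPush iA x) else NOP.

Lemma sx_pushes s A : sx (pushes s) A (s ++ A) (size s + 2).
Proof.
elim: s => [|x s IH] /=.
  move=> fl; exists (Some None).
  exact: (X_seq (n := 1) (X_push fl (mem4 A [::] [::] [::]) iA None) (X_pop _ _ _)).
by rewrite addSn -addn1; apply: sx_seq IH _; apply: sx_push.
Qed.

Lemma TB_const A C {eA : Enc A} {eC : Enc C} (B : A -> nat) (c : C) : TB B (fun=> c).
Proof.
exists (SSeq DROP (pushes (code (enc c)))), (fun a => 20 * (sz a + B a) + (sz c + 2)); split.
  by bd.
move=> a; have [k hk ck] := drop_correct (enc a).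
exists (k + (sz c + 2)); first by rewrite /sz in hk *; lia.
move=> rest; apply: sx_seq (ck _) _; exact: sx_pushes.
Qed.

(** In the code of [(l e, e)] the second symbol tells whether [l e] is empty. Popping two symbols
    leaves [e] if it is, and otherwise [y], [s], [e], which two pushed tags turn into
    [((y, s), e)]. *)
Lemma TB_case E Y C {eE : Enc E} {eY : Enc Y} {eC : Enc C} (B : E -> nat)
    (l : E -> seq Y) (f : E -> C) (g : (Y * seq Y) * E -> C) :
  TB B l -> TB B f -> TB (fun t => B t.2) g ->
  TB B (fun e => if l e is y :: s then g ((y, s), e) else f e).
Proof.
move=> hl hf [Q [U [bU hU]]]; have [P [T [bT hT]]] := hf.
have [R [V [bV hV]]] := TB_pair hl (TB_id B).
set be := fun a => sz a + B a in bT bV *.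
pose U' e := if l e is y :: s then U ((y, s), e) else 0.
exists (SSeq R (SSeq (SPop iA) (SSeq (SPop iA) (SIf istrue
  (SSeq (SPush iA (Some true)) (SSeq (SPush iA (Some true)) Q)) P)))).
exists (fun e => V e + (T e + U' e + 5)); split.
  apply: bdd_add (bV) _; apply: bdd_add (bdd_c _ _); apply: bdd_add (bT) _.
  case: bU => d hd.
  apply: (@bdd_le _ _ _ (fun e => (sz (l e) + be e + 3) ^ d)).
    move=> e; rewrite /U'; case El: (l e) => [|y s] //.
    apply: leq_trans (hd _) _; case: d {hd} => // d; rewrite leq_exp2r //.
    by rewrite /be !sz_pair sz_cons /=; lia.
  have bs := bdd_self be; have bl := TB_sz hl.
  by bd.
move=> e; have [n hn cn] := hV e; have [m hm cm] := hT e.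
rewrite /cmp /= in cn; rewrite /U'; case: (l e) cn => [|y s] cn.
  exists (n + (1 + (1 + m.+1))); first lia.
  move=> rest; apply: sx_seq (cn _) _; apply: sx_seq (sx_pop _ _) _ => fl.
  have [fl' e'] := cm rest (Some (Some false)).
  exists fl'; apply: X_seq (X_pop _ _ _) _ => /=; exact: X_iff e'.
have [k hk ck] := hU ((y, s), e).
exists (n + (1 + (1 + (1 + (1 + k)).+1))); first lia.
move=> rest; apply: sx_seq (cn _) _; apply: sx_seq (sx_pop _ _) _ => fl.
have [fl' e'] := ck rest (Some (Some true)).
exists fl'; apply: X_seq (X_pop _ _ _) _; apply: X_ift => //.
by do 2! apply: X_seq (X_push _ _ _ _) _.
Qed.

Lemma TB_if E C {eE : Enc E} {eC : Enc C} (B : E -> nat)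
    (c : E -> bool) (f g : E -> C) :
  TB B c -> TB B f -> TB B g -> TB B (fun e => if c e then f e else g e).
Proof.
move=> hc hf hg.
(* These lists have the codes of [true] and [false], so a boolean test is a case distinction on
   lists. *)
pose l e : seq bool := if c e then [:: false] else [::].
have hl : TB B l by apply: TB_cast hc => e; rewrite /l; case: (c e).
apply: (@TB_ext _ _ _ _ _ (fun e => if l e is y :: s then f e else g e)) => [e|].
  by rewrite /l; case: (c e).
apply: (TB_case (g := fun t => f t.2)) hl hg _.
apply: TB_compB hf (PT_TB _ PT_snd) _.
by apply: bdd_le (bdd_self _) => t; exact: leq_addl.
Qed.

(** The list is only a clock: each turn drops its head and swaps the rest below the state while [P]
    acts. Popping the leading tag of the rest decides about the next turn. *)
Lemma sx_iter E X {eE : Enc E} {eX : Enc X} P T (f : X -> X) M :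
  (forall a, exists2 n, n <= T a & cmp P a (f a) n) ->
  forall (s : seq E) x, (forall i, i <= size s -> sz (iter i f x) <= M /\ T (iter i f x) <= M) ->
  exists2 n, n <= size s * (40 * (sz s + M) + M + 2) + 3 &
  cmp (SSeq (SPop iA) (SSeq (SPop iA) (SWhile istrue
    (SSeq DROP (SSeq SWAP (SSeq P (SSeq SWAP (SPop iA)))))))) (s, x) (iter (size s) f x) n.
Proof.
move=> hP s x hM.
have [n hn hs] : exists2 n, n <= size s * (40 * (sz s + M) + M + 2) + 1 & forall rest,
   exists fl', sexec (SWhile istrue (SSeq DROP (SSeq SWAP (SSeq P (SSeq SWAP (SPop iA))))))
    (ohead (code (enc s)), mem4 (behead (code (enc s)) ++ code (enc x) ++ rest) [::] [::] [::])
    (fl', mem4 (code (enc (iter (size s) f x)) ++ rest) [::] [::] [::]) n.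
  elim: s x hM => [|y s IH] x hM.
    by exists 1 => // rest; exists (Some (Some false)); exact: X_whf.
  have [|n hn hs] := IH (f x).
    by move=> i hi; rewrite -iterSr; apply: hM.
  have [k hk ck] := drop_correct (enc y).
  have [l hl cl] := swap_correct (enc s) (enc x).
  have [m hm cm] := hP x.
  have [l' hl' cl'] := swap_correct (enc (f x)) (enc s).
  exists ((k + (l + (m + (l' + 1))) + n).+1).
    have [hx hT] := hM 0 isT; have [hx' _] := hM 1 isT.
    have zs : sz (y :: s) = (sz y + sz s).+1 by rewrite /sz /= size_cat.
    rewrite zs /sz in hk hl hl' hn hx hx' *; rewrite /= in hx hx' hT *.
    have : size s * (40 * (size (code (enc s)) + M) + M + 2) <=
       size s * (40 * ((size (code (enc y)) + size (code (enc s))).+1 + M) + M + 2).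
      by rewrite leq_mul2l; apply/orP; right; lia.
    by rewrite mulSn; lia.
  move=> rest; have [fl' e'] := hs rest; exists fl'.
  have e1 : sexec (SSeq DROP (SSeq SWAP (SSeq P (SSeq SWAP (SPop iA)))))
     (Some (Some true), mem4 (code (enc y) ++ code (enc s) ++ code (enc x) ++ rest) [::] [::] [::])
     (ohead (code (enc s)), mem4 (behead (code (enc s)) ++ code (enc (f x)) ++ rest) [::] [::] [::])
     (k + (l + (m + (l' + 1)))).
    have [f1 e1] := ck (code (enc s) ++ code (enc x) ++ rest) (Some (Some true)).
    have [f2 e2] := cl rest f1; have [f3 e3] := cm (code (enc s) ++ rest) f2.
    have [f4 e4] := cl' rest f3.
    apply: X_seq e1 (X_seq e2 (X_seq e3 (X_seq e4 _))).
    have := X_pop f4 (mem4 (code (enc s) ++ code (enc (f x)) ++ rest) [::] [::] [::]) iA.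
    by case: (enc s) => [|u v] h; exact: h.
  rewrite [size (y :: s)]/= iterSr.
  apply: X_wht e' => //.
  by rewrite [code (enc (y :: s))]/= /= -catA.
exists (1 + (1 + n)); first lia.
move=> rest; rewrite [code (enc (s, x))]/= cat_cons -catA.
apply: sx_seq (sx_pop _ _) _ => fl.
have [fl' e'] := hs rest; exists fl'; apply: X_seq (X_pop _ _ _) _.
by case: (enc s) e' => [|u v] e'; exact: e'.
Qed.

(** The bound [M] on the iterates is the crux: a polynomial-time [f] may double its argument at
    every turn. *)
Lemma TB_iter E X Y {eE : Enc E} {eX : Enc X} {eY : Enc Y} (B : E -> nat)
    (f : X -> X) (l : E -> seq Y) (x : E -> X) (M : E -> nat) :
  PT f -> TB B l -> TB B x -> bdd (fun e => sz e + B e) M ->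
  (forall e i, i <= size (l e) -> sz (iter i f (x e)) <= M e) ->
  TB B (fun e => iter (size (l e)) f (x e)).
Proof.
move=> [P [T [[d hd] hT]]] hl hx bM hM.
have [R [V [bV hV]]] := TB_pair hl hx.
(* One bound for the sizes of the iterates and for the running time of [f] on them. *)
pose M' e := (M e + 2) ^ d.+1.
have bM' : bdd (fun e => sz e + B e) M' by apply: bdd_exp; apply: bdd_add bM (bdd_c _ _).
have MM' e : M e <= M' e.
  by rewrite /M' addn2 -[leqLHS]expn1; apply: (@leq_trans ((M e).+2 ^ 1)); rewrite ?leq_pexp2l // !expn1; lia.
set Q := (SSeq (SPop iA) (SSeq (SPop iA) (SWhile istrue
    (SSeq DROP (SSeq SWAP (SSeq P (SSeq SWAP (SPop iA)))))))).
exists (SSeq R Q), (fun e => V e + (sz (l e) * (40 * (sz (l e) + M' e) + M' e + 2) + 3)); split.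
  have bl := TB_sz hl.
  by bd.
move=> e; have [n hn cn] := hV e.
have [|m hm cm] := sx_iter hT (M := M' e) (s := l e) (x := x e).
  move=> i hi; have h := hM _ _ hi; split; first exact: leq_trans h (MM' e).
  apply: leq_trans (hd _) _; rewrite addn0 /M'.
  apply: leq_trans (_ : (M e + 2) ^ d <= _); last by rewrite addn2 leq_pexp2l.
  by case: d {hd M' bM' MM'} => // d; rewrite leq_exp2r // addn2 !ltnS.
have szl : size (l e) <= sz (l e).
  by elim: (l e) => [|y s IH] //; rewrite sz_cons /=; lia.
exists (n + m).
  by apply: leq_add => //; apply: leq_trans hm _; rewrite leq_add2r leq_mul2r szl orbT.
by move=> rest; apply: sx_seq (cn _) (cm _).
Qed.

(** * Recursion over lists *)

Lemma sz_mem Y {eY : Enc Y} (s : seq Y) s1 y s2 : s = s1 ++ y :: s2 -> sz y <= sz s.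
Proof.
by elim: s1 s => [|x s1 IH] s -> /=; rewrite sz_cons; [|have := IH _ erefl]; lia.
Qed.

Lemma size_sz Y {eY : Enc Y} (s : seq Y) : size s <= sz s.
Proof. by elim: s => //= y s IH; rewrite sz_cons; lia. Qed.

Section Fold.
Variables (E Acc Y : Type) (eE : Enc E) (eAcc : Enc Acc) (eY : Enc Y).
Variables (B : E -> nat) (b : E -> Acc -> Y -> Acc) (i : E -> Acc) (l : E -> seq Y).

(** The iterated map may not depend on [e], so the environment travels in the state. *)
Definition fstep (st : seq Y * (Acc * E)) :=
  if st.1 is y :: s then (s, (b st.2.2 st.2.1 y, st.2.2)) else st.

Lemma iter_fstep n s acc e : n <= size s ->
  iter n fstep (s, (acc, e)) = (drop n s, (foldl (b e) acc (take n s), e)).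
Proof.
elim: n s acc => [|n IH] [|y s] acc //= h; rewrite ?drop0 ?take0 //.
by rewrite -iterS iterSr /fstep /= -/fstep IH.
Qed.

Lemma TB_foldl (M : E -> nat) :
  PT (fun t : E * (Acc * Y) => b t.1 t.2.1 t.2.2) ->
  TB B i -> TB B l -> bdd (fun e => sz e + B e) M ->
  (forall e s1 s2, l e = s1 ++ s2 -> sz (foldl (b e) (i e) s1) <= M e) ->
  TB B (fun e => foldl (b e) (i e) (l e)).
Proof.
move=> hb hi hl bM hM.
apply: (@TB_ext _ _ _ _ _ (fun e => (iter (size (l e)) fstep (l e, (i e, e))).2.1)).
  by move=> e; rewrite iter_fstep // take_size.
have bl := TB_sz hl.
apply: TB_fst; apply: TB_snd.
apply: (@TB_iter _ _ _ _ _ _ _ _ _ _ (fun e => sz (l e) + (M e + (sz e + B e) + 2))).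
- apply: (@TB_case _ _ _ _ _ _ _ (fun st => st.1) (fun st => st)
    (fun t => (t.1.2, (b t.2.2.2 t.2.2.1 t.1.1, t.2.2.2)))).
  + by apply: TB_fst; apply: TB_id.
  + exact: TB_id.
  + apply: TB_pair; first by apply: TB_snd; apply: TB_fst; apply: TB_id.
    apply: TB_pair; last by do 2! apply: TB_snd; apply: TB_snd; apply: TB_id.
    apply: (TB_comp (f := fun t => (t.2.2.2, (t.2.2.1, t.1.1))) hb).
    apply: TB_pair; first by do 3! apply: TB_snd; apply: TB_id.
    apply: TB_pair; first by apply: TB_fst; do 2! apply: TB_snd; apply: TB_id.
    by do 2! apply: TB_fst; apply: TB_id.
- exact: hl.
- by do 2! [apply: TB_pair => //]; apply: TB_id.
- by bd.
move=> e n hn; rewrite iter_fstep // !sz_pair.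
have h1 := hM e (take n (l e)) (drop n (l e)) (esym (cat_take_drop _ _)).
have h2 : sz (drop n (l e)) <= sz (l e).
  elim: (l e) n {hn h1} => [|y s IH] [|n] //=; rewrite sz_cons.
  by have := IH n; lia.
by lia.
Qed.

(** Growth by an amount independent of the accumulator adds up to a polynomial. The estimate is
    asked only for [y] no larger than the list, as its members are. *)
Lemma TB_foldl_inc (K : E -> nat) :
  PT (fun t : E * (Acc * Y) => b t.1 t.2.1 t.2.2) ->
  TB B i -> TB B l -> bdd (fun e => sz e + B e) K ->
  (forall e acc y, sz y <= sz (l e) -> sz (b e acc y) <= sz acc + K e) ->
  TB B (fun e => foldl (b e) (i e) (l e)).
Proof.
move=> hb hi hl bK hK.
apply: (@TB_foldl (fun e => sz (i e) + sz (l e) * K e)) => //.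
  by have bl := TB_sz hl; have bi := TB_sz hi; bd.
move=> e s1 s2 El.
have h : sz (foldl (b e) (i e) s1) <= sz (i e) + size s1 * K e.
  elim/last_ind: s1 s2 El => [|s1 y IH] s2 El; first by rewrite /= addn0.
  rewrite cat_rcons in El; rewrite foldl_rcons size_rcons mulSn.
  have h1 := IH _ El; have h2 := hK e (foldl (b e) (i e) s1) y (sz_mem El).
  by lia.
apply: leq_trans h _; rewrite leq_add2l leq_mul2r; apply/orP; right.
by apply: leq_trans (size_sz (l e)); rewrite El size_cat leq_addr.
Qed.
End Fold.


Lemma TB_cons E (eE : Enc E) (B : E -> nat) Y (eY : Enc Y) (f : E -> Y) (g : E -> seq Y) :
  TB B f -> TB B g -> TB B (fun e => f e :: g e).
Proof. by move=> hf hg; apply: TB_cast (TB_pair hf hg). Qed.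

(** A hook, redefined once more closure lemmas are available. *)
Ltac pt_more := fail.
Ltac pt_step := cbv beta; first
  [ assumption
  | match goal with
    | |- TB _ (fun e => e) => apply: TB_id
    | |- TB _ (fun _ => ?c) => apply: TB_const
    | |- TB _ (@fst _ _) => apply: (TB_fst (f := fun t => t)); apply: TB_id
    | |- TB _ (@snd _ _) => apply: (TB_snd (f := fun t => t)); apply: TB_id
    | |- TB _ (fun e => fst _) => apply: TB_fst
    | |- TB _ (fun e => snd _) => apply: TB_snd
    | |- TB _ (fun e => pair _ _) => apply: TB_pair
    | |- TB _ (fun e => cons _ _) => apply: TB_cons
    end
  | pt_more ].
Ltac pt := repeat pt_step.

Lemma TB_catrev E (eE : Enc E) (B : E -> nat) Y (eY : Enc Y) (f g : E -> seq Y) :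
  TB B f -> TB B g -> TB B (fun e => catrev (f e) (g e)).
Proof.
move=> hf hg; apply: (@TB_ext _ _ _ _ _ (fun e => foldl (fun acc y => y :: acc) (g e) (f e))).
  by move=> e; elim: (f e) (g e) => //=.
apply: (TB_foldl_inc (K := fun e => sz (f e) + 1) _ hg hf).
- by pt.
- by have bf := TB_sz hf; bd.
- by move=> e acc y hy; rewrite sz_cons; lia.
Qed.

Lemma TB_rev E (eE : Enc E) (B : E -> nat) Y (eY : Enc Y) (f : E -> seq Y) :
  TB B f -> TB B (fun e => rev (f e)).
Proof. by move=> hf; apply: TB_catrev hf (TB_const _ [::]). Qed.

Lemma TB_cat E (eE : Enc E) (B : E -> nat) Y (eY : Enc Y) (f g : E -> seq Y) :
  TB B f -> TB B g -> TB B (fun e => f e ++ g e).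
Proof.
move=> hf hg; apply: TB_ext (TB_catrev (TB_rev hf) hg) => e.
by rewrite catrevE revK.
Qed.

Lemma TB_behead E (eE : Enc E) (B : E -> nat) Y (eY : Enc Y) (f : E -> seq Y) :
  TB B f -> TB B (fun e => behead (f e)).
Proof.
move=> hf.
apply: (@TB_ext _ _ _ _ _ (fun e => if f e is y :: s then ((y, s), e).1.2 else [::])).
  by move=> e; case: (f e).
by apply: (TB_case (g := fun t => t.1.2) hf (TB_const _ _)); pt.
Qed.

Lemma TB_nth E (eE : Enc E) (B : E -> nat) Y (eY : Enc Y) d i (f : E -> seq Y) :
  TB B f -> TB B (fun e => nth d (f e) i).
Proof.
elim: i f => [|i IH] f hf; last first.
  by apply: TB_ext (IH _ (TB_behead hf)) => e; rewrite nth_behead.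
apply: (@TB_ext _ _ _ _ _ (fun e => if f e is y :: s then ((y, s), e).1.1 else d)).
  by move=> e; case: (f e).
by apply: (TB_case (g := fun t => t.1.1) hf (TB_const _ _)); pt.
Qed.

Lemma TB_flatmap E (eE : Enc E) (B : E -> nat) Y Z (eY : Enc Y) (eZ : Enc Z) (h : E -> Y -> seq Z) (l : E -> seq Y) :
  PT (fun t : E * Y => h t.1 t.2) -> TB B l ->
  TB B (fun e => flatten [seq h e y | y <- l e]).
Proof.
move=> hh hl.
apply: (@TB_ext _ _ _ _ _ (fun e => rev (foldl (fun acc y => catrev (h e y) acc) [::] (l e)))).
  move=> e; have -> s : foldl (fun acc y => catrev (h e y) acc) s (l e)
     = catrev (flatten [seq h e y | y <- l e]) s; last by rewrite -/(rev _) revK.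
  by elim: (l e) s => //= y s IH a; rewrite IH !catrevE rev_cat catA.
apply: TB_rev; have [d hd] := TB_sz hh.
apply: (TB_foldl_inc (K := fun e => (sz e + B e + sz (l e) + 3) ^ d) _ (TB_const _ _) hl).
- apply: TB_catrev; last by pt.
  by apply: (TB_comp (f := fun t => (t.1, t.2.2)) hh); pt.
- by have bl := TB_sz hl; bd.
move=> e acc y hy; have := hd (e, y); rewrite sz_pair addn0 /= => h1.
have : sz (h e y) <= (sz e + B e + sz (l e) + 3) ^ d.
  apply: leq_trans h1 _; case: d {hd} => // d; rewrite leq_exp2r //; lia.
have : sz (catrev (h e y) acc) <= sz (h e y) + sz acc.
  elim: (h e y) acc => [|z s IH] acc /=; first by rewrite leq_addl.
  by apply: leq_trans (IH _) _; rewrite !sz_cons; lia.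
by lia.
Qed.

Lemma TB_map E (eE : Enc E) (B : E -> nat) Y Z (eY : Enc Y) (eZ : Enc Z) (h : E -> Y -> Z) (l : E -> seq Y) :
  PT (fun t : E * Y => h t.1 t.2) -> TB B l -> TB B (fun e => [seq h e y | y <- l e]).
Proof.
move=> hh hl.
apply: (@TB_ext _ _ _ _ _ (fun e => flatten [seq [:: h e y] | y <- l e])).
  by move=> e; elim: (l e) => //= y s ->.
by apply: (TB_flatmap (h := fun e y => [:: h e y])); pt.
Qed.

Lemma TB_and E (eE : Enc E) (B : E -> nat) (f g : E -> bool) : TB B f -> TB B g -> TB B (fun e => f e && g e).
Proof. by move=> hf hg; apply: TB_if hf hg (TB_const _ false). Qed.

Lemma TB_neg E (eE : Enc E) (B : E -> nat) (f : E -> bool) : TB B f -> TB B (fun e => ~~ f e).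
Proof. by move=> hf; apply: TB_if hf (TB_const _ _) (TB_const _ _). Qed.

Lemma TB_eqb E (eE : Enc E) (B : E -> nat) (f g : E -> bool) : TB B f -> TB B g -> TB B (fun e => f e == g e).
Proof.
move=> hf hg; apply: TB_ext (TB_if hf hg (TB_neg hg)) => e.
by case: (f e); case: (g e).
Qed.

Lemma TB_addb E (eE : Enc E) (B : E -> nat) (f g : E -> bool) : TB B f -> TB B g -> TB B (fun e => f e (+) g e).
Proof.
move=> hf hg; apply: TB_ext (TB_if hf (TB_neg hg) hg) => e.
by case: (f e); case: (g e).
Qed.

Lemma TB_filter E (eE : Enc E) (B : E -> nat) Y (eY : Enc Y) (h : E -> Y -> bool) (l : E -> seq Y) :
  PT (fun t : E * Y => h t.1 t.2) -> TB B l -> TB B (fun e => [seq y <- l e | h e y]).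
Proof.
move=> hh hl.
apply: (@TB_ext _ _ _ _ _ (fun e => flatten [seq (if h e y then [:: y] else [::]) | y <- l e])).
  by move=> e; elim: (l e) => //= y s ->; case: (h e y).
apply: (TB_flatmap (h := fun e y => if h e y then [:: y] else [::])) => //.
by apply: TB_if; pt.
Qed.

Lemma TB_nilp E (eE : Enc E) (B : E -> nat) Y (eY : Enc Y) (l : E -> seq Y) : TB B l -> TB B (fun e => nilp (l e)).
Proof.
move=> hl; apply: (@TB_ext _ _ _ _ _ (fun e => if l e is y :: s then false else true)).
  by move=> e; case: (l e).
by apply: (TB_case (g := fun=> false) hl); pt.
Qed.

Lemma TB_all E (eE : Enc E) (B : E -> nat) Y (eY : Enc Y) (h : E -> Y -> bool) (l : E -> seq Y) :
  PT (fun t : E * Y => h t.1 t.2) -> TB B l -> TB B (fun e => all (h e) (l e)).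
Proof.
move=> hh hl; apply: (@TB_ext _ _ _ _ _ (fun e => nilp [seq y <- l e | ~~ h e y])).
  by move=> e; rewrite /nilp size_filter; elim: (l e) => //= y s; case: (h e y).
by apply: TB_nilp; apply: (TB_filter (h := fun e y => ~~ h e y)) => //; apply: TB_neg.
Qed.

Lemma TB_has E (eE : Enc E) (B : E -> nat) Y (eY : Enc Y) (h : E -> Y -> bool) (l : E -> seq Y) :
  PT (fun t : E * Y => h t.1 t.2) -> TB B l -> TB B (fun e => has (h e) (l e)).
Proof.
move=> hh hl; apply: (@TB_ext _ _ _ _ _ (fun e => ~~ all (fun y => ~~ h e y) (l e))).
  by move=> e; rewrite all_predC negbK.
by apply: TB_neg; apply: (TB_all (h := fun e y => ~~ h e y)) => //; apply: TB_neg.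
Qed.

Definition zipstep Y Z (st : seq Z * seq (Y * Z)) (y : Y) :=
  if st.1 is z :: t then (t, (y, z) :: st.2) else st.

Lemma TB_zip E (eE : Enc E) (B : E -> nat) Y Z (eY : Enc Y) (eZ : Enc Z) (f : E -> seq Y) (g : E -> seq Z) :
  TB B f -> TB B g -> TB B (fun e => zip (f e) (g e)).
Proof.
move=> hf hg.
apply: (@TB_ext _ _ _ _ _ (fun e => rev (foldl (@zipstep Y Z) (g e, [::]) (f e)).2)).
  move=> e; have h s t o : (foldl (@zipstep Y Z) (t, o) s).2 = catrev (zip s t) o.
    elim: s t o => [|y s IH] [|z t] o //=; last by rewrite IH.
    by rewrite /zipstep /= -/(@zipstep Y Z) IH; case: s {IH}.
  by rewrite h -/(rev _) revK.
apply: TB_rev; apply: TB_snd.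
apply: (TB_foldl_inc (b := fun _ => @zipstep Y Z) (K := fun e => sz (f e) + 3) _ _ hf).
- apply: (@TB_case _ _ _ _ _ _ _ (fun t : E * ((seq Z * seq (Y * Z)) * Y) => t.2.1.1)
    (fun t => t.2.1) (fun t => (t.1.2, (t.2.2.2, t.1.1) :: t.2.2.1.2))); pt.
- by pt.
- by have bf := TB_sz hf; bd.
move=> e [t o] y hy; rewrite /zipstep; case: t => [|z t] /=; first lia.
by rewrite !(sz_pair, sz_cons); lia.
Qed.

Lemma TB_natseq E (eE : Enc E) (B : E -> nat) (f : E -> nat) : TB B f -> TB B (fun e => nseq (f e) false).
Proof. by apply: TB_cast => e; elim: (f e) => //= n; rewrite /enc /= => <-. Qed.

Lemma TB_size E (eE : Enc E) (B : E -> nat) Y (eY : Enc Y) (l : E -> seq Y) : TB B l -> TB B (fun e => size (l e)).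
Proof.
move=> hl; have := TB_map (eZ := enc_bool) (h := fun _ _ => false) (TB_const _ _) hl.
by apply: TB_cast => e; elim: (l e) => //= y s; rewrite /enc /= => ->.
Qed.

Lemma TB_subn E (eE : Enc E) (B : E -> nat) (f g : E -> nat) : TB B f -> TB B g -> TB B (fun e => f e - g e).
Proof.
move=> hf hg; apply: (@TB_ext _ _ _ _ _ (fun e => size (foldl (fun acc (_ : bool) => behead acc)
   (nseq (f e) false) (nseq (g e) false)))).
  move=> e; elim: (g e) (f e) => [|n IH] m; first by rewrite /= size_nseq subn0.
  by case: m => [|m]; [exact: (IH 0) | rewrite subSS -IH].
apply: TB_size.
apply: (TB_foldl_inc (K := fun e => 0)).
- by apply: TB_behead; pt.
- exact: TB_natseq.
- exact: TB_natseq.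
- exact: bdd_c.
- by move=> e [|x s] y hy //=; rewrite sz_cons; lia.
Qed.

Lemma TB_eqn E (eE : Enc E) (B : E -> nat) (f g : E -> nat) : TB B f -> TB B g -> TB B (fun e => f e == g e).
Proof.
move=> hf hg; apply: (@TB_ext _ _ _ _ _ (fun e => nilp (nseq (f e - g e) false) && nilp (nseq (g e - f e) false))).
  by move=> e; rewrite /nilp !size_nseq; lia.
by apply: TB_and; apply: TB_nilp; apply: TB_natseq; apply: TB_subn.
Qed.

Lemma TB_eqs E (eE : Enc E) (B : E -> nat) (f g : E -> seq nat) : TB B f -> TB B g -> TB B (fun e => f e == g e).
Proof.
move=> hf hg; apply: (@TB_ext _ _ _ _ _ (fun e => (size (f e) == size (g e)) &&
    all (fun t => t.1 == t.2) (zip (f e) (g e)))).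
  move=> e; elim: (f e) (g e) => [|x s IH] [|y t] //=; rewrite eqseq_cons -IH eqSS.
  by case: (x == y); rewrite ?andbF.
apply: TB_and; first by apply: TB_eqn; apply: TB_size.
apply: (TB_all (h := fun _ t => t.1 == t.2)); last exact: TB_zip.
by apply: TB_eqn; pt.
Qed.

Lemma TB_addn E (eE : Enc E) (B : E -> nat) (f g : E -> nat) : TB B f -> TB B g -> TB B (fun e => f e + g e).
Proof.
move=> hf hg; have := TB_size (TB_cat (TB_natseq hf) (TB_natseq hg)).
by apply: TB_ext => e; rewrite size_cat !size_nseq.
Qed.

Lemma TB_b2n E (eE : Enc E) (B : E -> nat) (f : E -> bool) : TB B f -> TB B (fun e => nat_of_bool (f e)).
Proof. by apply: TB_cast => e; case: (f e). Qed.

Lemma sz_nat (n : nat) : sz n = n.*2.+1.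
Proof. by elim: n => // n; rewrite /sz /enc /= => ->; rewrite doubleS. Qed.

(** The accumulator is its own counter: its length is the next entry. The growth then depends on the
    accumulator, which calls for [TB_foldl] with an explicit bound. *)
Lemma TB_iota E (eE : Enc E) (B : E -> nat) (f : E -> nat) : TB B f -> TB B (fun e => iota 0 (f e)).
Proof.
move=> hf; apply: (@TB_ext _ _ _ _ _ (fun e => rev (foldl (fun acc (_ : bool) => size acc :: acc)
   [::] (nseq (f e) false)))).
  move=> e; have h n : foldl (fun acc (_ : bool) => size acc :: acc) [::] (nseq n false) = rev (iota 0 n).
    elim: n => // n IH; rewrite -addn1 nseqD foldl_cat IH iotaD rev_cat /=.
    by rewrite size_rev size_iota add0n.
  by rewrite h revK.
apply: TB_rev; have hn := TB_natseq hf.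
apply: (TB_foldl (M := fun e => sz (f e) * (sz (f e) + 3) + 1)) => //; first by apply: TB_cons; [apply: TB_size|]; pt.
- by pt.
- by have bf := TB_sz hf; bd.
move=> e s1 s2 hs; have h1 : size s1 <= f e.
  by rewrite -(size_nseq (f e) false) hs size_cat leq_addr.
have [h2 h3] : size (foldl (fun acc (_ : bool) => size acc :: acc) [::] s1) = size s1 /\
   sz (foldl (fun acc (_ : bool) => size acc :: acc) [::] s1) <= size s1 * (size s1).*2.+2 + 1.
  elim/last_ind: s1 {hs h1} => [|s1 y [h2 h3]] //.
  rewrite foldl_rcons /= size_rcons h2 sz_cons sz_nat; split=> //; nia.
apply: leq_trans h3 _; rewrite sz_nat; nia.
Qed.

Lemma TB_ap2 E X Y Z (eE : Enc E) (eX : Enc X) (eY : Enc Y) (eZ : Enc Z) (B : E -> nat)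
    (f : X -> Y -> Z) (x : E -> X) (y : E -> Y) :
  PT (fun t : X * Y => f t.1 t.2) -> TB B x -> TB B y -> TB B (fun e => f (x e) (y e)).
Proof. by move=> hf hx hy; apply: (TB_comp (f := fun e => (x e, y e)) hf); pt. Qed.

Lemma TB_ap3 E X Y Z W (eE : Enc E) (eX : Enc X) (eY : Enc Y) (eZ : Enc Z) (eW : Enc W)
    (B : E -> nat) (f : X -> Y -> Z -> W) (x : E -> X) (y : E -> Y) (z : E -> Z) :
  PT (fun t : X * (Y * Z) => f t.1 t.2.1 t.2.2) ->
  TB B x -> TB B y -> TB B z -> TB B (fun e => f (x e) (y e) (z e)).
Proof. by move=> hf hx hy hz; apply: (TB_comp (f := fun e => (x e, (y e, z e))) hf); pt. Qed.

Lemma TB_ap4 E X Y Z W V (eE : Enc E) (eX : Enc X) (eY : Enc Y) (eZ : Enc Z) (eW : Enc W)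
    (eV : Enc V) (B : E -> nat) (f : X -> Y -> Z -> W -> V)
    (x : E -> X) (y : E -> Y) (z : E -> Z) (w : E -> W) :
  PT (fun t : (X * Y) * (Z * W) => f t.1.1 t.1.2 t.2.1 t.2.2) ->
  TB B x -> TB B y -> TB B z -> TB B w -> TB B (fun e => f (x e) (y e) (z e) (w e)).
Proof.
by move=> hf hx hy hz hw; apply: (TB_comp (f := fun e => ((x e, y e), (z e, w e))) hf); pt.
Qed.

Ltac pt_more ::=
  match goal with
  | |- TB _ (fun e => map _ _) => apply: TB_map
  | |- TB _ (fun e => flatten (map _ _)) => apply: TB_flatmap
  | |- TB _ (fun e => filter _ _) => apply: TB_filter
  | |- TB _ (fun e => all _ _) => apply: TB_all
  | |- TB _ (fun e => has _ _) => apply: TB_has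
  | |- TB _ (fun e => zip _ _) => apply: TB_zip
  | |- TB _ (fun e => rev _) => apply: TB_rev
  | |- TB _ (fun e => cat _ _) => apply: TB_cat
  | |- TB _ (fun e => nth _ _ _) => apply: TB_nth
  | |- TB _ (fun e => size _) => apply: TB_size
  | |- TB _ (fun e => iota 0 _) => apply: TB_iota
  | |- TB _ (fun e => negb _) => apply: TB_neg
  | |- TB _ (fun e => andb _ _) => apply: TB_and
  | |- TB _ (fun e => addb _ _) => apply: TB_addb
  | |- TB _ (fun e => eq_op _ _) => first [apply: TB_eqb | apply: TB_eqn | apply: TB_eqs]
  | |- TB _ (fun e => addn _ _) => apply: TB_addn
  | |- TB _ (fun e => nat_of_bool _) => apply: TB_b2n
  | |- TB _ (fun e => nseq _ false) => apply: TB_natseq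
  | |- TB _ (fun e => if _ then _ else _) => apply: TB_if
  end.

(** * Arithmetic modulo p on fixed-width bit lists *)

(* Least significant bit first. *)
Notation num := (seq bool).

(** A full adder: the carry propagates if the two bits differ and otherwise equals either bit. *)
Definition rstep (st : bool * num) (t : bool * bool) : bool * num :=
  (if t.1 (+) t.2 then st.1 else t.1, (st.1 (+) (t.1 (+) t.2)) :: st.2).
Definition ripple (c : bool) (a b : num) : bool * num :=
  ((foldl rstep (c, [::]) (zip a b)).1, rev (foldl rstep (c, [::]) (zip a b)).2).

Definition selm (d : bool * num) (s : num) : num := if d.1 then d.2 else s.
(* Subtracts [p] by adding its two's complement; the carry tells whether [p <= s]. *)
Definition redm (p s : num) : num := selm (ripple true s (map negb p)) s.
Definition addm (p a b : num) : num := redm p (ripple false a b).2.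
Definition zer (p : num) : num := map (fun=> false) p.
Definition one (p : num) : num := (ripple true (zer p) (zer p)).2.
Definition mstep (e : num * num) (acc : num) (bt : bool) : num :=
  if bt then addm e.1 (addm e.1 acc acc) e.2 else addm e.1 acc acc.
(** Horner's scheme from the most significant bit of [a], reduced after every doubling and
    addition. *)
Definition mulm (p a b : num) : num := foldl (mstep (p, b)) (zer p) (rev a).
(** [ripple] yields [p - a] by two's complement; adding zero reduces it, which matters for
    [a = 0]. *)
Definition negm (p a : num) : num := addm p (zer p) (ripple true p (map negb a)).2.
Definition nz (a : num) : bool := has id a.

Lemma size_rfold c out l :
  size (foldl rstep (c, out) l).2 = size out + size l.
Proof.
elim: l c out => [|t l IH] c out /=; first by rewrite addn0.
by rewrite /rstep /= -/rstep IH /= addSnnS.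
Qed.

Lemma size_ripple c a b : size (ripple c a b).2 = minn (size a) (size b).
Proof. by rewrite size_rev size_rfold size_zip. Qed.

Lemma size_addm p a b : size (addm p a b) <= minn (size a) (size b).
Proof.
rewrite /addm /redm /selm; case: ifP => _; rewrite ?size_ripple //.
exact: geq_minl.
Qed.

(** Nothing is assumed about reducedness or equal widths, since running times are bounded on all
    encoded arguments. *)
Lemma size_addm_le p a b w : size a <= w -> size (addm p a b) <= w.
Proof. by move=> h; apply: leq_trans (size_addm p a b) _; rewrite geq_min h. Qed.

Lemma size_mulm p a b : size (mulm p a b) <= size p.
Proof.
rewrite /mulm; elim/last_ind: (rev a) => [|s x IH]; first by rewrite size_map.
by rewrite foldl_rcons /mstep; case: x => /=; do ?apply: size_addm_le.
Qed.

Lemma sz_num (a : num) : sz a <= 4 * size a + 1.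
Proof.
elim: a => // x a IH; rewrite sz_cons /=.
have : sz x <= 3 by case: x.
by lia.
Qed.

Lemma PT_ripple : PT (fun t : bool * (num * num) => ripple t.1 t.2.1 t.2.2).
Proof.
have h : PT (fun t : bool * (num * num) => foldl rstep (t.1, [::]) (zip t.2.1 t.2.2)).
  apply: (TB_foldl_inc (b := fun _ => rstep) (K := fun e => 20)); try by pt.
  - by rewrite /rstep; pt.
  - exact: bdd_c.
  move=> e [c o] [x y] _; rewrite /rstep !(sz_pair, sz_cons) /=.
  have hb (z : bool) : 1 <= sz z <= 3 by case: z.
  have h1 := hb c.
  have h2 := hb (if x (+) y then c else x).
  have h3 := hb (c (+) (x (+) y)); lia.
by rewrite /ripple; apply: TB_pair; [apply: TB_fst|apply: TB_rev; apply: TB_snd].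
Qed.

Lemma PT_redm : PT (fun t : num * num => redm t.1 t.2).
Proof.
rewrite /redm; apply: (TB_ap2 (f := selm)); first by rewrite /selm; pt.
  by apply: (TB_ap3 (f := ripple) PT_ripple); pt.
by pt.
Qed.

Lemma PT_addm : PT (fun t : num * (num * num) => addm t.1 t.2.1 t.2.2).
Proof.
rewrite /addm; apply: (TB_ap2 (f := redm) PT_redm); first by pt.
by apply: TB_snd; apply: (TB_ap3 (f := ripple) PT_ripple); pt.
Qed.

Ltac pt_add :=
  match goal with
  | |- TB _ (fun e => ripple _ _ _) => apply: (TB_ap3 (f := ripple) PT_ripple)
  | |- TB _ (fun e => addm _ _ _) => apply: (TB_ap3 (f := addm) PT_addm)
  | |- TB _ (fun e => zer _) => rewrite /zer
  | |- TB _ zer => rewrite /zer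
  end.
Ltac pt1 := repeat first [pt_step | pt_add].

Lemma PT_mulm : PT (fun t : num * (num * num) => mulm t.1 t.2.1 t.2.2).
Proof.
apply: (TB_foldl (b := fun t => mstep (t.1, t.2.2)) (M := fun t => 4 * sz t + 1)).
- by rewrite /mstep; pt1.
- by pt1.
- by pt.
- by apply: bdd_le (_ : bdd _ (fun t => 4 * (sz t + 0) + 1)) => [a|]; [rewrite addn0|bd].
move=> [p [a b]] s1 s2 _ /=.
have h : size (foldl (mstep (p, b)) (zer p) s1) <= size p.
  elim/last_ind: s1 => [|s x IH]; first by rewrite size_map.
  by rewrite foldl_rcons /mstep; case: x => /=; do ?apply: size_addm_le.
apply: leq_trans (sz_num _) _; rewrite sz_pair; generalize (size_sz p); lia.
Qed.

Lemma PT_negm : PT (fun t : num * num => negm t.1 t.2).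
Proof. by rewrite /negm; pt1. Qed.

Lemma PT_nz : PT nz.
Proof. by apply: (TB_has (h := fun _ => id)); pt. Qed.

Lemma PT_one : PT one.
Proof. by rewrite /one; pt1. Qed.

Ltac pt_num :=
  match goal with
  | |- TB _ (fun e => mulm _ _ _) => apply: (TB_ap3 (f := mulm) PT_mulm)
  | |- TB _ (fun e => negm _ _) => apply: (TB_ap2 (f := negm) PT_negm)
  | |- TB _ (fun e => one _) => apply: (TB_comp (g := one) PT_one)
  | |- TB _ (fun e => nz _) => apply: (TB_comp (g := nz) PT_nz)
  end.

(** * The closure algorithm *)

(* [(g, (a, b))] is the entry of a tensor over [G] ([g = true]) or [H] whose
   in-labels are [a] and whose out-labels are [rev b]: the labels [a ++ b] are
   listed in the order of the cycle [C_k]. *)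
Notation coord := (bool * (seq nat * seq nat))%type.
Notation edges := (seq ((nat * nat) * bool)).
Notation ctx := (num * (seq coord * ((seq (seq nat) * seq (seq nat)) *
  ((edges * edges) * seq (seq nat)))))%type.
Notation vec := (seq num).

(** A context holds the modulus, the coordinates, the words of length [k] over the vertices of G and
    of H, the two adjacency tables, and the words over 0, 1, 2 that describe minors of M_k. *)
Definition cP (x : ctx) : num := x.1.
Definition cC (x : ctx) : seq coord := x.2.1.
Definition cW (x : ctx) (g : bool) := if g then x.2.2.1.1 else x.2.2.1.2.
Definition cE (x : ctx) (g : bool) := if g then x.2.2.2.1.1 else x.2.2.2.1.2.
Definition cT (x : ctx) := x.2.2.2.2.

Definition eqc (c d : coord) : bool :=
  (c.1 == d.1) && ((c.2.1 == d.2.1) && (c.2.2 == d.2.2)).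
Definition adj (E : edges) (a b : nat) : bool :=
  has (fun t => t.2 && ((t.1.1 == a) && (t.1.2 == b))) E.

Definition lookstep (c : coord) (acc : num) (t : coord * num) :=
  if eqc t.1 c then t.2 else acc.
Definition look (x : ctx) (v : vec) (c : coord) : num :=
  foldl (lookstep c) (zer (cP x)) (zip (cC x) v).

Definition opR (x : ctx) (v : vec) : vec :=
  [seq look x v (c.1, (behead c.2.1 ++ [:: nth 0 c.2.2 0],
                       behead c.2.2 ++ [:: nth 0 c.2.1 0])) | c <- cC x].
Definition opE (x : ctx) (v : vec) : vec :=
  [seq if nth 0 (c.2.1 ++ c.2.2) 0 == nth 0 (c.2.1 ++ c.2.2) 1 then look x v c
       else zer (cP x) | c <- cC x].
Definition opA (x : ctx) (v : vec) : vec :=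
  [seq if adj (cE x c.1) (nth 0 (c.2.1 ++ c.2.2) 0) (nth 0 (c.2.1 ++ c.2.2) 1)
       then look x v c else zer (cP x) | c <- cC x].

(** For shared labels with values [w], the left factor is read at [rev w], because coordinates list
    out-labels backwards. *)
Definition pstep (y : (ctx * (vec * vec)) * coord) (acc : num) (w : seq nat) : num :=
  addm (cP y.1.1) acc
    (mulm (cP y.1.1) (look y.1.1 y.1.2.1 (y.2.1, (y.2.2.1, rev w)))
                     (look y.1.1 y.1.2.2 (y.2.1, (w, y.2.2.2)))).
Definition pentry (y : (ctx * (vec * vec)) * coord) : num :=
  foldl (pstep y) (zer (cP y.1.1)) (cW y.1.1 y.2.1).
Definition opP (x : ctx) (u v : vec) : vec :=
  [seq pentry ((x, (u, v)), c) | c <- cC x].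

(** [r.1] is the fate of a rung of M_k: 0 deleted, 1 contracted, otherwise kept. The pair holds the
    values of its two ends. *)
Definition okr (E : edges) (r : nat * (nat * nat)) : bool :=
  if r.1 == 0 then true else
  if r.1 == 1 then r.2.1 == r.2.2 else adj E r.2.1 r.2.2.
Definition gen (x : ctx) (t : seq nat) : vec :=
  [seq if all (fun r => okr (cE x c.1) r) (zip t (zip c.2.1 (rev c.2.2)))
       then one (cP x) else zer (cP x) | c <- cC x].

Definition pivstep (acc : bool * (num * num)) (t : num * num) :=
  if acc.1 then acc else if nz t.2 then (true, t) else acc.
(** The entries of [v] and [b] at the pivot of [b], its first nonzero position. [elim1]
    cross-multiplies with them: the result vanishes at the pivot and is the pivot entry times [v]
    minus a multiple of [b]. *)
Definition piv (v b : vec) : num * num :=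
  (foldl pivstep (false, ([::], [::])) (zip v b)).2.
Definition elim1 (p : num) (q : num * num) (v b : vec) : vec :=
  [seq addm p (mulm p q.2 t.1) (mulm p (negm p q.1) t.2) | t <- zip v b].
Definition red1 (p : num) (v b : vec) : vec := elim1 p (piv v b) v b.
Definition redall (p : num) (Bs : seq vec) (v : vec) : vec := foldl (red1 p) v Bs.

Definition cands (x : ctx) (Bs : seq vec) : seq vec :=
  [seq gen x t | t <- cT x] ++ [seq opR x b | b <- Bs] ++
  [seq opE x b | b <- Bs] ++ [seq opA x b | b <- Bs] ++
  flatten [seq [seq opP x u v | v <- Bs] | u <- Bs].
Definition hd1 (s : seq vec) : seq vec := if s is v :: s' then [:: v] else [::].
(** A single vector is added per round, because a second residue would first have to be reduced by
    it. *)
Definition round (x : ctx) (Bs : seq vec) : seq vec :=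
  Bs ++ hd1 [seq v <- [seq redall (cP x) Bs c | c <- cands x Bs] | has nz v].
(** The dummy coordinate makes N + 1 rounds. The basis never has more than N vectors, so some round
    adds nothing, and from then on the basis is stationary. *)
Definition closure_basis (x : ctx) : seq vec :=
  foldl (fun Bs _ => round x Bs) [::] ((true, ([::], [::])) :: cC x).
Definition totstep (p : num) (acc : num) (t : coord * num) : num :=
  addm p acc (if t.1.1 then t.2 else negm p t.2).
Definition tot (x : ctx) (v : vec) : num :=
  foldl (totstep (cP x)) (zer (cP x)) (zip (cC x) v).
Definition answer (x : ctx) : bool :=
  all (fun v => ~~ nz (tot x v)) (closure_basis x).

(** * Polynomial running time of the closure algorithm *)

Lemma PT_eqc : PT (fun t : coord * coord => eqc t.1 t.2).
Proof. by rewrite /eqc; pt. Qed.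

Lemma PT_adj : PT (fun t : edges * (nat * nat) => adj t.1 t.2.1 t.2.2).
Proof. by rewrite /adj; pt. Qed.

Lemma PT_cP : PT cP. Proof. by rewrite /cP; pt. Qed.
Lemma PT_cC : PT cC. Proof. by rewrite /cC; pt. Qed.
Lemma PT_cT : PT cT. Proof. by rewrite /cT; pt. Qed.
Lemma PT_cW : PT (fun t : ctx * bool => cW t.1 t.2).
Proof. by rewrite /cW; pt. Qed.
Lemma PT_cE : PT (fun t : ctx * bool => cE t.1 t.2).
Proof. by rewrite /cE; pt. Qed.

Ltac pt_ctx :=
  match goal with
  | |- TB _ (fun e => eqc _ _) => apply: (TB_ap2 (f := eqc) PT_eqc)
  | |- TB _ (fun e => adj _ _ _) => apply: (TB_ap3 (f := adj) PT_adj)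
  | |- TB _ cP => exact: PT_cP
  | |- TB _ cC => exact: PT_cC
  | |- TB _ cT => exact: PT_cT
  | |- TB _ (fun e => cP _) => apply: (TB_comp (g := cP) PT_cP)
  | |- TB _ (fun e => cC _) => apply: (TB_comp (g := cC) PT_cC)
  | |- TB _ (fun e => cT _) => apply: (TB_comp (g := cT) PT_cT)
  | |- TB _ (fun e => cW _ _) => apply: (TB_ap2 (f := cW) PT_cW)
  | |- TB _ (fun e => cE _ _) => apply: (TB_ap2 (f := cE) PT_cE)
  end.
Ltac pt2 := repeat first [pt_step | pt_add | pt_num | pt_ctx].

(** For folds that select a value already present: a bound common to the start and all elements
    persists. *)
Lemma sz_foldsel (Acc Y : Type) {eA : Enc Acc} (b : Acc -> Y -> Acc) i s N :
  sz i <= N -> (forall acc y s1 s2, s = s1 ++ y :: s2 -> sz acc <= N -> sz (b acc y) <= N) ->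
  sz (foldl b i s) <= N.
Proof.
elim: s i => [|y s IH] i //= hi h; apply: IH => [|acc z s1 s2 e].
  exact: (h i y [::] s).
by apply: (h acc z (y :: s1) s2); rewrite e.
Qed.

Lemma bdd_sz1 E (eE : Enc E) c d : bdd (fun e : E => sz e + 0) (fun e => c * sz e + d).
Proof.
by apply: bdd_le (_ : bdd _ (fun e => c * (sz e + 0) + d)) => [e|]; [rewrite addn0|bd].
Qed.

Lemma sz_zip Y Z {eY : Enc Y} {eZ : Enc Z} (s : seq Y) (t : seq Z) :
  sz (zip s t) <= sz s + sz t.
Proof.
elim: s t => [|y s IH] [|z t]; [exact: leq_addr|exact: leq_addr|exact: leq_addl|].
by rewrite /= !sz_cons sz_pair; have := IH t; lia.
Qed.

Lemma PT_look : PT (fun t : ctx * (vec * coord) => look t.1 t.2.1 t.2.2).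
Proof.
apply: (TB_foldl (b := fun t => lookstep t.2.2) (M := fun t => 4 * sz t + 1)).
- by rewrite /lookstep; pt2.
- by pt2.
- by pt2.
- exact: bdd_sz1.
move=> [x [v c]] s1 s2 hs.
have hp : sz (zer (cP x)) <= 4 * sz (x, (v, c)) + 1.
  apply: leq_trans (sz_num _) _; rewrite size_map /cP; generalize (size_sz x.1).
  by case: x {hs} => p x; rewrite !sz_pair /=; lia.
apply: sz_foldsel => //= acc [d a] s3 s4 e hacc; rewrite /lookstep; case: ifP => // _ /=.
rewrite e -catA in hs; generalize (sz_mem hs); generalize (sz_zip (cC x) v).
by case: x {hp hs hacc} => p [cd x]; rewrite /cC /= !sz_pair; lia.
Qed.

Ltac pt_look :=
  match goal with
  | |- TB _ (fun e => look _ _ _) => apply: (TB_ap3 (f := look) PT_look)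
  end.
Ltac pt3 := repeat first [pt_step | pt_add | pt_num | pt_ctx | pt_look].

Lemma PT_opR : PT (fun t : ctx * vec => opR t.1 t.2).
Proof. by rewrite /opR; pt3; apply: TB_behead; pt3. Qed.

Lemma PT_opE : PT (fun t : ctx * vec => opE t.1 t.2).
Proof. by rewrite /opE; pt3. Qed.

Lemma PT_opA : PT (fun t : ctx * vec => opA t.1 t.2).
Proof. by rewrite /opA; pt3. Qed.

Lemma PT_pentry : PT pentry.
Proof.
apply: (TB_foldl (b := pstep) (M := fun t => 4 * sz t + 1)).
- by rewrite /pstep; pt3.
- by pt3.
- by pt3.
- exact: bdd_sz1.
move=> y s1 s2 _.
have h : size (foldl (pstep y) (zer (cP y.1.1)) s1) <= size (cP y.1.1).
  elim/last_ind: s1 => [|s z IH]; first by rewrite size_map.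
  by rewrite foldl_rcons; apply: size_addm_le.
apply: leq_trans (sz_num _) _; generalize (size_sz (cP y.1.1)).
case: y h => [[x [u v]] c]; rewrite /cP !sz_pair /=; case: x => p x /=.
by rewrite !sz_pair; lia.
Qed.

Lemma PT_opP : PT (fun t : ctx * (vec * vec) => opP t.1 t.2.1 t.2.2).
Proof.
rewrite /opP; pt3.
by apply: (TB_comp (g := pentry) PT_pentry); pt3.
Qed.

Lemma PT_gen : PT (fun t : ctx * seq nat => gen t.1 t.2).
Proof. by rewrite /gen /okr; pt3. Qed.

Lemma PT_piv : PT (fun t : vec * vec => piv t.1 t.2).
Proof.
rewrite /piv; apply: TB_snd.
apply: (TB_foldl (b := fun=> pivstep) (M := fun t => 1 * sz t + 10)).
- by rewrite /pivstep; pt3.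
- by pt3.
- by pt3.
- exact: bdd_sz1.
move=> [v b] s1 s2 hs.
apply: sz_foldsel => [|acc t s3 s4 e hacc].
  by rewrite !sz_pair /= ; generalize (sz_gt0 v); rewrite /sz /=; lia.
rewrite /pivstep; case: ifP => // _; case: ifP => // _.
rewrite e -catA in hs; generalize (sz_mem hs); generalize (sz_zip v b).
by rewrite sz_pair (sz_pair v b) (_ : sz true = 3) //=; lia.
Qed.

Lemma PT_red1 : PT (fun t : num * (vec * vec) => red1 t.1 t.2.1 t.2.2).
Proof.
rewrite /red1; apply: (TB_ap4 (f := elim1)); first by rewrite /elim1; pt3.
- by pt3.
- by apply: (TB_ap2 (f := piv) PT_piv); pt3.
- by pt3.
- by pt3.
Qed.

(** Shape only, without correctness of the entries: just enough to bound the size of a code. *)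
Definition okv (w m : nat) (v : vec) := (size v <= m) && all (fun a => size a <= w) v.

Lemma sz_okv w m v : okv w m v -> sz v <= m * (4 * w + 2) + 1.
Proof.
move=> /andP[hm hv].
have : sz v <= size v * (4 * w + 2) + 1.
  elim: v hv {hm} => // a v IH /= /andP[ha hv]; rewrite sz_cons mulSn.
  by have := IH hv; have := sz_num a; lia.
by move/leq_trans; apply; rewrite leq_add2r leq_mul2r hm orbT.
Qed.

Lemma okv_map T (f : T -> num) w s m : size s <= m -> (forall c, size (f c) <= w) ->
  okv w m [seq f c | c <- s].
Proof.
by move=> hs hf; rewrite /okv size_map hs /= all_map; elim: s {hs} => //= c s ->; rewrite hf.
Qed.

(** Each entry is a sum that starts with a product, and [mulm] never exceeds the width of [p],
    whatever its operands. *)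
Lemma okv_red1 p v b m : size v <= m -> okv (size p) m (red1 p v b).
Proof.
move=> hm; apply: okv_map => [|t]; first by rewrite size_zip geq_min hm.
by apply: size_addm_le; apply: size_mulm.
Qed.

Lemma okv_redall w p Bs v m : size p <= w -> okv w m v -> okv w m (redall p Bs v).
Proof.
move=> hw; elim: Bs v => //= b Bs IH v /andP[h1 h2]; apply: IH.
have /andP[h3 h4] := okv_red1 p b h1; rewrite /okv h3 /=.
by apply: sub_all h4 => a /leq_trans; apply.
Qed.

Lemma size_mem_sz (v : vec) a : a \in v -> size a <= sz v.
Proof.
case/splitPr => v1 v2; apply: leq_trans (size_sz a) _; exact: (sz_mem erefl).
Qed.

Lemma PT_redall : PT (fun t : num * (seq vec * vec) => redall t.1 t.2.1 t.2.2).
Proof.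
apply: (TB_foldl (b := fun t => red1 t.1)
   (M := fun t => (sz t + 0) * (4 * (sz t + 0) + 2) + 1)).
- by apply: (TB_ap3 (f := red1) PT_red1); pt3.
- by pt3.
- by pt3.
- by bd.
move=> [p [Bs v]] s1 s2 _ /=.
(* On the empty prefix [v] comes back as it is, so its own entries contribute to the width. *)
have h : okv (size p + sz v) (size v) (redall p s1 v).
  apply: okv_redall; first exact: leq_addr.
  rewrite /okv leqnn /=; apply/allP => a /size_mem_sz h; apply: leq_trans h _; exact: leq_addl.
apply: leq_trans (sz_okv h) _; rewrite leq_add2r !sz_pair.
by apply: leq_mul; generalize (size_sz p); generalize (size_sz v); lia.
Qed.

Lemma PT_cands : PT (fun t : ctx * seq vec => cands t.1 t.2).
Proof.
rewrite /cands; pt3.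
- by apply: (TB_ap2 (f := gen) PT_gen); pt3.
- by apply: (TB_ap2 (f := opR) PT_opR); pt3.
- by apply: (TB_ap2 (f := opE) PT_opE); pt3.
- by apply: (TB_ap2 (f := opA) PT_opA); pt3.
- by apply: (TB_ap3 (f := opP) PT_opP); pt3.
Qed.

Lemma PT_hd1 : PT hd1.
Proof.
apply: (@TB_case _ _ _ _ _ _ _ (fun s => s) (fun=> [::]) (fun t => [:: t.1.1])); pt.
Qed.

Lemma PT_round : PT (fun t : ctx * seq vec => round t.1 t.2).
Proof.
rewrite /round; pt3.
apply: (TB_comp (g := hd1) PT_hd1); pt3.
- by apply: (TB_ap3 (f := redall) PT_redall); pt3.
- by apply: (TB_ap2 (f := cands) PT_cands); pt3.
Qed.

Lemma size_look w x v c : size (cP x) <= w -> all (fun a => size a <= w) v ->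
  size (look x v c) <= w.
Proof.
move=> hp hv; rewrite /look.
have : size (zer (cP x)) <= w by rewrite size_map.
elim: (cC x) v hv (zer _) => [|d s IH] [|a v] //= /andP[ha hv] acc hacc.
by apply: IH => //; rewrite /lookstep; case: ifP.
Qed.

Lemma size_pentry y : size (pentry y) <= size (cP y.1.1).
Proof.
rewrite /pentry; elim/last_ind: (cW _ _) => [|s z IH]; first by rewrite size_map.
by rewrite foldl_rcons; apply: size_addm_le.
Qed.

Lemma okv_cands x Bs : all (okv (size (cP x)) (size (cC x))) Bs ->
  all (okv (size (cP x)) (size (cC x))) (cands x Bs).
Proof.
move=> /allP hB; have hz : size (zer (cP x)) <= size (cP x) by rewrite size_map.
have hl v c : v \in Bs -> size (look x v c) <= size (cP x).
  by move=> /hB/andP[_ hv]; apply: size_look.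
rewrite /cands !all_cat; apply/and5P; split; apply/allP => v.
- case/mapP => t _ ->; apply: okv_map => // c; case: ifP => // _.
  by rewrite size_ripple minnn.
- by case/mapP => b hb ->; apply: okv_map => // c; apply: hl.
- by case/mapP => b hb ->; apply: okv_map => // c; case: ifP => // _; apply: hl.
- by case/mapP => b hb ->; apply: okv_map => // c; case: ifP => // _; apply: hl.
- by case/flattenP => s /mapP[u _ ->] /mapP[w _ ->]; apply: okv_map => // c; apply: size_pentry.
Qed.

Lemma okv_round x Bs : all (okv (size (cP x)) (size (cC x))) Bs ->
  all (okv (size (cP x)) (size (cC x))) (round x Bs).
Proof.
move=> hB; rewrite /round all_cat hB /=.
set s := filter _ _.
have : all (okv (size (cP x)) (size (cC x))) s.
  apply/allP => v; rewrite mem_filter => /andP[_ /mapP[c hc ->]].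
  apply: okv_redall => //; exact: (allP (okv_cands hB)).
by case: s => //= v s /andP[-> _].
Qed.

Lemma size_round x Bs : size (round x Bs) <= (size Bs).+1.
Proof. by rewrite /round size_cat -addn1 leq_add2l; case: (filter _ _). Qed.

Lemma sz_okvs w m Bs : all (okv w m) Bs -> sz Bs <= size Bs * (m * (4 * w + 2) + 2) + 1.
Proof.
elim: Bs => // v Bs IH /= /andP[hv hB]; rewrite sz_cons mulSn.
by have := sz_okv hv; have := IH hB; lia.
Qed.

Lemma PT_closure_basis : PT closure_basis.
Proof.
apply: (TB_foldl (b := fun x Bs (_ : coord) => round x Bs) (l := fun x => (true, ([::], [::])) :: cC x)
   (M := fun x => ((sz x + 0) + 1) * ((sz x + 0) * (4 * (sz x + 0) + 2) + 2) + 1)).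
- by apply: (TB_ap2 (f := round) PT_round); pt3.
- by pt3.
- by pt3.
- by bd.
move=> x s1 s2 hs.
have h1 : size s1 <= (size (cC x)).+1.
  by move/(congr1 size): hs; rewrite size_cat /= => ->; rewrite leq_addr.
have [h2 h3] : all (okv (size (cP x)) (size (cC x))) (foldl (fun Bs (_ : coord) => round x Bs) [::] s1)
   /\ size (foldl (fun Bs (_ : coord) => round x Bs) [::] s1) <= size s1.
  elim/last_ind: s1 {hs h1} => [|s z [h2 h3]] //; rewrite foldl_rcons size_rcons.
  by split; [exact: okv_round | apply: leq_trans (size_round _ _) _].
apply: leq_trans (sz_okvs h2) _; rewrite leq_add2r.
have hP : size (cP x) <= sz x.
  by case: x {hs h1 h2 h3} => p x; rewrite sz_pair /cP /=; generalize (size_sz p); lia.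
have hC : size (cC x) <= sz x.
  by case: x {hs h1 h2 h3 hP} => p [cd x]; rewrite !sz_pair /cC /=; generalize (size_sz cd); lia.
apply: leq_mul; first by lia.
by rewrite leq_add2r leq_mul //; lia.
Qed.

Lemma PT_tot : PT (fun t : ctx * vec => tot t.1 t.2).
Proof.
apply: (TB_foldl (b := fun t => totstep (cP t.1)) (M := fun t => 4 * sz t + 1)).
- by rewrite /totstep; pt3.
- by pt3.
- by pt3.
- exact: bdd_sz1.
move=> [x v] s1 s2 _ /=.
have h : size (foldl (totstep (cP x)) (zer (cP x)) s1) <= size (cP x).
  elim/last_ind: s1 => [|s z IH]; first by rewrite size_map.
  by rewrite foldl_rcons; apply: size_addm_le.
apply: leq_trans (sz_num _) _; generalize (size_sz (cP x)).
by case: x h => p x; rewrite /cP !sz_pair /=; lia.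
Qed.

Lemma PT_answer : PT answer.
Proof.
rewrite /answer; pt3; last exact: PT_closure_basis.
by apply: (TB_ap2 (f := tot) PT_tot); pt3.
Qed.

(** * From the input word to the coordinate system *)

(* A word over {0, 1, #} is presented as a list in which [::] stands for # and
   [:: b] for the bit b. *)
Notation input := (seq (seq bool)).

Definition splitstep (st : seq bool * seq (seq bool)) (x : seq bool) :=
  if x is b :: _ then (b :: st.1, st.2) else ([::], rev st.1 :: st.2).
Definition fields (e : input) : seq (seq bool) :=
  rev (rev (foldl splitstep ([::], [::]) e).1 :: (foldl splitstep ([::], [::]) e).2).

Lemma sz_catrev Y (eY : Enc Y) (s t : seq Y) : (sz (catrev s t)).+1 = sz s + sz t.
Proof.
elim: s t => [|y s IH] t /=; first by rewrite add1n.
by rewrite IH !sz_cons; lia.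
Qed.

Lemma sz_rev Y (eY : Enc Y) (s : seq Y) : sz (rev s) = sz s.
Proof. by apply: succn_inj; rewrite sz_catrev addn1. Qed.

Lemma PT_fields : PT fields.
Proof.
have h : PT (fun e : input => foldl splitstep ([::], [::]) e).
  apply: (TB_foldl_inc (b := fun _ => splitstep) (K := fun=> 10)).
  - apply: (@TB_case _ _ _ _ _ _ _ (fun t : input * ((seq bool * seq (seq bool)) * seq bool) => t.2.2)
      (fun t => ([::], rev t.2.1.1 :: t.2.1.2)) (fun t => (t.1.1 :: t.2.2.1.1, t.2.2.1.2))); pt.
  - by pt.
  - by pt.
  - exact: bdd_c.
  move=> e [c o] x _; rewrite /splitstep; case: x => [|b x].
    by rewrite !(sz_pair, sz_cons) /= sz_rev (_ : sz [::] = 1) //; lia.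
  by rewrite !(sz_pair, sz_cons) /=; have : sz b <= 3 by [case: b]; lia.
rewrite /fields; apply: TB_rev; apply: TB_cons.
  by apply: TB_rev; apply: TB_fst.
exact: TB_snd.
Qed.

Definition fld i (e : input) := nth [::] (fields e) i.

Lemma PT_fld i : PT (fld i).
Proof. by apply: TB_nth; exact: PT_fields. Qed.

Definition kval (s : seq bool) : nat := foldl (fun a (b : bool) => b + (a + a)) 0 s.

Lemma kval_prefix s1 s2 : kval s1 <= kval (s1 ++ s2).
Proof.
rewrite /kval foldl_cat; elim: s2 (foldl _ _ s1) => //= b s IH a.
by apply: leq_trans (IH _); lia.
Qed.

(** Passing from binary to unary is exponential in the length, so the value itself is the budget. *)
Lemma TB_kval : TB (fun s => kval s) (fun s : seq bool => kval s).
Proof.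
apply: (TB_foldl (b := fun _ a (b : bool) => b + (a + a)) (M := fun s => 2 * (sz s + kval s) + 1)); try by pt.
  by bd.
move=> e s1 s2 ->; rewrite sz_nat -/(kval s1); have := kval_prefix s1 s2; lia.
Qed.

Definition wstep (vs : seq nat) (ws : seq (seq nat)) (_ : bool) : seq (seq nat) :=
  flatten [seq [seq a :: w | w <- ws] | a <- vs].
Definition words (vs : seq nat) (m : nat) : seq (seq nat) :=
  foldl (wstep vs) [:: [::]] (nseq m false).

Lemma wordsS vs m : words vs m.+1 = [seq a :: w | a <- vs, w <- words vs m].
Proof. by rewrite /words -addn1 nseqD foldl_cat. Qed.

Lemma size_words vs m : size (words vs m) = size vs ^ m.
Proof. by elim: m => // m IH; rewrite wordsS size_allpairs IH expnS. Qed.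

Lemma size_mem_words vs m t : t \in words vs m -> size t = m.
Proof.
elim: m t => [|m IH] t; first by rewrite inE => /eqP ->.
by rewrite wordsS => /allpairsP[[a u] /= [_ /IH <- ->]].
Qed.

Lemma sz_all_le Y {eY : Enc Y} (s : seq Y) N :
  all (fun y => sz y <= N) s -> sz s <= size s * (N + 1) + 1.
Proof.
elim: s => // y s IH /= /andP[hy hs]; rewrite sz_cons mulSn.
by have := IH hs; lia.
Qed.

Lemma sz_words vs m :
  sz (words vs m) <= size vs ^ m * (m * (sz vs + 1) + 2) + 1.
Proof.
have h (w : seq nat) : w \in words vs m -> sz w <= m * (sz vs + 1) + 1.
  elim: m w => [|m IH] w; first by rewrite inE => /eqP ->.
  rewrite wordsS => /allpairsP[[a u] /= [ha hu ->]]; rewrite sz_cons mulSn.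
  have := IH _ hu; have ha' : sz (a : nat) <= sz vs.
    by case/splitPr: ha => s1 s2; apply: sz_mem erefl.
  by lia.
rewrite -size_words -[_ + 2]/(_ + (1 + 1)) addnA; apply: sz_all_le.
by apply/allP => w hw; apply: h.
Qed.

(** The intermediate values are the lists of shorter words. The successor in the base makes the
    powers monotone in the exponent also for an empty alphabet, where [0 ^ 0 = 1]. *)
Lemma TB_words : TB (fun t => (size t.1).+1 ^ t.2) (fun t : seq nat * nat => words t.1 t.2).
Proof.
apply: (TB_foldl (b := fun t => wstep t.1)
  (M := fun t => (sz t + (size t.1).+1 ^ t.2) *
    ((sz t + (size t.1).+1 ^ t.2) * (sz t + (size t.1).+1 ^ t.2) + 2) + 1)).
- by rewrite /wstep; pt.
- by pt.
- by pt.
- by bd.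
move=> [vs m] s1 s2 /= hs.
have h1 : size s1 <= m by rewrite -(size_nseq m false) hs size_cat leq_addr.
have -> : s1 = nseq (size s1) false.
  by apply/all_pred1P; have := all_nseq (pred1 false) m false; rewrite /= hs eqxx orbT all_cat => /andP[].
rewrite -/(words _ _); apply: leq_trans (sz_words _ _) _; rewrite leq_add2r.
apply: leq_mul.
  apply: leq_trans (leq_addl _ _).
  apply: (@leq_trans ((size vs).+1 ^ size s1)); last by rewrite leq_pexp2l.
  by case: (size s1) => // n; rewrite leq_exp2r.
rewrite leq_add2r; apply: leq_mul.
  by apply: leq_trans (leq_addr _ _); rewrite sz_pair sz_nat; lia.
by apply: leq_trans (leq_addr _ _); rewrite sz_pair; have := sz_gt0 m; lia.
Qed.

Definition mkedges (n : nat) (bits : seq bool) : edges :=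
  zip (flatten [seq [seq (a, b) | b <- iota 0 n] | a <- iota 0 n]) bits.

Definition mkcoords (wG wH : seq (seq nat)) : seq coord :=
  flatten [seq [seq (true, (a, b)) | b <- wG] | a <- wG] ++
  flatten [seq [seq (false, (a, b)) | b <- wH] | a <- wH].

(** The modulus gets a zero bit on top, which leaves room for sums below [2p]. *)
Definition mkctx (e : input) (w : (seq (seq nat) * seq (seq nat)) * seq (seq nat)) : ctx :=
  (rev (fld 5 e) ++ [:: false], (mkcoords w.1.1 w.1.2, (w.1,
    ((mkedges (size (fld 0 e)) (fld 1 e), mkedges (size (fld 2 e)) (fld 3 e)), w.2)))).

Definition kin (e : input) := kval (fld 4 e).

Definition setup (e : input) : ctx :=
  mkctx e
    ((words (iota 0 (size (fld 0 e))) (kin e), words (iota 0 (size (fld 2 e))) (kin e)),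
     words [:: 0; 1; 2] (kin e)).

(** The terms pay for [k] in unary and for the words over the two vertex sets and over three
    symbols; each base is an alphabet size plus one, as in [TB_words]. *)
Definition budget (e : input) : nat :=
  kin e + ((size (fld 0 e)).+1 ^ kin e + (size (fld 2 e)).+1 ^ kin e + 4 ^ kin e).

Lemma TB_setup : TB budget setup.
Proof.
have hf i : TB budget (fld i) by apply: PT_TB; exact: PT_fld.
have bb : bdd (fun e : input => sz e + budget e) budget.
  by apply: bdd_le (bdd_self _) => e; rewrite leq_addl.
have hk : TB budget kin.
  apply: (TB_compB TB_kval (hf 4)); apply: bdd_le bb => e; exact: leq_addr.
have hi j : TB budget (fun e => iota 0 (size (fld j e))).
  by apply: TB_iota; apply: TB_size; apply: hf.
have hw (vs : input -> seq nat) : TB budget vs ->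
   (forall e, (size (vs e)).+1 ^ kin e <= budget e) -> TB budget (fun e => words (vs e) (kin e)).
  move=> hv hb; apply: (TB_compB (f := fun e => (vs e, kin e)) TB_words); first by pt.
  exact: bdd_le bb.
have h0 := hw _ (hi 0); have h2 := hw _ (hi 2); have h3 := hw _ (TB_const _ [:: 0; 1; 2]).
have PTf i E (eE : Enc E) (f : E -> input) : PT f -> PT (fun x => fld i (f x)).
  by move=> h; apply: (TB_comp (g := fld i) (PT_fld i) h).
rewrite /setup; apply: TB_ap2.
- by rewrite /mkctx /mkcoords /mkedges; pt; apply: PTf; pt.
- by pt.
- apply: TB_pair; first apply: TB_pair.
  + by apply: h0 => e; rewrite size_iota /budget; lia.
  + by apply: h2 => e; rewrite size_iota /budget; lia.
  + by apply: h3 => e; rewrite /budget /=; lia.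
Qed.

(** * Loading the input and running the algorithm *)

Definition sy (i : 'I_3) : seq bool := if bsym i is Some b then [:: b] else [::].

Definition pushcons (x : seq bool) : scom :=
  SSeq (pushes (code (enc x))) (SPush iA (Some true)).

(** The last input symbol is on top of [iB], so consing the symbols as they are popped yields the
    list in reading order. *)
Definition LOAD : scom :=
  SSeq (SPush iA (Some false)) (SSeq (SPop iB) (SWhile isbit
    (SSeq (SIf istrue (pushcons [:: true])
            (SIf (fun y => y == Some (Some false)) (pushcons [:: false]) (pushcons [::])))
          (SPop iB)))).

Lemma X_pushes s fl a b c d :
  exists2 fl', True & exists2 n, n = size s + 2 &
   sexec (pushes s) (fl, mem4 a b c d) (fl', mem4 (s ++ a) b c d) n.
Proof.
elim: s => [|x s [fl' _ [n -> h]]] /=.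
  exists (Some None) => //; exists 2 => //.
  exact: (X_seq (n := 1) (X_push fl (mem4 a b c d) iA None) (X_pop _ _ _)).
exists fl' => //; exists (size s + 2 + 1); first lia.
exact: X_seq h (X_push _ _ _ _).
Qed.

Lemma X_pushcons x fl a b :
  exists fl' n, n = sz x + 3 /\
   sexec (pushcons x) (fl, mem4 a b [::] [::])
     (fl', mem4 (Some true :: code (enc x) ++ a) b [::] [::]) n.
Proof.
have [fl' _ [n -> h]] := X_pushes (code (enc x)) fl a b [::] [::].
exists fl', (sz x + 2 + 1); split; first by rewrite /sz; lia.
exact: X_seq h (X_push _ _ _ _).
Qed.

Lemma load_correct (w : seq 'I_3) : exists fl n, n <= 20 * size w + 3 /\
  sexec LOAD (None, ([::], rev (map bsym w), [::], [::]))
    (fl, mem4 (code (enc (map sy w))) [::] [::] [::]) n.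
Proof.
rewrite /LOAD; set W := SWhile _ _.
have hW : forall u : seq (seq bool), exists fl n, n <= 20 * size w + 1 /\
  sexec W (ohead (rev (map bsym w)),
     mem4 (code (enc u)) (behead (rev (map bsym w))) [::] [::])
   (fl, mem4 (code (enc (map sy w ++ u))) [::] [::] [::]) n.
  elim/last_ind: w => [|w i IH] u; first by exists None, 1; split=> //; exact: X_whf.
  rewrite !map_rcons rev_rcons cat_rcons size_rcons /=.
  have [fl [n [hn h]]] := IH (sy i :: u).
  have [f1 [m [hm e1]]] := X_pushcons (sy i) (Some (bsym i)) (code (enc u)) (rev (map bsym w)).
  have hs : sz (sy i) <= 7 by rewrite /sy /bsym; case: i {IH h e1 hm} => -[|[|[|j]]].
  have [m' [hm' e2]] : exists m', m' <= m + 2 /\ sexec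
      (SIf istrue (pushcons [:: true])
            (SIf (fun y => y == Some (Some false)) (pushcons [:: false]) (pushcons [::])))
      (Some (bsym i), mem4 (code (enc u)) (rev (map bsym w)) [::] [::])
      (f1, mem4 (Some true :: code (enc (sy i)) ++ code (enc u)) (rev (map bsym w)) [::] [::]) m'.
    move: e1; rewrite /sy; case: (bsym i) => [[]|] e1.
    - by exists m.+1; split; [lia|apply: X_ift].
    - by exists m.+2; split; [lia|apply: X_iff => //; apply: X_ift].
    - by exists m.+2; split; [lia|apply: X_iff => //; apply: X_iff].
  exists fl, ((m' + 1) + n).+1; split; first lia.
  by apply: X_wht h => //; apply: X_seq e2 (X_pop _ _ _).
have [fl [n [hn]]] := hW [::]; rewrite cats0 => h.
exists fl, (1 + (1 + n)); split; first lia.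
apply: X_seq (X_push _ _ _ _) _; apply: X_seq (X_pop _ _ _) _.
exact: h.
Qed.

(* Reading the answer: [true] is encoded by a node, i.e. its code starts with [true]. *)
Lemma TB_decider (B : input -> nat) (f : input -> bool) : TB B f ->
  exists M d, forall w : seq 'I_3, forall T,
    (size w + B (map sy w) + 2) ^ d <= T ->
    let cf := run M w T in
    halted cf /\ (c_state cf = tm_acc M <-> f (map sy w)).
Proof.
move=> [P [U [[d hd] hU]]].
pose b w := size w + B (map sy w).
have [d' hd'] : bdd b (fun w => let n := 20 * size w + 3 + (U (map sy w) + 1) in
    n * (6 * (size w + n) + 20) + 3).
  have bs : bdd b size by apply: bdd_le (bdd_self _) => w; exact: leq_addr.
  have bB : bdd b (fun w => B (map sy w)) by apply: bdd_le (bdd_self _) => w; exact: leq_addl.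
  have bU : bdd b (fun w => U (map sy w)).
    apply: (bdd_comp (g := map sy) (ex_intro _ d hd)).
    apply: (@bdd_le _ _ _ (fun w => (size w * (7 + 1) + 1) + B (map sy w))); last by bd.
    move=> w; rewrite leq_add2r -(size_map sy w); apply: sz_all_le.
    rewrite all_map; apply/allP => i _ /=.
    by rewrite /sy /bsym; case: i => -[|[|[|j]]].
  by rewrite /=; bd.
exists (stk_decider (SSeq LOAD (SSeq P (SPop iA))) istrue), d' => w T hT.
have hT' : (b w).+2 ^ d' <= T by rewrite -addn2.
have [fl [n [hn hl]]] := load_correct w.
have [m hm /(_ [::] fl) [fl' hc]] := hU (map sy w).
rewrite !cats0 in hc.
have := stk_decider_correct istrue (T := T) (X_seq hl (X_seq hc (X_pop _ _ _))) _.
rewrite /=; case: (f (map sy w)) => /=; apply.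
all: apply: leq_trans _ (leq_trans (hd' w) hT'); rewrite /= addn3 addn2 !ltnS.
all: have hx : n + (m + 1) <= 20 * size w + 3 + (U (map sy w) + 1) by lia.
all: by apply: leq_mul => //; lia.
Qed.

(** * Correctness of the modular arithmetic *)

Fixpoint val2 (a : num) : nat := if a is b :: a' then b + (val2 a').*2 else 0.

Lemma val2_lt a : val2 a < 2 ^ size a.
Proof. by elim: a => //= b a IH; rewrite expnS; case: b => /=; lia. Qed.

Lemma val2_negb a : val2 a + val2 (map negb a) + 1 = 2 ^ size a.
Proof. by elim: a => //= b a IH; rewrite expnS -IH; case: b => /=; lia. Qed.

Lemma val2_zer a : val2 (zer a) = 0.
Proof. by elim: a => //= b a ->. Qed.

Lemma rfold_spec c out a b : size a = size b ->
  exists c' s, [/\ foldl rstep (c, out) (zip a b) = (c', catrev s out),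
    size s = size a & val2 s + c' * 2 ^ size a = val2 a + val2 b + c].
Proof.
elim: a b c out => [|x a IH] [|y b] c out //= => [_|[sab]].
  by exists c, [::]; split=> //; rewrite expn0 muln1.
have [c' [s [e ss hs]]] := IH b (if x (+) y then c else x) ((c (+) (x (+) y)) :: out) sab.
exists c', ((c (+) (x (+) y)) :: s); split=> //=; first by rewrite ss.
by rewrite expnS; case: x y c {IH e} hs => [] [] [] /=; lia.
Qed.

Lemma ripple_spec c a b : size a = size b ->
  [/\ size (ripple c a b).2 = size a &
   val2 (ripple c a b).2 + (ripple c a b).1 * 2 ^ size a = val2 a + val2 b + c].
Proof.
move=> sab; have [c' [s [e ss hs]]] := rfold_spec c [::] sab.
by rewrite /ripple e /= -/(rev s) revK.
Qed.

Lemma nz_spec a : nz a = (val2 a != 0).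
Proof. by rewrite /nz; elim: a => //= -[] a IH /=; rewrite ?IH; lia. Qed.

Section ModP.
Variable p : num.
Hypothesis p2 : (val2 p).*2 <= 2 ^ size p.

Definition okn (a : num) := (size a == size p) && (val2 a < val2 p).

Lemma redm_spec s : size s = size p -> val2 s < (val2 p).*2 ->
  okn (redm p s) /\ val2 (redm p s) = val2 s %% val2 p.
Proof.
move=> ss hs; rewrite /redm /selm.
have [|s2 e2] := @ripple_spec true s (map negb p); first by rewrite size_map.
have hn := val2_negb p; rewrite -ss in hn.
have lt2 := val2_lt (ripple true s (map negb p)).2; rewrite s2 in lt2.
case: (ripple true s (map negb p)) s2 e2 lt2 => -[] d /= s2 e2 lt2; rewrite /okn ?s2 ss eqxx /=.
  have e3 : val2 d = val2 s - val2 p by lia.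
  have lp : val2 p <= val2 s by lia.
  rewrite e3; split; first lia.
  by rewrite -[in RHS](subnK lp) modnDr modn_small //; lia.
have lp : val2 s < val2 p by lia.
by rewrite modn_small.
Qed.

Lemma addm_spec a b : okn a -> okn b ->
  okn (addm p a b) /\ val2 (addm p a b) = (val2 a + val2 b) %% val2 p.
Proof.
move=> /andP[/eqP sa ha] /andP[/eqP sb hb].
have [|ss es] := @ripple_spec false a b; first by rewrite sa.
have lt2 := val2_lt (ripple false a b).2.
rewrite ss in lt2; rewrite sa in ss es lt2.
(* A carry is impossible, since the sum is below [2p] and hence below [2 ^ size p]. *)
rewrite /addm; case: (ripple false a b) ss es lt2 => -[] d /= ss es lt2; first lia.
have <- : val2 d = val2 a + val2 b by lia.
by apply: redm_spec => //; lia.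
Qed.

Lemma zer_spec : 0 < val2 p -> okn (zer p).
Proof. by move=> h; rewrite /okn size_map eqxx val2_zer. Qed.

Lemma one_spec : 1 < val2 p -> okn (one p) /\ val2 (one p) = 1.
Proof.
move=> hp; have [|ss es] := @ripple_spec true (zer p) (zer p); first by [].
have lt2 := val2_lt (one p); rewrite /okn /one in lt2 *.
rewrite size_map !val2_zer in ss es.
case: (ripple true (zer p) (zer p)) ss es lt2 => c d /= ss es lt2; rewrite ss in lt2.
have : val2 d = 1 by case: c es => /=; lia.
by move=> ->; rewrite hp ss eqxx.
Qed.

Lemma mulm_spec a b : 0 < val2 p -> okn b ->
  okn (mulm p a b) /\ val2 (mulm p a b) = (val2 a * val2 b) %% val2 p.
Proof.
move=> hp hb; rewrite /mulm.
have -> : foldl (mstep (p, b)) (zer p) (rev a) = foldr (fun x acc => mstep (p, b) acc x) (zer p) a.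
  by rewrite -foldl_rev.
elim: a => [|x a [IH1 IH2]] /=; first by rewrite mul0n mod0n val2_zer zer_spec.
move: (foldr _ _ a) IH1 IH2 => acc IH1 IH2.
have [o1 e1] := addm_spec IH1 IH1; rewrite /mstep.
have e2 : val2 (addm p acc acc) = ((val2 a).*2 * val2 b) %% val2 p.
  by rewrite e1 IH2 modnDm -mulnDl addnn.
case: x => /=; last by rewrite add0n.
have [o3 e3] := addm_spec o1 hb; split=> //.
by rewrite e3 e2 modnDml mulnDl mul1n addnC.
Qed.

Lemma negm_spec a : 0 < val2 p -> okn a ->
  okn (negm p a) /\ val2 (negm p a) = (val2 p - val2 a) %% val2 p.
Proof.
move=> hp /andP[/eqP sa ha]; rewrite /negm /addm.
have [|ss es] := @ripple_spec true p (map negb a); first by rewrite size_map.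
have hn := val2_negb a; rewrite sa in hn.
have lt2 := val2_lt (ripple true p (map negb a)).2; rewrite ss in lt2.
have lp := val2_lt p.
have ev : val2 (ripple true p (map negb a)).2 = val2 p - val2 a.
  by case: (ripple _ _ _) es lt2 => -[] d /= es lt2; lia.
move: (ripple true p _).2 ss ev {es lt2} => s ss ev.
have [|s3 e3] := @ripple_spec false (zer p) s; first by rewrite size_map.
have lt3 := val2_lt (ripple false (zer p) s).2; rewrite s3 in lt3.
rewrite size_map val2_zer in s3 e3 lt3.
have e4 : val2 (ripple false (zer p) s).2 = val2 p - val2 a.
  by case: (ripple _ _ _) e3 lt3 => -[] d /= e3 lt3; lia.
by rewrite -e4; apply: redm_spec => //; lia.
Qed.

Variable q : nat.
Hypotheses (q_pr : prime q) (pq : val2 p = q).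
Local Open Scope ring_scope.

Definition phi (a : num) : 'F_q := (val2 a)%:R.

Let p_gt0 : (0 < val2 p)%N. Proof. by rewrite pq prime_gt0. Qed.

Lemma phiD a b : okn a -> okn b -> okn (addm p a b) /\ phi (addm p a b) = phi a + phi b.
Proof.
move=> oa ob; have [o e] := addm_spec oa ob; split=> //.
by rewrite /phi e pq Fp_nat_mod // natrD.
Qed.

Lemma phiM a b : okn b -> okn (mulm p a b) /\ phi (mulm p a b) = phi a * phi b.
Proof.
move=> ob; have [o e] := mulm_spec a p_gt0 ob; split=> //.
by rewrite /phi e pq Fp_nat_mod // natrM.
Qed.

Lemma phiN a : okn a -> okn (negm p a) /\ phi (negm p a) = - phi a.
Proof.
move=> oa; have [o e] := negm_spec p_gt0 oa; split=> //.
case/andP: oa => _ ha; rewrite /phi e pq Fp_nat_mod // natrB; last by rewrite -pq ltnW.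
by rewrite pchar_Fp_0 // sub0r.
Qed.

Lemma phi0 : okn (zer p) /\ phi (zer p) = 0.
Proof. by rewrite /phi val2_zer zer_spec. Qed.

Lemma phi1 : okn (one p) /\ phi (one p) = 1.
Proof. by have [|o e] := one_spec; rewrite ?pq ?prime_gt1 // /phi e. Qed.

Lemma phi_nz a : okn a -> nz a = (phi a != 0).
Proof.
case/andP => _ ha; rewrite nz_spec /phi; congr negb.
have -> : (val2 a)%:R == 0 :> 'F_q = (q %| val2 a)%N.
  by rewrite (dvdn_pcharf (pchar_Fp q_pr)).
apply/eqP/idP => [->|/dvdn_leq]; first exact: dvdn0.
by rewrite -pq; case: (val2 a) ha => // n; lia.
Qed.
End ModP.

(** * Homomorphism tensors *)

Section Words.
Lemma mem_words (n m : nat) w :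
  (w \in words (iota 0 n) m) = (size w == m) && all (fun x => x < n) w.
Proof.
elim: m w => [|m IH] w; first by rewrite inE -size_eq0; case: w.
rewrite wordsS; apply/allpairsP/idP => [[[a u] /= [ha hu ->]]|].
  by move: hu; rewrite IH mem_iota in ha *; rewrite /= eqSS => /andP[-> ->]; rewrite andbT.
case: w => [|a u] //=; rewrite eqSS => /and3P[hs ha hu].
by exists (a, u); rewrite mem_iota ha IH hs hu.
Qed.

Lemma uniq_words vs m : uniq vs -> uniq (words vs m).
Proof.
move=> hv; elim: m => // m IH; rewrite wordsS; apply: allpairs_uniq => //.
by move=> [a u] [b v] _ _ /= [-> ->].
Qed.

Lemma sum_words (n m : nat) w : w \in words (iota 0 n) m ->
  \sum_(x <- words (iota 0 n) m) (w == x) = 1.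
Proof.
move=> hw; rewrite -[RHS](_ : count_mem w (words (iota 0 n) m) = _).
  by rewrite -sum1_count [RHS]big_mkcond /=; apply: eq_bigr => x _; rewrite eq_sym; case: eqP.
by rewrite count_uniq_mem ?hw // uniq_words // iota_uniq.
Qed.
End Words.

Definition lab (F : bgraph) := bg_in F ++ rev (bg_out F).

Definition wfb (k : nat) (F : bgraph) :=
  [/\ size (bg_in F) = k, size (bg_out F) = k & all (fun x => x < bg_n F) (bg_in F ++ bg_out F)].

Section Tensor.
Variables (n : nat) (E : rel 'I_n).

(* Out-of-range arguments, which never occur, get the value 0. *)
Definition ext m (f : {ffun 'I_m -> 'I_n}) (x : nat) : nat :=
  if insub x is Some i then f i else 0.

Lemma ext_ord m (f : {ffun 'I_m -> 'I_n}) (i : 'I_m) : ext f i = f i.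
Proof. by rewrite /ext valK. Qed.

Lemma extE m (f : {ffun 'I_m -> 'I_n}) x (hx : x < m) : ext f x = f (Ordinal hx).
Proof. by rewrite -ext_ord. Qed.

Definition homd m (e : nat -> nat -> bool) (f : {ffun 'I_m -> 'I_n}) : bool :=
  [forall a : 'I_m, forall b : 'I_m, e a b ==> E (f a) (f b)].

(** The entry at [c] of the homomorphism tensor, indexed by the values of the labels in cyclic
    order. *)
Definition tens (F : bgraph) (c : seq nat) : nat :=
  \sum_(f : {ffun 'I_(bg_n F) -> 'I_n})
    (homd (bg_e F) f && (map (ext f) (lab F) == c)).

Lemma homE F : hom F E = \sum_(f : {ffun 'I_(bg_n F) -> 'I_n}) homd (bg_e F) f.
Proof.
rewrite /hom -sum1_card big_mkcond /=; apply: eq_bigr => f _.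
by rewrite inE /homd; case: [forall a, _].
Qed.

Lemma ext_lt m (f : {ffun 'I_m -> 'I_n}) s : all (fun x => x < m) s ->
  all (fun x => x < n) (map (ext f) s).
Proof.
by elim: s => //= x s IH /andP[hx /IH ->]; rewrite (extE _ hx) ltn_ord.
Qed.

(** Each homomorphism sends the labels to exactly one word, so it is counted in exactly one
    entry. *)
Lemma hom_tens k F : wfb k F -> hom F E =
  \sum_(a <- words (iota 0 n) k) \sum_(b <- words (iota 0 n) k) tens F (a ++ b).
Proof.
move=> [s1 s2]; rewrite all_cat => /andP[l1 l2].
rewrite homE /tens; under [RHS]eq_bigr => a _ do rewrite exchange_big.
rewrite exchange_big; apply: eq_bigr => f _.
case: homd => /=; last by rewrite big1 // => a _; rewrite big1.
have m1 : map (ext f) (bg_in F) \in words (iota 0 n) k.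
  by rewrite mem_words size_map s1 eqxx ext_lt.
have m2 : rev (map (ext f) (bg_out F)) \in words (iota 0 n) k.
  by rewrite mem_words size_rev size_map s2 eqxx all_rev ext_lt.
rewrite -(sum_words m1) big_seq [RHS]big_seq; apply: eq_bigr => a.
rewrite mem_words => /andP[/eqP sa _].
rewrite /lab map_cat map_rev; under eq_bigr => b _ do rewrite eqseq_cat ?size_map ?s1 ?sa //.
case: (_ == a) => /=; last by rewrite big1.
by rewrite sum_words.
Qed.

Section Glue.
Variables (N : nat) (Ed : nat -> nat -> bool) (pairs : seq (nat * nat)) (lin lout : seq nat).
Hypotheses (pN : all (fun t => (t.1 < N) && (t.2 < N)) pairs)
  (linN : all (fun x => x < N) lin) (loutN : all (fun x => x < N) lout).

Let R : rel 'I_N := fun x y =>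
  (((x : nat), (y : nat)) \in pairs) || (((y : nat), (x : nat)) \in pairs).
Let rt : 'I_N -> 'I_N := fingraph.root R.
Let rs := undup [seq rt x | x <- enum 'I_N].
Let cls (x : nat) : nat :=
  if (insub x : option 'I_N) is Some y then index (rt y) rs else 0.
Let Gl := glue N Ed pairs lin lout.

Let rtrs x : rt x \in rs.
Proof. by rewrite mem_undup; apply: map_f; rewrite mem_enum. Qed.

Let clsP (x : 'I_N) : cls x < bg_n Gl.
Proof. by rewrite /cls valK index_mem. Qed.

Let clsO (x : 'I_N) : 'I_(bg_n Gl) := Ordinal (clsP x).

Let Phi (h : {ffun 'I_(bg_n Gl) -> 'I_n}) : {ffun 'I_N -> 'I_n} := [ffun x => h (clsO x)].

Let R_sym : connect_sym R.
Proof. by apply: sym_connect_sym => x y; rewrite /R orbC. Qed.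

Let cls_rt x y : (rt x == rt y) -> clsO x = clsO y.
Proof. by move/eqP => e; apply: val_inj; rewrite /= /cls !valK e. Qed.

Let clsO_surj r : exists x, clsO x = r.
Proof.
have hr : r < size rs by case: r.
have x0 : 'I_N by case: rs hr => // y.
have : nth x0 rs r \in rs by apply: mem_nth.
rewrite {2}/rs mem_undup => /mapP[x _ e]; exists x; apply: val_inj.
by rewrite /= /cls valK -e index_uniq // undup_uniq.
Qed.

Definition respects (f : {ffun 'I_N -> 'I_n}) := all (fun t => ext f t.1 == ext f t.2) pairs.

Let resp_connect f x y : respects f -> connect R x y -> f x = f y.
Proof.
move=> /allP hf /connectP[s hs ->]; elim: s x hs => //= z s IH x /andP[hxz hs].
rewrite -(IH z hs); apply: val_inj; case/orP: hxz => /hf /eqP /=; rewrite !ext_ord //.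
Qed.

(** Composition with the class map, [Phi], is a bijection from the maps on the quotient to the maps
    on the original vertices that agree on all listed pairs; it preserves the edge condition and the
    values of the labels. *)
Lemma tens_glue c : tens Gl c = \sum_(f : {ffun 'I_N -> 'I_n})
  [&& homd Ed f, respects f & map (ext f) (lin ++ rev lout) == c].
Proof.
have cardE (T : finType) (P : pred T) : \sum_(x : T) (P x : nat) = #|[set x | P x]|.
  by rewrite -sum1_card [RHS]big_mkcond /=; apply: eq_bigr => x _; rewrite inE; case: (P x).
rewrite /tens !cardE -(card_imset _ (_ : injective Phi)); last first.
  move=> h h' /ffunP e; apply/ffunP => r; have [x <-] := clsO_surj r.
  by have := e x; rewrite !ffunE.
have extP h x : x < N -> ext (Phi h) x = ext h (cls x).
  move=> hx; rewrite (extE _ hx) ffunE -(ext_ord h); congr ext.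
have labP h : map (ext (Phi h)) (lin ++ rev lout) = map (ext h) (lab Gl).
  rewrite /lab /Gl /glue /= -map_rev -map_cat -map_comp; apply/eq_in_map => x.
  rewrite mem_cat mem_rev => hx; apply: extP.
  by case/orP: hx => [/(allP linN)|/(allP loutN)].
have homP h : homd Ed (Phi h) = homd (bg_e Gl) h.
  apply/forallP/forallP => H.
    move=> a; apply/forallP => b; apply/implyP => /existsP[s /existsP[t /and3P[est /eqP ea /eqP eb]]].
    have /forallP/(_ t)/implyP/(_ est) := H s; rewrite !ffunE.
    have -> : clsO s = a by apply: val_inj.
    by have -> : clsO t = b by apply: val_inj.
  move=> s; apply/forallP => t; apply/implyP => est; rewrite !ffunE.
  have /forallP/(_ (clsO t))/implyP := H (clsO s); apply.
  by apply/existsP; exists s; apply/existsP; exists t; rewrite est !eqxx.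
congr #|pred_of_set _|; apply/setP => f; rewrite inE; apply/imsetP/idP.
  case=> h; rewrite inE -homP -labP => /andP[hh hl] ->; rewrite hh hl andbT /=.
  apply/allP => -[x y] hxy; have /andP[/= hx hy] := allP pN _ hxy.
  rewrite !extP // -[x]/(val (Ordinal hx)) -[y]/(val (Ordinal hy)).
  suff -> : cls (Ordinal hx) = cls (Ordinal hy) by [].
  apply: (congr1 val (cls_rt _)); rewrite /rt root_connect //.
  by apply: connect1; rewrite /R /= hxy.
case/and3P => hh hr hl.
have M0 (r : 'I_(bg_n Gl)) : r < size rs by case: r.
(* The preimage under [Phi] evaluates [f] at the root of each class. *)
pose h : {ffun 'I_(bg_n Gl) -> 'I_n} := [ffun r => f (tnth (in_tuple rs) (Ordinal (M0 r)))].
have eP : f = Phi h.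
  apply/ffunP => x; rewrite !ffunE (tnth_nth x) /= /cls valK nth_index //.
  apply: resp_connect hr _; exact: connect_root.
exists h => //; by rewrite inE -homP -labP -eP hh.
Qed.
End Glue.

Section Union.
Variables n1 n2 : nat.
Definition joinf (f1 : {ffun 'I_n1 -> 'I_n}) (f2 : {ffun 'I_n2 -> 'I_n}) :
  {ffun 'I_(n1 + n2) -> 'I_n} :=
  [ffun i => match split i with inl a => f1 a | inr b => f2 b end].

Lemma joinf_l f1 f2 a : joinf f1 f2 (lshift n2 a) = f1 a.
Proof. by rewrite ffunE; rewrite (unsplitK (inl a)). Qed.

Lemma joinf_r f1 f2 b : joinf f1 f2 (rshift n1 b) = f2 b.
Proof. by rewrite ffunE; rewrite (unsplitK (inr b)). Qed.

Lemma sum_joinf (P : {ffun 'I_(n1 + n2) -> 'I_n} -> nat) :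
  \sum_f P f = \sum_(f1 : {ffun 'I_n1 -> 'I_n}) \sum_(f2 : {ffun 'I_n2 -> 'I_n}) P (joinf f1 f2).
Proof.
rewrite pair_big /= (reindex (fun t => joinf t.1 t.2)) //=.
apply: onW_bij.
exists (fun f : {ffun 'I_(n1 + n2) -> 'I_n} =>
   ([ffun a => f (lshift n2 a)] : {ffun 'I_n1 -> 'I_n},
    [ffun b => f (rshift n1 b)] : {ffun 'I_n2 -> 'I_n})).
  move=> [f1 f2]; congr pair; apply/ffunP => a; rewrite ffunE; [exact: joinf_l|exact: joinf_r].
move=> f; apply/ffunP => i; rewrite /= -[i]splitK; case: (split i) => j /=.
  by rewrite joinf_l ffunE.
by rewrite joinf_r ffunE.
Qed.

Lemma ext_joinl f1 f2 x : x < n1 -> ext (joinf f1 f2) x = ext f1 x.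
Proof.
move=> hx; rewrite (extE _ hx) -(joinf_l f1 f2) -ext_ord //.
Qed.

Lemma ext_joinr f1 f2 x : x < n2 -> ext (joinf f1 f2) (n1 + x) = ext f2 x.
Proof.
move=> hx; rewrite (extE _ hx) -(joinf_r f1 f2) -ext_ord //.
Qed.
End Union.

Lemma homd_join F F' (f1 : {ffun 'I_(bg_n F) -> 'I_n}) (f2 : {ffun 'I_(bg_n F') -> 'I_n}) : homd (dunion_e F F') (joinf f1 f2) =
  homd (bg_e F) f1 && homd (bg_e F') f2.
Proof.
apply/forallP/andP => [H|[/forallP H1 /forallP H2] i].
  split; apply/forallP => a; apply/forallP => b; apply/implyP => eab.
    have /forallP/(_ (lshift _ b)) := H (lshift _ a); rewrite !joinf_l => /implyP; apply.
    by rewrite /dunion_e /= !ltn_ord.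
  have /forallP/(_ (rshift _ b)) := H (rshift _ a); rewrite !joinf_r => /implyP; apply.
  by rewrite /dunion_e /= !ltnNge !leq_addr /= !addKn.
apply/forallP => j; apply/implyP; rewrite -[i]splitK -[j]splitK.
case: (split i) => a; case: (split j) => b /=; rewrite /dunion_e /= ?joinf_l ?joinf_r.
- by rewrite !ltn_ord => eab; have /forallP/(_ b)/implyP := H1 a; apply.
- by rewrite ltn_ord /= !ltnNge leq_addr /= leqNgt ltn_ord.
- by rewrite (ltnNge (_ + _)) leq_addr /= (leqNgt _ b) ltn_ord.
- by rewrite !ltnNge !leq_addr /= !addKn => eab; have /forallP/(_ b)/implyP := H2 a; apply.
Qed.

Lemma resp_zip n1 n2 (f1 : {ffun 'I_n1 -> 'I_n}) (f2 : {ffun 'I_n2 -> 'I_n}) s t :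
  size s = size t -> all (fun x => x < n1) s -> all (fun x => x < n2) t ->
  all (fun t => ext (joinf f1 f2) t.1 == ext (joinf f1 f2) t.2) (zip s (map (addn n1) t)) =
  (map (ext f1) s == map (ext f2) t).
Proof.
elim: s t => [|x s IH] [|y t] //= [st] /andP[hx hs] /andP[hy ht].
by rewrite ext_joinl // ext_joinr // IH // eqseq_cons.
Qed.

Lemma zip_lt n1 n2 s t : all (fun x => x < n1) s -> all (fun x => x < n2) t ->
  all (fun t => (t.1 < n1 + n2) && (t.2 < n1 + n2)) (zip s (map (addn n1) t)).
Proof.
elim: s t => [|x s IH] [|y t] //= /andP[hx hs] /andP[hy ht].
by rewrite IH // ltn_add2l hy ltn_addr.
Qed.

(** Homomorphisms of the composite are pairs that agree on the shared labels; grouped by the common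
    word [x] they form a matrix product. *)
Lemma tens_series k F F' a b : wfb k F -> wfb k F' -> size a = k ->
  tens (series F F') (a ++ b) =
  \sum_(x <- words (iota 0 n) k) tens F (a ++ rev x) * tens F' (x ++ b).
Proof.
move=> [s1 s2]; rewrite all_cat => /andP[l1 l2] [s1' s2']; rewrite all_cat => /andP[l1' l2'] sa.
rewrite /series tens_glue; first last.
- by apply/allP => x /mapP[y hy ->]; rewrite ltn_add2l (allP l2').
- by apply: sub_all l1 => x hx; rewrite ltn_addr.
- exact: zip_lt.
rewrite sum_joinf [RHS](_ : _ = \sum_(f1 : {ffun 'I_(bg_n F) -> 'I_n})
   \sum_(f2 : {ffun 'I_(bg_n F') -> 'I_n}) \sum_(x <- words (iota 0 n) k)
   (homd (bg_e F) f1 && (map (ext f1) (lab F) == a ++ rev x)) *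
   (homd (bg_e F') f2 && (map (ext f2) (lab F') == x ++ b))); last first.
  rewrite /tens; under [LHS]eq_bigr => x _ do rewrite big_distrlr /=.
  by rewrite exchange_big; apply: eq_bigr => f1 _; rewrite exchange_big.
apply: eq_bigr => f1 _; apply: eq_bigr => f2 _.
rewrite homd_join /respects resp_zip ?s2 ?s1' //.
have -> : map (ext (joinf f1 f2)) (bg_in F ++ rev (map (addn (bg_n F)) (bg_out F'))) =
    map (ext f1) (bg_in F) ++ rev (map (ext f2) (bg_out F')).
  rewrite map_cat -map_rev -map_comp; congr cat; last rewrite -map_rev.
    by apply/eq_in_map => x hx; rewrite ext_joinl // (allP l1).
  by apply/eq_in_map => x; rewrite mem_rev => hx; rewrite /= ext_joinr // (allP l2').
rewrite /lab !map_cat !map_rev eqseq_cat ?size_map ?s1 ?sa //.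
case h1: (homd _ f1) => /=; last by rewrite big1.
case h2: (homd _ f2) => /=; last by rewrite big1 // => x _; rewrite muln0.
have mv : map (ext f1) (bg_out F) \in words (iota 0 n) k.
  by rewrite mem_words size_map s2 eqxx ext_lt.
(* The indicators of the word taken by the out-labels sum to 1, which introduces the summation over
   [x]. *)
transitivity (\sum_(x <- words (iota 0 n) k) (map (ext f1) (bg_out F) == x) *
  [&& map (ext f1) (bg_out F) == map (ext f2) (bg_in F'), map (ext f1) (bg_in F) == a
   & rev (map (ext f2) (bg_out F')) == b]).
  by rewrite -big_distrl /= sum_words // mul1n.
rewrite big_seq [RHS]big_seq; apply: eq_bigr => x; rewrite mem_words => /andP[/eqP sx _].
rewrite !eqseq_cat ?size_map ?s1 ?s1' ?sa ?sx //.
rewrite (inj_eq (can_inj revK)) -mulnb; case: (_ == x) / eqP => [<-|_]; last by rewrite andbF.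
by rewrite andbT mul1n eq_sym; case: (_ == a); case: (_ == _); case: (_ == b).
Qed.

(** Pairs that agree on all labels and take the word [c] there are the pairs whose members both take
    [c]. *)
Lemma tens_parallel k F F' c : wfb k F -> wfb k F' ->
  tens (parallel F F') c = tens F c * tens F' c.
Proof.
move=> [s1 s2]; rewrite all_cat => /andP[l1 l2] [s1' s2']; rewrite all_cat => /andP[l1' l2'].
rewrite /parallel tens_glue; first last.
- by apply: sub_all l2 => x hx; rewrite ltn_addr.
- by apply: sub_all l1 => x hx; rewrite ltn_addr.
- by rewrite all_cat !zip_lt.
rewrite sum_joinf /tens big_distrlr /=.
apply: eq_bigr => f1 _; apply: eq_bigr => f2 _.
rewrite homd_join /respects all_cat !resp_zip ?s2 ?s1 //.
have -> : map (ext (joinf f1 f2)) (bg_in F ++ rev (bg_out F)) = map (ext f1) (lab F).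
  apply/eq_in_map => x; rewrite mem_cat mem_rev => hx; rewrite ext_joinl //.
  by case/orP: hx => [/(allP l1)|/(allP l2)].
have -> : (map (ext f1) (bg_in F) == map (ext f2) (bg_in F')) &&
    (map (ext f1) (bg_out F) == map (ext f2) (bg_out F')) =
    (map (ext f1) (lab F) == map (ext f2) (lab F')).
  by rewrite /lab !map_cat !map_rev eqseq_cat ?size_map ?s1 // (inj_eq (can_inj revK)).
case: (homd _ f1) => //=; case: (homd _ f2) => //=; last by rewrite muln0.
case: (map (ext f1) (lab F) =P c) => [<-|ne]; rewrite ?andbT ?andbF // mul1n eq_sym //.
Qed.

End Tensor.

Lemma cls_glue_lt N e ps l1 l2 x : x < N ->
  (if (insub x : option 'I_N) is Some y then
     index (fingraph.root (fun x y : 'I_N => (((x : nat), (y : nat)) \in ps) || (((y : nat), (x : nat)) \in ps)) y)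
       (undup [seq fingraph.root (fun x y : 'I_N => (((x : nat), (y : nat)) \in ps) || (((y : nat), (x : nat)) \in ps)) z | z <- enum 'I_N])
   else 0) < bg_n (glue N e ps l1 l2).
Proof.
move=> hx; rewrite (insubT (fun x => x < N) hx) /= index_mem mem_undup.
by apply: map_f; rewrite mem_enum.
Qed.

Lemma wfb_glue k N e ps l1 l2 : size l1 = k -> size l2 = k ->
  all (fun x => x < N) (l1 ++ l2) -> wfb k (glue N e ps l1 l2).
Proof.
move=> s1 s2 /allP hl; split; rewrite ?size_map // -map_cat all_map.
by apply/allP => x /hl hx; apply: cls_glue_lt.
Qed.

Lemma wfb_series k F F' : wfb k F -> wfb k F' -> wfb k (series F F').
Proof.
move=> [s1 s2]; rewrite all_cat => /andP[l1 l2] [s1' s2']; rewrite all_cat => /andP[l1' l2'].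
apply: wfb_glue; rewrite ?size_map // all_cat all_map; apply/andP; split.
  by apply: sub_all l1 => x hx; rewrite ltn_addr.
by apply: sub_all l2' => x hx; rewrite /= ltn_add2l.
Qed.

Lemma wfb_parallel k F F' : wfb k F -> wfb k F' -> wfb k (parallel F F').
Proof.
move=> [s1 s2 l] _; apply: wfb_glue => //.
by apply: sub_all l => x hx; rewrite ltn_addr.
Qed.

Lemma size_cyc k : size (cyc k) = k.*2.
Proof. by rewrite size_cat size_rev !size_iota addnn. Qed.

Lemma mem_cyc k x : (x \in cyc k) = (x < k.*2).
Proof. by rewrite mem_cat mem_rev !mem_iota; lia. Qed.

Lemma uniq_cyc k : uniq (cyc k).
Proof.
rewrite cat_uniq rev_uniq !iota_uniq andbT /=.
by apply/hasPn => x; rewrite mem_rev !mem_iota; lia.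
Qed.

Lemma lab_cyc k F : wfb k F -> lab F = map (nth 0 (bg_in F ++ bg_out F)) (cyc k).
Proof.
move=> [s1 s2 _]; rewrite /lab /cyc map_cat map_rev; congr (_ ++ rev _).
  apply: (@eq_from_nth _ 0); rewrite ?size_map ?size_iota // => i hi.
  by rewrite (nth_map 0) ?size_iota -?s1 // nth_iota // nth_cat hi.
apply: (@eq_from_nth _ 0); rewrite ?size_map ?size_iota // => i hi.
rewrite s2 in hi; rewrite (nth_map 0) ?size_iota // nth_iota //.
by rewrite nth_cat s1 ltnNge leq_addr /= addKn.
Qed.

Lemma nth_rot_mod (s : seq nat) m j : m <= size s -> j < size s ->
  nth 0 (rot m s) j = nth 0 s ((j + m) %% size s).
Proof.
move=> hm hj; rewrite /rot nth_cat size_drop nth_drop.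
case: ltnP => h; first by rewrite modn_small ?[j + m]addnC //; lia.
have -> : j + m = j - (size s - m) + size s by lia.
rewrite modnDr modn_small; last lia.
by rewrite nth_take //; lia.
Qed.

Lemma wfb_permute k r F : 0 < k -> wfb k F -> wfb k (permute k r F).
Proof.
move=> k0 [s1 s2 l]; split; rewrite ?size_map ?size_iota //.
rewrite -map_cat all_map; apply/allP => x _ /=.
apply: (allP l); apply: mem_nth; rewrite size_cat s1 s2 addnn.
have : rot_perm k r x \in cyc k; last by rewrite mem_cyc.
by apply: mem_nth; rewrite size_cyc ltn_mod; lia.
Qed.

(** Read along [cyc], [rot_perm] adds [r] to the position; this is what the order of [lab] is made
    for. *)
Lemma lab_permute k r F : 0 < k -> wfb k F ->
  lab (permute k r F) = rot (r %% k.*2) (lab F).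
Proof.
move=> k0 wf; have [s1 s2 _] := wf; have k2 : 0 < k.*2 by lia.
rewrite (lab_cyc wf).
have -> : lab (permute k r F) = map (fun i => nth 0 (bg_in F ++ bg_out F) (rot_perm k r i)) (cyc k).
  by rewrite /lab /cyc map_cat map_rev.
rewrite -map_rot /rot_perm (map_comp (nth 0 (bg_in F ++ bg_out F)) (fun i => nth 0 (cyc k) _)); congr map.
apply: (@eq_from_nth _ 0); rewrite ?size_map ?size_rot // => j hj.
rewrite nth_rot_mod ?size_cyc // -?size_cyc //; last by rewrite size_cyc ltnW // ltn_mod.
by rewrite (nth_map 0) // index_uniq ?uniq_cyc // modnDmr.
Qed.

Lemma tens_permute n (E : rel 'I_n) k r F c : 0 < k -> wfb k F ->
  tens E (permute k r F) (rot (r %% k.*2) c) = tens E F c.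
Proof.
move=> k0 wf; rewrite /tens lab_permute //; apply: eq_bigr => f _.
by rewrite map_rot (inj_eq (@rot_inj _ _)).
Qed.

(** * Bilabelled minors as conjunctions of local constraints *)

Section Minors.
Variable k : nat.
Local Notation K := k.*2.

(* [pi] sends a vertex of the base graph to the vertex of the minor containing it,
   [Eq] lists contracted edges of the base graph and [Ad] surviving ones. *)
Record minv (pi : nat -> nat) (Eq Ad : seq (nat * nat)) (Q : bgraph) : Prop := Minv {
  mv_in : bg_in Q = map pi (iota 0 k);
  mv_out : bg_out Q = map pi (iota k k);
  mv_lt : forall i, i < K -> pi i < bg_n Q;
  mv_surj : forall x, x < bg_n Q -> exists2 i, i < K & pi i = x;
  mv_edge : forall x y, bg_e Q x y =
    has (fun t => ((pi t.1 == x) && (pi t.2 == y)) || ((pi t.1 == y) && (pi t.2 == x))) Ad;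
  mv_eq : forall w : nat -> nat,
    (forall i j, i < K -> j < K -> pi i = pi j -> w i = w j) <->
    all (fun t => w t.1 == w t.2) Eq;
  mv_ad : all (fun t => (t.1 < K) && (t.2 < K)) Ad }.

Lemma minv_lab pi Eq Ad Q : minv pi Eq Ad Q -> bg_in Q ++ bg_out Q = map pi (iota 0 K).
Proof. by move=> h; rewrite (mv_in h) (mv_out h) -map_cat -addnn iotaD. Qed.

Lemma minv_wfb pi Eq Ad Q : minv pi Eq Ad Q -> wfb k Q.
Proof.
move=> h; split; rewrite ?(mv_in h) ?(mv_out h) ?size_map ?size_iota //.
rewrite -map_cat all_map; apply/allP => i; rewrite mem_cat !mem_iota => hi.
by apply: (mv_lt h); lia.
Qed.

Definition within (a b : nat) (pi : nat -> nat) (t : nat * nat) :=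
  (pi t.1 \in [:: a; b]) && (pi t.2 \in [:: a; b]).

Lemma minv_del_edge pi Eq Ad Q a b : minv pi Eq Ad Q ->
  minv pi Eq [seq t <- Ad | ~~ (((pi t.1 == a) && (pi t.2 == b)) || ((pi t.1 == b) && (pi t.2 == a)))]
    (del_edge Q a b).
Proof.
case=> h1 h2 h3 h4 h5 h6 h7; split=> //=; last first.
  by apply/allP => t; rewrite mem_filter => /andP[_ /(allP h7)].
move=> x y; apply/andP/hasP => [[]|[t]].
  rewrite h5 => /hasP[t ht et] hn; exists t => //; rewrite mem_filter ht andbT.
  by apply: contra hn; case/orP: et => /andP[/eqP -> /eqP ->]; lia.
rewrite mem_filter => /andP[hn ht] et; split; first by rewrite h5; apply/hasP; exists t.
by apply: contra hn; case/orP: et => /andP[/eqP -> /eqP ->]; lia.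
Qed.

Definition fcon (a b x : nat) := down b (if x == b then a else x).

Lemma fcon_eq a b x y : a < b -> (fcon a b x == fcon a b y) =
  (x == y) || ((x \in [:: a; b]) && (y \in [:: a; b])).
Proof.
by move=> ab; rewrite /fcon /down !inE; do ?case: ifP; lia.
Qed.

(** [mv_eq] describes the fibres of [pi] by the functions constant on them, so no equivalence
    closure has to be formed: merging two fibres adds just the equation [w i = w j] of a base edge
    between them. *)
Lemma minv_contract pi Eq Ad Q a b i j : minv pi Eq Ad Q -> a < b -> b < bg_n Q ->
  (i, j) \in Ad -> ((pi i == a) && (pi j == b)) || ((pi i == b) && (pi j == a)) ->
  minv (fcon a b \o pi) ((i, j) :: Eq) [seq t <- Ad | ~~ within a b pi t] (contract Q a b).
Proof.
case=> h1 h2 h3 h4 h5 h6 h7 ab bn hij eij; have /andP[/= hi hj] := allP h7 _ hij.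
split=> /=.
- by rewrite h1 -map_comp.
- by rewrite h2 -map_comp.
- move=> l /h3; rewrite /fcon /down; do ?case: ifP; lia.
- move=> x hx; have [|l hl el] := h4 (up b x); first by rewrite /up; case: ifP; lia.
  by exists l => //=; rewrite el /fcon /up /down; do ?case: ifP; lia.
- move=> x y; apply/existsP/hasP.
    case=> s /existsP[t /and4P[]]; rewrite h5 => /hasP[[u v] huv /= euv] hn ex ey.
    exists (u, v); first rewrite mem_filter huv andbT /within /=.
      by case/orP: euv => /andP[/eqP -> /eqP ->] //; rewrite andbC.
    by case/orP: euv => /andP[/eqP -> /eqP ->] /=; rewrite /fcon ex ey ?orbT.
  case=> -[u v]; rewrite mem_filter => /andP[hw huv] /= euv.
  have /andP[/= hu hv] := allP h7 _ huv.
  rewrite /within /= in hw; case/orP: euv => /andP[eu ev].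
    exists (Ordinal (h3 _ hu)); apply/existsP; exists (Ordinal (h3 _ hv)).
    by apply/and4P; split=> //; rewrite h5; apply/hasP; exists (u, v); rewrite //= !eqxx.
  exists (Ordinal (h3 _ hv)); apply/existsP; exists (Ordinal (h3 _ hu)).
  apply/and4P; split=> //=; last by rewrite andbC.
  by rewrite h5; apply/hasP; exists (u, v); rewrite //= !eqxx orbT.
- move=> w; split=> [H|/andP[/eqP eq /(iffRL (h6 w)) H] u v hu hv /eqP].
    apply/andP; split; last by apply/(h6 w) => u v hu hv e; apply: H => //=; rewrite e.
    apply/eqP; apply: H => //=; apply/eqP; rewrite fcon_eq // !inE.
    by case/orP: eij => /andP[-> ->]; rewrite !orbT.
  rewrite /= fcon_eq // => /orP[/eqP|]; first exact: H.
  have cl l : l < K -> pi l \in [:: a; b] -> w l = w i.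
    move=> hl; rewrite !inE; case/orP: eij => /andP[/eqP ei /eqP ej] /orP[]/eqP el.
    + by apply: H; rewrite // ei.
    + by rewrite eq; apply: H; rewrite // ej.
    + by rewrite eq; apply: H; rewrite // ej.
    + by apply: H; rewrite // ei.
  by case/andP => /cl -> // /cl ->.
- by apply/allP => t; rewrite mem_filter => /andP[_ /(allP h7)].
Qed.

Section Base.
Variable Bg : bgraph.
Hypotheses (nB : bg_n Bg = K) (inB : bg_in Bg = iota 0 k) (outB : bg_out Bg = iota k k).
Hypotheses (symB : forall x y, bg_e Bg x y = bg_e Bg y x)
  (ltB : forall x y, bg_e Bg x y -> (x < K) && (y < K)).

Definition bedges : seq (nat * nat) :=
  [seq t <- [seq (x, y) | x <- iota 0 K, y <- iota 0 K] | bg_e Bg t.1 t.2].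

Lemma mem_bedges x y : ((x, y) \in bedges) = bg_e Bg x y.
Proof.
rewrite mem_filter /=; apply/andP/idP => [[]//|e]; split=> //.
by have /andP[hx hy] := ltB e; apply/allpairsP; exists (x, y); rewrite !mem_iota.
Qed.

Lemma minv_base : minv id [::] bedges Bg.
Proof.
split; rewrite ?map_id ?nB //.
- by move=> x hx; exists x.
- move=> x y; apply/idP/hasP => [e|[[u v]]].
    by exists (x, y); rewrite ?mem_bedges //= !eqxx.
  by rewrite mem_bedges /= => e /orP[]/andP[/eqP <- /eqP <-] //; rewrite symB.
- by move=> w; split=> // _ i j _ _ ->.
- by apply/allP => -[x y]; rewrite mem_bedges => /ltB.
Qed.

Lemma bminor_minv Q : bminor Bg Q -> exists pi Eq Ad,
  [/\ minv pi Eq Ad Q, {subset Eq <= bedges} & {subset Ad <= bedges}].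
Proof.
elim=> {Q} [|F a b _ [pi [Eq [Ad [h1 h2 h3]]]] e ha hb|F a b _ [pi [Eq [Ad [h1 h2 h3]]]] e ab hb
  |F w _ [pi [Eq [Ad [h1 h2 h3]]]] hw hn].
- by exists id, [::], bedges; split=> //; exact: minv_base.
- exists pi, Eq; eexists; split; [exact: minv_del_edge h1|exact: h2|].
  by move=> t; rewrite mem_filter => /andP[_ /h3].
- move: (e); rewrite (mv_edge h1) => /hasP[[i j] hij /= eij].
  exists (fcon a b \o pi), ((i, j) :: Eq); eexists; split.
  + exact: minv_contract h1 ab hb hij eij.
  + by move=> t; rewrite inE => /orP[/eqP ->|/h2 //]; apply: h3.
  + by move=> t; rewrite mem_filter => /andP[_ /h3].
(* All base vertices are labelled and [pi] is onto, so no vertex is ever available for deletion. *)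
- have [i hi ei] := mv_surj h1 hw; case/negP: hn; rewrite (minv_lab h1) -ei.
  by apply: map_f; rewrite mem_iota.
Qed.

(** Unwanted edges are deleted one by one. Both orientations of an edge are listed and vanish
    together, hence the symmetry of [keep] and the induction on a bound for the length. *)
Lemma bminor_keep (keep : pred (nat * nat)) : (forall x y, keep (x, y) = keep (y, x)) ->
  exists Q, bminor Bg Q /\ minv id [::] [seq t <- bedges | keep t] Q.
Proof.
move=> kC.
suff H m Q Ad : size Ad <= m -> bminor Bg Q -> minv id [::] Ad Q ->
    exists Q', bminor Bg Q' /\ minv id [::] [seq t <- Ad | keep t] Q'.
  exact: H (leqnn _) (bm_refl _) minv_base.
elim: m Q Ad => [|m IH] Q Ad hm hQ hi.
  by exists Q; case: Ad hm hi.
case: (boolP (all keep Ad)) => [/all_filterP ->|]; first by exists Q.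
rewrite -has_predC => /hasP[[a b] hab /= nk].
have hab' := allP (mv_ad hi) _ hab; have /andP[/= ha hb] := hab'.
have eab : bg_e Q a b by rewrite (mv_edge hi); apply/hasP; exists (a, b); rewrite //= !eqxx.
have := minv_del_edge a b hi; set Ad' := filter _ Ad => hi'.
have [||Q' [hQ' hiQ']] := IH _ Ad' _ _ hi'.
- have : size Ad' < size Ad; last lia.
  rewrite size_filter -(count_predC (fun t : nat * nat => ~~ (((t.1 == a) && (t.2 == b)) || ((t.1 == b) && (t.2 == a)))) Ad).
  rewrite -[X in X < _]addn0 ltn_add2l -has_count; apply/hasP; exists (a, b) => //=.
  by rewrite !eqxx.
- by apply: bm_del_edge hQ eab _ _; have := mv_lt hi; [move/(_ _ ha)|move/(_ _ hb)].
exists Q'; split=> //; suff -> : [seq t <- Ad | keep t] = [seq t <- Ad' | keep t] by [].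
rewrite -filter_predI; apply: eq_in_filter => -[x y] _ /=.
case kxy: (keep (x, y)) => //=; apply/esym/negP => /orP[]/andP[/eqP ex /eqP ey].
  by rewrite -ex -ey kxy in nk.
by rewrite -ex -ey kC kxy in nk.
Qed.

Definition ends (cs : seq (nat * nat)) := flatten [seq [:: c.1; c.2] | c <- cs].

(* The edges of a matching can be contracted one after the other, as contracting
   one of them does not affect the endpoints of the others. *)
Lemma bminor_contracts (cs : seq (nat * nat)) pi Eq Ad Q : bminor Bg Q -> minv pi Eq Ad Q ->
  {subset cs <= Ad} -> uniq (ends cs) ->
  (forall i l : nat, i \in ends cs -> l < K -> pi l = pi i -> l = i) ->
  exists Q' pi', bminor Bg Q' /\
    minv pi' (rev cs ++ Eq)
      [seq t <- Ad | ~~ has (fun c => (t.1 \in [:: c.1; c.2]) && (t.2 \in [:: c.1; c.2])) cs] Q'.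
Proof.
elim: cs pi Eq Ad Q => [|[i j] cs IH] pi Eq Ad Q hQ hi hsub hu hsg.
  by exists Q, pi; rewrite filter_predT.
have hij : (i, j) \in Ad by apply: hsub; rewrite mem_head.
have /andP[/= iK jK] := allP (mv_ad hi) _ hij.
have hends : forall x, x \in ends cs -> x \in ends ((i, j) :: cs) by move=> x hx; rewrite /ends /= !inE -/(ends cs) hx !orbT.
move: (hu); rewrite /ends /= -/(ends cs) !inE negb_or => /and3P[/andP[nij ni] nj hu'].
have sgi l : l < K -> pi l = pi i -> l = i by apply: hsg; rewrite /ends /= mem_head.
have sgj l : l < K -> pi l = pi j -> l = j by apply: hsg; rewrite /ends /= !inE eqxx orbT.
have npij : pi i != pi j by apply: contra nij => /eqP e; apply/eqP; apply: sgj.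
(* Contraction merges the larger vertex number into the smaller one, whatever the orientation of the
   edge. *)
pose a := minn (pi i) (pi j); pose b := maxn (pi i) (pi j).
have ab : a < b by rewrite /a /b; lia.
have bn : b < bg_n Q by rewrite /b gtn_max !(mv_lt hi).
have eij : ((pi i == a) && (pi j == b)) || ((pi i == b) && (pi j == a)) by rewrite /a /b; lia.
have inab l : l < K -> (pi l \in [:: a; b]) = (l \in [:: i; j]).
  move=> hl; rewrite !inE; have -> : (pi l == a) || (pi l == b) = (pi l == pi i) || (pi l == pi j).
    by rewrite /a /b; lia.
  by congr orb; apply/eqP/eqP => [|-> //]; [apply: sgi|apply: sgj].
have eab : bg_e Q a b.
  rewrite (mv_edge hi); apply/hasP; exists (i, j) => //=.
have hi' := minv_contract hi ab bn hij eij.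
have [||Q' [pi' [hQ' hiQ']]] := IH _ _ _ _ (bm_contract hQ eab ab bn) hi' _ hu'.
- move=> [u v] huv; rewrite mem_filter hsub ?inE ?huv ?orbT // andbT /within /=.
  have /andP[/= uK vK] := allP (mv_ad hi) _ (hsub _ (mem_behead (s := (i, j) :: cs) huv)).
  rewrite inab // !inE; apply: contra ni => /andP[]/orP[]/eqP eu _; last first.
    by case/negP: nj; rewrite -eu; apply/flattenP; exists [:: u; v]; rewrite ?mem_head //; apply/mapP; exists (u, v).
  by rewrite -eu; apply/flattenP; exists [:: u; v]; rewrite ?mem_head //; apply/mapP; exists (u, v).
- move=> x l hx hl /eqP; rewrite /= fcon_eq // => /orP[/eqP|/andP[_]]; first exact: hsg (hends _ hx) hl.
  have xK : x < K.
    case/flattenP: hx => s /mapP[[u v] huv ->].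
    have /andP[/= uK vK] := allP (mv_ad hi) _ (hsub _ (mem_behead (s := (i, j) :: cs) huv)).
    by rewrite !inE => /orP[]/eqP ->.
  by rewrite inab // !inE => /orP[]/eqP e; [case/negP: ni|case/negP: nj]; rewrite -e.
exists Q', pi'; split=> //.
rewrite rev_cons cat_rcons; suff -> : [seq t <- Ad | ~~ has
    (fun c => (t.1 \in [:: c.1; c.2]) && (t.2 \in [:: c.1; c.2])) ((i, j) :: cs)] =
   [seq t <- [seq t <- Ad | ~~ within a b pi t] | ~~ has
    (fun c => (t.1 \in [:: c.1; c.2]) && (t.2 \in [:: c.1; c.2])) cs] by [].
rewrite -filter_predI; apply: eq_in_filter => -[u v] huv.
have /andP[/= uK vK] := allP (mv_ad hi) _ huv.
by rewrite /within /= !inab // negb_or andbC.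
Qed.
End Base.
End Minors.

Lemma ext_inj_on n m (f g : {ffun 'I_m -> 'I_n}) : (forall x : 'I_m, ext f x = ext g x) -> f = g.
Proof. by move=> h; apply/ffunP => x; apply: val_inj; rewrite /= -!ext_ord. Qed.

Definition natrel n (E : rel 'I_n) (x y : nat) : bool :=
  match insub x, insub y with Some i, Some j => E i j | _, _ => false end.

Lemma natrel_ord n (E : rel 'I_n) (i j : 'I_n) : natrel E i j = E i j.
Proof. by rewrite /natrel !valK. Qed.

Lemma natrel_sym n (E : rel 'I_n) : symmetric E -> symmetric (natrel E).
Proof. by move=> h x y; rewrite /natrel; case: insub => [i|]; case: insub. Qed.

Section TensMinor.
Variables (k n : nat) (E : rel 'I_n).
Hypothesis symE : symmetric E.

(** Every vertex of the minor carries a label, so the word leaves at most one map. It exists if the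
    equations in [Eq] hold, and it is a homomorphism if the edges in [Ad] are respected. *)
Lemma tens_minv pi Eq Ad Q a b : minv k pi Eq Ad Q ->
  a \in words (iota 0 n) k -> b \in words (iota 0 n) k ->
  let w := nth 0 (a ++ rev b) in
  tens E Q (a ++ b) =
  all (fun t => w t.1 == w t.2) Eq && all (fun t => natrel E (w t.1) (w t.2)) Ad.
Proof.
rewrite !mem_words => hi /andP[/eqP sa ha] /andP[/eqP sb hb] w.
have labE (f : {ffun 'I_(bg_n Q) -> 'I_n}) : (map (ext f) (lab Q) == a ++ b) =
    all (fun i => ext f (pi i) == w i) (iota 0 k.*2).
  transitivity (map (ext f) (bg_in Q ++ bg_out Q) == a ++ rev b).
    rewrite /lab !map_cat !eqseq_cat ?size_map ?(mv_in hi) ?size_map ?size_iota ?sa //.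
    by rewrite map_rev -{1}[b]revK (inj_eq (can_inj revK)).
  rewrite (minv_lab hi) -map_comp.
  have sw : size (a ++ rev b) = k.*2 by rewrite size_cat size_rev sa sb addnn.
  apply/eqP/allP => [e i|H].
    rewrite mem_iota => hx; rewrite /w -e (nth_map 0) ?size_iota // nth_iota //=.
  apply: (@eq_from_nth _ 0); rewrite size_map size_iota // => i hx.
  by rewrite (nth_map 0) ?size_iota // nth_iota //; apply/eqP; apply: H; rewrite mem_iota.
have [hEq|nEq] := boolP (all _ Eq); last first.
  rewrite /tens big1 // => f _; case: eqP => [/eqP|_]; last by rewrite andbF.
  rewrite labE => /allP h; case/negP: nEq; apply/(mv_eq hi w) => i j hx hy e.
  have /eqP <- : ext f (pi i) == w i by apply: h; rewrite mem_iota.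
  have /eqP <- : ext f (pi j) == w j by apply: h; rewrite mem_iota.
  by rewrite e.
have resp := iffRL (mv_eq hi w) hEq.
(* A base vertex in the fibre over [x]. *)
pose ix x := index x (map pi (iota 0 k.*2)).
have ixP x : x < bg_n Q -> ix x < k.*2 /\ pi (ix x) = x.
  move=> /(mv_surj hi)[i hx e].
  have m : x \in map pi (iota 0 k.*2) by rewrite -e; apply: map_f; rewrite mem_iota.
  have lt : ix x < k.*2 by move: m; rewrite -index_mem size_map size_iota.
  split=> //; rewrite -[RHS](nth_index 0 m) (nth_map 0) ?size_iota // nth_iota //.
have wlt (x : 'I_(bg_n Q)) : w (ix x) < n.
  have [h _] := ixP _ (ltn_ord x).
  have : all (fun x => x < n) (a ++ rev b) by rewrite all_cat ha all_rev.
  by move/allP; apply; apply: mem_nth; rewrite size_cat size_rev sa sb addnn.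
pose f0 : {ffun 'I_(bg_n Q) -> 'I_n} := [ffun x => Ordinal (wlt x)].
have f0E i : i < k.*2 -> ext f0 (pi i) = w i.
  move=> hx; rewrite (extE _ (mv_lt hi hx)) ffunE /=.
  by have [h1 h2] := ixP _ (mv_lt hi hx); apply: resp.
have lab0 f : (map (ext f) (lab Q) == a ++ b) = (f == f0).
  rewrite labE; apply/allP/eqP => [h|-> i]; last by rewrite mem_iota => /f0E ->.
  apply: ext_inj_on => x; have [h1 h2] := ixP _ (ltn_ord x).
  by rewrite -h2 f0E //; apply/eqP; apply: h; rewrite mem_iota.
rewrite /tens (bigD1 f0) //= big1 => [|f nf]; last by rewrite lab0 (negbTE nf) andbF.
rewrite lab0 eqxx andbT addn0; congr nat_of_bool.
have rE i j (hx : i < k.*2) (hy : j < k.*2) :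
    natrel E (w i) (w j) = E (f0 (Ordinal (mv_lt hi hx))) (f0 (Ordinal (mv_lt hi hy))).
  by rewrite -natrel_ord -!ext_ord /= !f0E.
apply/forallP/allP => [H [i j] hij|H x].
  have /andP[/= hx hy] := allP (mv_ad hi) _ hij; rewrite rE.
  have /forallP/(_ (Ordinal (mv_lt hi hy)))/implyP := H (Ordinal (mv_lt hi hx)); apply.
  by rewrite (mv_edge hi); apply/hasP; exists (i, j); rewrite //= !eqxx.
apply/forallP => y; apply/implyP; rewrite (mv_edge hi) => /hasP[[i j] hij /= e].
have /andP[/= hx hy] := allP (mv_ad hi) _ hij; have := H _ hij; rewrite /= rE.
by case/orP: e => /andP[/eqP ex /eqP ey]; last rewrite symE;
   congr (E (f0 _) (f0 _)); apply: val_inj.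
Qed.
End TensMinor.

(** * The minors of the two base graphs *)

Section BaseGraphs.
Variable k : nat.
Hypothesis k_gt0 : 0 < k.

Lemma sym_edges_sym N P x y : sym_edges N P x y = sym_edges N P y x.
Proof. by rewrite /sym_edges [(x < N) && _]andbC orbC. Qed.

Lemma sym_edges_lt N P x y : sym_edges N P x y -> (x < N) && (y < N).
Proof. by case/andP. Qed.

Definition minor_tens (B Q : bgraph) (Eq Ad : seq (nat * nat)) :=
  [/\ bminor B Q, wfb k Q & forall n (E : rel 'I_n) a b, symmetric E ->
     a \in words (iota 0 n) k -> b \in words (iota 0 n) k ->
     let w := nth 0 (a ++ rev b) in
     tens E Q (a ++ b) =
     all (fun t => w t.1 == w t.2) Eq && all (fun t => natrel E (w t.1) (w t.2)) Ad].

Lemma minor_tensI B pi Eq Ad Q : bminor B Q -> minv k pi Eq Ad Q -> minor_tens B Q Eq Ad.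
Proof.
move=> hQ hi; split=> //; first exact: minv_wfb hi.
by move=> n E a b sE ha hb; exact (tens_minv sE hi ha hb).
Qed.

Lemma base_minor_tens B Q : B = C_bg k \/ B = M_bg k -> bminor B Q -> exists Eq Ad,
  [/\ minor_tens B Q Eq Ad, {subset Eq <= bedges k B} & {subset Ad <= bedges k B}].
Proof.
move=> hB hQ; have [|||||pi [Eq [Ad [h1 h2 h3]]]] := @bminor_minv k B _ _ _ _ _ Q hQ;
  try by case: hB => ->.
- by case: hB => -> x y; apply: sym_edges_sym.
- by case: hB => -> x y; apply: sym_edges_lt.
by exists Eq, Ad; split=> //; apply: minor_tensI h1.
Qed.

Lemma QP_tens Q : QP k Q -> exists Eq Ad, [/\ minor_tens (C_bg k) Q Eq Ad,
  {subset Eq <= bedges k (C_bg k)} & {subset Ad <= bedges k (C_bg k)}].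
Proof. by apply: base_minor_tens; left. Qed.

Lemma QS_tens Q : QS k Q -> exists Eq Ad, [/\ minor_tens (M_bg k) Q Eq Ad,
  {subset Eq <= bedges k (M_bg k)} & {subset Ad <= bedges k (M_bg k)}].
Proof. by apply: base_minor_tens; right. Qed.

Lemma matching_tens B keep (cs : seq (nat * nat)) : B = C_bg k \/ B = M_bg k ->
  (forall x y, keep (x, y) = keep (y, x)) ->
  {subset cs <= [seq t <- bedges k B | keep t]} -> uniq (ends cs) ->
  exists Q, minor_tens B Q (rev cs)
    [seq t <- [seq t <- bedges k B | keep t] |
       ~~ has (fun c => (t.1 \in [:: c.1; c.2]) && (t.2 \in [:: c.1; c.2])) cs].
Proof.
move=> hB kC hs hu.
have nB : bg_n B = k.*2 by case: hB => ->.
have iB : bg_in B = iota 0 k by case: hB => ->.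
have oB : bg_out B = iota k k by case: hB => ->.
have sB x y : bg_e B x y = bg_e B y x by case: hB => ->; apply: sym_edges_sym.
have lB x y : bg_e B x y -> (x < k.*2) && (y < k.*2) by case: hB => ->; apply: sym_edges_lt.
have [Q [hQ hi]] := bminor_keep nB iB oB sB lB kC.
have [Q' [pi' [hQ' hi']]] := bminor_contracts nB hQ hi hs hu (fun i l _ _ e => e).
by rewrite cats0 in hi'; exists Q'; apply: minor_tensI hQ' hi'.
Qed.

(** Uniform in [k]: for [k = 1] it joins the in-label to the out-label, otherwise it is the first
    edge of the path of in-labels. *)
Lemma C_edge01 : bg_e (C_bg k) 0 1.
Proof. by rewrite /= /sym_edges; lia. Qed.

Let keep01 (t : nat * nat) := (t == (0, 1)) || (t == (1, 0)).

Let keep01C x y : keep01 (x, y) = keep01 (y, x).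
Proof. by rewrite /keep01 !xpair_eqE; lia. Qed.

Let mem_keep01 t : (t \in [seq t <- bedges k (C_bg k) | keep01 t]) = keep01 t.
Proof.
rewrite mem_filter andb_idr // /keep01 => /orP[]/eqP ->;
rewrite mem_bedges //; try exact: sym_edges_lt; first exact: C_edge01.
by rewrite /bg_e /= sym_edges_sym; exact: C_edge01.
Qed.

(** Deleting all other edges before contracting this one leaves an edgeless minor, whose tensor is
    the equality mask of [opE]. *)
Lemma QE_exists : exists Q, minor_tens (C_bg k) Q [:: (0, 1)] [::].
Proof.
have [||Q] := @matching_tens (C_bg k) keep01 [:: (0, 1)] (or_introl erefl) keep01C.
- by move=> t; rewrite inE mem_keep01 => /eqP ->.
- by [].
have -> : [seq t <- [seq t <- bedges k (C_bg k) | keep01 t]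
  | ~~ has (fun c => (t.1 \in [:: c.1; c.2]) && (t.2 \in [:: c.1; c.2])) [:: (0, 1)]] = [::].
  apply/eqP; rewrite -[_ == _]negbK -has_filter; apply/negP => /hasP[t].
  by rewrite mem_keep01 => /orP[]/eqP ->.
by exists Q.
Qed.

Lemma QA_exists : exists Q Ad, minor_tens (C_bg k) Q [::] Ad /\ Ad =i [:: (0, 1); (1, 0)].
Proof.
have [//|//|Q] := @matching_tens (C_bg k) keep01 [::] (or_introl erefl) keep01C.
set Ad := filter _ _ => h; exists Q, Ad; split=> // t.
by rewrite /Ad filter_predT mem_keep01 !inE.
Qed.

Definition okrel (e : rel nat) (r : nat * (nat * nat)) : bool :=
  if r.1 == 0 then true else if r.1 == 1 then r.2.1 == r.2.2 else e r.2.1 r.2.2.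

Lemma all_okrel (e : rel nat) t a b : size t = k -> size a = k -> size b = k ->
  all (okrel e) (zip t (zip a (rev b))) =
  all (fun i => okrel e (nth 0 t i, (nth 0 (a ++ rev b) i, nth 0 (a ++ rev b) (i + k)))) (iota 0 k).
Proof.
move=> st sa sb; rewrite -[RHS](all_map _ (fun r => r)).
rewrite -(all_map (okrel e) (fun r => r)); congr all.
apply: (@eq_from_nth _ true).
  by rewrite !size_map !size_zip size_rev st sa sb size_iota !minnn.
move=> i; rewrite size_map !size_zip size_rev st sa sb !minnn => hi.
rewrite (nth_map (0, (0, 0))) ?size_zip ?size_rev ?st ?sa ?sb ?minnn //.
rewrite (nth_map 0) ?size_iota // nth_iota // add0n.
rewrite !nth_zip ?size_zip ?size_rev ?st ?sa ?sb ?minnn //.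
by rewrite !nth_cat sa hi ltnNge leq_addl /= addnK.
Qed.

Lemma M_edge x y : bg_e (M_bg k) x y = ((x < k) && (y == x + k)) || ((y < k) && (x == y + k)).
Proof. by rewrite /= /sym_edges; lia. Qed.

Lemma mem_ends x cs : (x \in ends cs) = has (fun c => x \in [:: c.1; c.2]) cs.
Proof. by elim: cs => //= c cs IH; rewrite /ends /= -/(ends cs) !inE IH orbA. Qed.

Lemma uniq_ends s : uniq s -> all (fun i => i < k) s -> uniq (ends [seq (i, i + k) | i <- s]).
Proof.
elim: s => //= i s IH /andP[hi us] /andP[ik hs].
rewrite /ends /= -/(ends _) IH // andbT inE negb_or -andbA.
apply/and3P; split; first by apply/eqP; lia.
  rewrite mem_ends has_map; apply/hasPn => j hj /=; rewrite !inE negb_or.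
  by apply/andP; split; apply/eqP => e; [rewrite e hj in hi | lia].
rewrite mem_ends has_map; apply/hasPn => j hj /=; rewrite !inE negb_or.
apply/andP; split; apply/eqP => e; first by have := allP hs _ hj; lia.
by have e' : i = j by [lia]; rewrite e' hj in hi.
Qed.

(** The rungs of M_k form a matching, so deletion, contraction or survival can be chosen
    independently for each of them. *)
Lemma QM_exists t : size t = k -> exists Q, QS k Q /\ wfb k Q /\
  forall n (E : rel 'I_n) a b, symmetric E ->
     a \in words (iota 0 n) k -> b \in words (iota 0 n) k ->
     tens E Q (a ++ b) = all (okrel (natrel E)) (zip t (zip a (rev b))).
Proof.
(* [minn] gives the index of the rung from either orientation. *)
move=> st; pose keep (c : nat * nat) := nth 0 t (minn c.1 c.2) != 0.
pose cs := [seq (i, i + k) | i <- iota 0 k & nth 0 t i == 1].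
have ltM x y : bg_e (M_bg k) x y -> (x < k.*2) && (y < k.*2) by apply: sym_edges_lt.
have csP c : (c \in cs) = [&& c.1 < k, c.2 == c.1 + k & nth 0 t c.1 == 1].
  apply/mapP/and3P => [[i]|[h1 /eqP h2 h3]].
    by rewrite mem_filter mem_iota => /andP[h1 h2] ->.
  by exists c.1; [rewrite mem_filter h3 mem_iota|rewrite -h2; case: (c)].
have [|||Q [hQ wQ tQ]] := @matching_tens (M_bg k) keep cs (or_intror erefl).
- by move=> x y; rewrite /keep minnC.
- move=> [x y]; rewrite csP mem_filter mem_bedges // M_edge /keep /= => /and3P[hx /eqP -> /eqP ht].
  by rewrite (_ : minn x (x + k) = x) ?ht ?hx ?eqxx //; lia.
- apply: uniq_ends; first by rewrite filter_uniq ?iota_uniq.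
  by apply/allP => i; rewrite mem_filter mem_iota => /andP[].
exists Q; split=> //; split=> // n E a b sE ha hb; rewrite tQ //.
move: (ha); rewrite mem_words => /andP[/eqP sa _].
move: (hb); rewrite mem_words => /andP[/eqP sb _].
rewrite all_okrel //; congr nat_of_bool.
have AdP x y : ((x, y) \in [seq t <- [seq t <- bedges k (M_bg k) | keep t]
     | ~~ has (fun c => (t.1 \in [:: c.1; c.2]) && (t.2 \in [:: c.1; c.2])) cs]) ->
   exists2 i, i < k & [/\ nth 0 t i != 0, nth 0 t i != 1 & (x, y) = (i, i + k) \/ (x, y) = (i + k, i)].
  rewrite mem_filter mem_filter mem_bedges // M_edge /keep /= => /and3P[hn h0 /orP[]/andP[hx /eqP e]].
    exists x => //; rewrite e (_ : minn x (x + k) = x) in h0 *; last lia.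
    split=> //; last by left.
    apply: contra hn => h1; apply/hasP; exists (x, x + k); first by rewrite csP /= hx eqxx.
    by rewrite e !inE !eqxx orbT.
  exists y => //; rewrite e (_ : minn (y + k) y = y) in h0 *; last lia.
  split=> //; last by right.
  apply: contra hn => h1; apply/hasP; exists (y, y + k); first by rewrite csP /= hx eqxx.
  by rewrite e !inE !eqxx orbT.
apply/andP/allP => [[/allP hE /allP hA] i|H].
  rewrite mem_iota add0n => /= hi; rewrite /okrel /=; case: eqP => // h0; case: eqP => [h1|h1].
    by apply: (hE (i, i + k)); rewrite mem_rev csP /= hi eqxx h1.
  apply: (hA (i, i + k)); rewrite mem_filter mem_filter mem_bedges // M_edge hi eqxx /keep /=.
  rewrite (_ : minn i (i + k) = i); last lia.
  apply/and3P; split=> //; last by apply/eqP.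
  apply/negP => /hasP[[u v]]; rewrite csP /= => /and3P[hu /eqP -> /eqP hu1].
  rewrite !inE => /andP[/orP[]/eqP e _]; last lia.
  by case: h1; rewrite e.
split; apply/allP => -[x y].
  rewrite mem_rev csP /= => /and3P[hx /eqP -> /eqP h1].
  by have := H x; rewrite mem_iota hx /okrel /= h1 /=; apply.
move/AdP => [i hi [h0 h1 hxy]].
have := H i; rewrite mem_iota hi /okrel /= (negbTE h0) (negbTE h1) => /(_ isT) h.
by case: hxy => -[-> ->] //=; rewrite (natrel_sym sE).
Qed.
End BaseGraphs.

(** * Correctness of the elimination *)

Section Vectors.
Variables (x : ctx) (q : nat).
Hypotheses (p2 : (val2 (cP x)).*2 <= 2 ^ size (cP x)) (q_pr : prime q) (pq : val2 (cP x) = q).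
Hypothesis C_uniq : uniq (cC x).

Local Notation p := (cP x).
Local Notation C := (cC x).
Local Notation z := (zer (cP x)).
Local Notation okn := (okn (cP x)).
Local Notation phi := (phi q).
Local Notation F := 'F_q.

Definition okV (v : vec) := (size v == size C) && all okn v.

Definition sem (v : vec) (c : coord) : F := phi (look x v c).

Lemma eqcE (c d : coord) : eqc c d = (c == d).
Proof. by case: c d => g [a b] [g' [a' b']]; rewrite /eqc /= !xpair_eqE. Qed.

Lemma foldl_look c s v acc : uniq s -> size v = size s ->
  foldl (lookstep c) acc (zip s v) = if c \in s then nth z v (index c s) else acc.
Proof.
elim: s v acc => [|d s IH] [|a v] acc //= /andP[ds us] [sv].
rewrite IH // inE /lookstep /= eqcE eq_sym; case: eqP => [->|_] //=.
by rewrite (negbTE ds).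
Qed.

Lemma look_nth v c : size v = size C -> c \in C -> look x v c = nth z v (index c C).
Proof. by move=> sv hc; rewrite /look foldl_look // hc. Qed.

Lemma look_map f c : c \in C -> look x [seq f d | d <- C] c = f c.
Proof.
move=> hc; rewrite look_nth ?size_map // (nth_map c) ?index_mem //.
by rewrite nth_index.
Qed.

Lemma sem_map f c : c \in C -> sem [seq f d | d <- C] c = phi (f c).
Proof. by move=> hc; rewrite /sem look_map. Qed.

Lemma okV_map f : (forall c, c \in C -> okn (f c)) -> okV [seq f c | c <- C].
Proof.
move=> h; rewrite /okV size_map eqxx; apply/allP => a /mapP[c hc ->]; exact: h.
Qed.

Lemma okn_look v c : okV v -> okn (look x v c).
Proof.
case/andP => /eqP sv /allP hv; rewrite /look foldl_look //.
case: ifP => [hc|_]; last by case: (phi0 q_pr pq).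
by apply: hv; apply: mem_nth; rewrite sv index_mem.
Qed.

Lemma okn_nth v i : okV v -> okn (nth z v i).
Proof.
case/andP => _ /allP hv; have [hi|hi] := ltnP i (size v); first exact/hv/mem_nth.
by rewrite nth_default //; case: (phi0 q_pr pq).
Qed.

Definition fi (b : vec) := find nz b.

Lemma foldl_piv v b : size v = size b -> has nz b ->
  piv v b = (nth z v (fi b), nth z b (fi b)).
Proof.
rewrite /piv => sv; suff H acc : acc.1 = false -> has nz b ->
   foldl pivstep acc (zip v b) = (true, (nth z v (fi b), nth z b (fi b))) by move=> h; rewrite H.
have st t s : foldl pivstep (true, t) s = (true, t) by elim: s.
rewrite /fi; elim: b v sv acc => [|y b IH] [|u v] //= [sv] acc hacc.
by rewrite /pivstep hacc /=; case: ifP => /= [ny|ny] h; [rewrite st|rewrite IH].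
Qed.

Lemma red1_nth v b i : okV v -> okV b -> has nz b -> i < size C ->
  okn (nth z (red1 p v b) i) /\
  phi (nth z (red1 p v b) i) =
  (phi (nth z b (fi b)) * phi (nth z v i) - phi (nth z v (fi b)) * phi (nth z b i))%R.
Proof.
move=> ov ob hb hi; have /andP[/eqP sv _] := ov; have /andP[/eqP sb _] := ob.
rewrite /red1 foldl_piv ?sv ?sb // /elim1 (nth_map (z, z)) ?size_zip ?sv ?sb ?minnn //.
rewrite nth_zip ?sv ?sb //=.
have [o1 e1] := phiN p2 q_pr pq (okn_nth (fi b) ov).
have [o2 e2] := phiM p2 q_pr pq (nth z b (fi b)) (okn_nth i ov).
have [o3 e3] := phiM p2 q_pr pq (negm p (nth z v (fi b))) (okn_nth i ob).
have [o4 e4] := phiD p2 q_pr pq o2 o3; split=> //.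
by rewrite e4 e2 e3 e1 mulNr.
Qed.

Lemma okV_red1 v b : okV v -> okV b -> has nz b -> okV (red1 p v b).
Proof.
move=> ov ob hb; have /andP[/eqP sv _] := ov; have /andP[/eqP sb _] := ob.
have ss : size (red1 p v b) = size C by rewrite size_map size_zip sv sb minnn.
rewrite /okV ss eqxx; apply/(all_nthP z) => i; rewrite ss => hi.
by case: (red1_nth ov ob hb hi).
Qed.

Lemma fi_lt b : okV b -> has nz b -> fi b < size C.
Proof. by case/andP => /eqP <- _; rewrite has_find. Qed.

Lemma fi_nz b : okV b -> has nz b -> phi (nth z b (fi b)) != 0%R.
Proof. by move=> ob hb; rewrite -(phi_nz p2 q_pr pq (okn_nth _ ob)); apply: nth_find. Qed.

(** With [pairwise], a one-sided echelon form: later vectors vanish at the pivots of earlier ones,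
    and this makes the pivots distinct. *)
Definition tri (b b' : vec) := phi (nth z b' (fi b)) == 0%R.

Definition binv (Bs : seq vec) :=
  [/\ all okV Bs, all (has nz) Bs & pairwise tri Bs].

Inductive lincomb (Bs : seq vec) : (nat -> F) -> Prop :=
| lc0 f : (forall i, i < size C -> f i = 0%R) -> lincomb Bs f
| lcS a b f h : b \in Bs -> lincomb Bs f ->
    (forall i, i < size C -> h i = (a * phi (nth z b i) + f i)%R) -> lincomb Bs h.

Lemma lincomb_sub Bs Bs' f : {subset Bs <= Bs'} -> lincomb Bs f -> lincomb Bs' f.
Proof.
move=> hs; elim=> {f} [f hf|a b f h hb _ IH hf]; first exact: lc0.
exact: lcS (hs _ hb) IH hf.
Qed.

(** The third clause carries the induction: once the pivot of the first vector is cleared, the later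
    vectors, which vanish there, keep it cleared. The fourth says that a residue and the original
    vector are interchangeable modulo the span. *)
Lemma redall_spec Bs v : binv Bs -> okV v ->
  [/\ okV (redall p Bs v),
      forall b, b \in Bs -> phi (nth z (redall p Bs v) (fi b)) = 0%R,
      forall i, i < size C -> phi (nth z v i) = 0%R ->
        (forall b, b \in Bs -> phi (nth z b i) = 0%R) -> phi (nth z (redall p Bs v) i) = 0%R &
      exists a, a != 0%R /\ exists2 f, lincomb Bs f &
        forall i, i < size C -> phi (nth z (redall p Bs v) i) = (a * phi (nth z v i) + f i)%R].
Proof.
elim: Bs v => [|b Bs IH] v.
  move=> _ ov; split=> //; exists 1%R; split; first exact: oner_neq0.
  by exists (fun=> 0%R); [exact: lc0|move=> i _; rewrite mul1r addr0].
case=> /= /andP[ob oB] /andP[nb nB] /andP[tb tB] ov.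
have o1 := okV_red1 ov ob nb.
have [//|o2 h1 h2 [a [a0 [f lf ef]]]] := IH _ _ o1.
have hfb := fi_lt ob nb.
split=> //.
- move=> b'; rewrite inE => /orP[/eqP ->|/h1 //]; apply: h2 => //.
    by case: (red1_nth ov ob nb hfb) => _ ->; rewrite mulrC subrr.
  by move=> b'' hb''; apply/eqP; apply: (allP tb).
- move=> i hi vi hb; apply: h2 => // [|b' hb']; last by apply: hb; rewrite inE hb' orbT.
  case: (red1_nth ov ob nb hi) => _ ->.
  by rewrite vi (hb b) ?mem_head // !mulr0 subr0.
(* The scalar is the product of the pivot entries. *)
- exists (a * phi (nth z b (fi b)))%R; split; first by rewrite mulf_neq0 ?fi_nz.
  exists (fun i => (- (a * phi (nth z v (fi b)))) * phi (nth z b i) + f i)%R.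
    apply: (@lcS _ (- (a * phi (nth z v (fi b))))%R b f) => //; first by rewrite mem_head.
    by apply: lincomb_sub lf => t ht; rewrite inE ht orbT.
  move=> i hi; rewrite ef //; case: (red1_nth ov ob nb hi) => _ ->.
  by rewrite mulrBr mulNr !mulrA addrA.
Qed.

Lemma binv_rcons Bs v : binv Bs -> okV v -> has nz (redall p Bs v) ->
  binv (rcons Bs (redall p Bs v)).
Proof.
move=> hB ov hn; have [o1 h1 _ _] := redall_spec hB ov; case: hB => oB nB tB.
rewrite /binv !all_rcons o1 hn oB nB; split=> //.
rewrite pairwise_rcons tB andbT; apply/allP => b hb; apply/eqP; exact: h1.
Qed.

Lemma binv_size Bs : binv Bs -> size Bs <= size C.
Proof.
case=> oB nB tB; rewrite -(size_map fi) -(size_iota 0 (size C)); apply: uniq_leq_size; last first.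
  move=> i /mapP[b hb ->]; rewrite mem_iota /= add0n fi_lt //; [exact: (allP oB)|exact: (allP nB)].
elim: Bs oB nB tB => //= b Bs IH /andP[ob oB] /andP[nb nB] /andP[tb tB].
rewrite IH // andbT; apply/negP => /mapP[b' hb' e].
have := allP tb _ hb'; rewrite /tri e; apply/negP.
by apply: fi_nz; [exact: (allP oB)|exact: (allP nB)].
Qed.

Lemma sem_nth v c : okV v -> c \in C -> sem v c = phi (nth z v (index c C)).
Proof. by move=> /andP[/eqP sv _] hc; rewrite /sem look_nth. Qed.

Lemma nz_vec v : okV v -> ~~ has nz v -> forall i, phi (nth z v i) = 0%R.
Proof.
move=> ov hn i; apply/eqP; rewrite -[_ == _]negbK -(phi_nz p2 q_pr pq (okn_nth _ ov)).
have [hi|hi] := ltnP i (size v); first by apply: (hasPn hn); apply: mem_nth.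
by rewrite nth_default // nz_spec val2_zer.
Qed.

Section Rounds.
Hypothesis cands_ok : forall Bs, all okV Bs -> all okV (cands x Bs).

Definition rounds (l : seq coord) := foldl (fun Bs _ => round x Bs) [::] l.

Lemma round_cases Bs :
  (round x Bs = Bs /\ forall c, c \in cands x Bs -> ~~ has nz (redall p Bs c)) \/
  exists c, [/\ c \in cands x Bs, has nz (redall p Bs c)
    & round x Bs = rcons Bs (redall p Bs c)].
Proof.
rewrite /round; set s := filter _ _.
case E: s => [|v s'].
  left; rewrite cats0; split=> // c hc; apply/negP => hn.
  have : redall p Bs c \in s by rewrite mem_filter hn map_f.
  by rewrite E.
right; have : v \in s by rewrite E mem_head.
rewrite mem_filter => /andP[hn /mapP[c hc e]]; exists c; rewrite -e; split=> //.
by rewrite cats1.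
Qed.

Lemma rounds_inv l (P : vec -> Prop) :
  (forall Bs c, binv Bs -> (forall b, b \in Bs -> P b) -> c \in cands x Bs -> P (redall p Bs c)) ->
  binv (rounds l) /\ forall b, b \in rounds l -> P b.
Proof.
move=> hP; elim/last_ind: l => [|l y [IH1 IH2]]; first by split.
rewrite /rounds foldl_rcons -/(rounds l).
have [[-> _]|[c [hc hn ->]]] := round_cases (rounds l); first by split.
split; last first.
  by move=> b; rewrite mem_rcons inE => /orP[/eqP ->|/IH2 //]; apply: hP.
apply: binv_rcons => //; apply: (allP (cands_ok _)) hc; by case: IH1.
Qed.

(** A round that adds nothing is repeated identically by all later ones; failing that, every round
    so far has added a vector. *)
Lemma rounds_fix l : binv (rounds l) /\ (round x (rounds l) = rounds l \/ size l <= size (rounds l)).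
Proof.
have inv l' : binv (rounds l') by case: (@rounds_inv l' (fun=> True)).
split=> //; elim/last_ind: l => [|l y IH]; first by right.
rewrite /rounds foldl_rcons -/(rounds l).
have [[e _]|[c [hc hn e]]] := round_cases (rounds l); first by left; rewrite !e.
right; rewrite e !size_rcons ltnS; case: IH => // e'.
by move/(congr1 size): e'; rewrite e size_rcons => /esym /n_Sn.
Qed.

Lemma closure_basis_fix : let Bs := closure_basis x in
  binv Bs /\ forall c, c \in cands x Bs -> ~~ has nz (redall p Bs c).
Proof.
have [inv h] := rounds_fix ((true, ([::], [::])) :: C); split=> //.
have [[_ //]|[c [_ _ e]]] := round_cases (rounds ((true, ([::], [::])) :: C)); exfalso.
case: h => [e'|]; first by move/(congr1 size): e'; rewrite e size_rcons => /esym /n_Sn.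
by rewrite /= ltnNge binv_size.
Qed.
End Rounds.

Lemma tot_spec v : okV v ->
  okn (tot x v) /\ phi (tot x v) = (\sum_(c <- C) (if c.1 then sem v c else - sem v c))%R.
Proof.
move=> ov; have /andP[/eqP sv /allP hv] := ov.
have -> : (\sum_(c <- C) (if c.1 then sem v c else - sem v c) =
   \sum_(t <- zip C v) (if t.1.1 then phi t.2 else - phi t.2))%R.
  have -> : zip C v = [seq (c, nth z v (index c C)) | c <- C].
    apply: (@eq_from_nth _ ((true, ([::], [::])), z)); first by rewrite size_map size_zip sv minnn.
    move=> i; rewrite size_zip sv minnn => hi.
    by rewrite nth_zip ?sv // (nth_map (true, ([::], [::]))) // index_uniq.
  by rewrite big_map; apply: eq_big_seq => c hc /=; rewrite sem_nth.
rewrite /tot; have oz : all (fun t => okn t.2) (zip C v).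
  by apply/allP => t /(map_f snd); rewrite -/unzip2 unzip2_zip ?sv //; apply: hv.
elim/last_ind: (zip C v) oz => [|s t IH].
  by rewrite big_nil; case: (phi0 q_pr pq).
rewrite all_rcons foldl_rcons => /andP[ot /IH[oa ea]].
rewrite -cats1 big_cat big_seq1 /= -ea /totstep.
case: ifP => _; first exact: (phiD p2 q_pr pq oa ot).
have [on en] := phiN p2 q_pr pq ot; rewrite -en.
exact: (phiD p2 q_pr pq oa on).
Qed.
End Vectors.

(** * The span of the homomorphism tensors *)

Section Closure.
Variables (x : ctx) (q k : nat) (nv : bool -> nat) (Er : forall g, rel 'I_(nv g)).
Arguments Er : clear implicits.
Hypotheses (k_gt0 : 0 < k) (p2 : (val2 (cP x)).*2 <= 2 ^ size (cP x))
  (q_pr : prime q) (pq : val2 (cP x) = q)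
  (symE : forall g, symmetric (Er g)) (irrE : forall g, irreflexive (Er g)).
Let W g := words (iota 0 (nv g)) k.
Hypotheses (hC : cC x = mkcoords (W true) (W false)) (hW : forall g, cW x g = W g)
  (hE : forall g a b, a < nv g -> b < nv g -> adj (cE x g) a b = natrel (Er g) a b)
  (hT : cT x = words [:: 0; 1; 2] k).

Local Notation p := (cP x).
Local Notation C := (cC x).
Local Notation z := (zer (cP x)).
Local Notation okn := (okn (cP x)).
Local Notation okV := (okV x).
Local Notation sem := (sem x q).
Local Notation F := 'F_q.

Definition cat2 (c : coord) := c.2.1 ++ c.2.2.
(** Indexed by the vertices of C_k and M_k, whereas [cat2] follows the cycle. *)
Definition lbl (c : coord) := nth 0 (c.2.1 ++ rev c.2.2).

Lemma memC c : (c \in C) = (c.2.1 \in W c.1) && (c.2.2 \in W c.1).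
Proof.
rewrite hC mem_cat; case: c => g [a b] /=.
have h g' : ((g, (a, b)) \in flatten [seq [seq (g', (a', b')) | b' <- W g'] | a' <- W g']) =
    [&& g == g', a \in W g' & b \in W g'].
  apply/allpairsP/and3P => [[[a' b'] /= [ha hb [-> -> ->]]]|[/eqP -> ha hb]] //.
  by exists (a, b).
by rewrite !h {h}; case: g; rewrite ?andbF ?orbF.
Qed.

Lemma C_uniq : uniq C.
Proof.
have u g : uniq (W g) by apply: uniq_words; rewrite iota_uniq.
have h g : uniq (flatten [seq [seq (g, (a, b)) | b <- W g] | a <- W g]).
  by apply: allpairs_uniq => // -[a b] [a' b'] _ _ [-> ->].
rewrite hC cat_uniq !h andbT /=; apply/hasPn => -[g [a b]] /allpairsP[[a' b'] /= [_ _ [-> _ _]]].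
by apply/negP => /allpairsP[[a'' b''] /= [_ _ []]].
Qed.

Lemma sizeC c : c \in C -> size c.2.1 = k /\ size c.2.2 = k.
Proof. by rewrite memC !mem_words => /andP[/andP[/eqP -> _] /andP[/eqP -> _]]. Qed.

Lemma ltC c i : c \in C -> i < k.*2 -> nth 0 (cat2 c) i < nv c.1.
Proof.
move=> hc hi; have [s1 s2] := sizeC hc.
move: hc; rewrite memC !mem_words => /andP[/andP[_ l1] /andP[_ l2]].
have : all (fun y => y < nv c.1) (cat2 c) by rewrite all_cat l1.
by move/allP; apply; apply: mem_nth; rewrite size_cat s1 s2 addnn.
Qed.

Definition rotc (c : coord) : coord :=
  (c.1, (behead c.2.1 ++ [:: nth 0 c.2.2 0], behead c.2.2 ++ [:: nth 0 c.2.1 0])).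

Lemma rotc_in c : c \in C -> rotc c \in C.
Proof.
rewrite !memC !mem_words /=; case: c => g [[|a0 a] [|b0 b]] /=; rewrite ?(ltn_eqF k_gt0) ?andbF //.
by rewrite !size_cat !all_cat /= !addn1 !andbT => /andP[/andP[-> /andP[-> ->]] /andP[-> /andP[-> ->]]].
Qed.

Lemma cat2_rotc c : c \in C -> cat2 (rotc c) = rot 1 (cat2 c).
Proof.
move=> /sizeC; case: c => g [[|a0 a] [|b0 b]] /= [s1 s2]; try (exfalso; lia).
by rewrite /cat2 /rotc /rot /= drop0 take0 -!catA /=.
Qed.

Local Open Scope ring_scope.

Let C_u := C_uniq.
Let okl v c : okV v -> okn (look x v c) := @okn_look x q q_pr pq C_u v c.

Lemma opR_spec v : okV v -> okV (opR x v) /\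
  forall c, c \in C -> sem (opR x v) c = sem v (rotc c).
Proof. by move=> ov; split=> [|c hc]; [apply: okV_map => c _; apply: okl|rewrite sem_map]. Qed.

Definition mask (mu : coord -> bool) (f : coord -> F) c := if mu c then f c else 0.
Definition mpair (rho : bool -> rel nat) (c : coord) :=
  rho c.1 (nth 0%N (cat2 c) 0) (nth 0%N (cat2 c) 1).
Definition rE (g : bool) : rel nat := fun a b => a == b.
Definition rA (g : bool) : rel nat := natrel (Er g).

Lemma opE_spec v : okV v -> okV (opE x v) /\
  forall c, c \in C -> sem (opE x v) c = mask (mpair rE) (sem v) c.
Proof.
have [o0 e0] := phi0 q_pr pq.
move=> ov; split=> [|c hc]; first by apply: okV_map => c _; case: ifP => // _; apply: okl.
by rewrite sem_map // /mask /mpair /rE /cat2; case: ifP.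
Qed.

Lemma opA_spec v : okV v -> okV (opA x v) /\
  forall c, c \in C -> sem (opA x v) c = mask (mpair rA) (sem v) c.
Proof.
have [o0 e0] := phi0 q_pr pq.
move=> ov; split=> [|c hc]; first by apply: okV_map => c _; case: ifP => // _; apply: okl.
rewrite sem_map // /mask /mpair /rA hE; [by case: ifP|apply: ltC => //; lia..].
Qed.

Definition sP (u v : coord -> F) (c : coord) : F :=
  \sum_(w <- W c.1) u (c.1, (c.2.1, rev w)) * v (c.1, (w, c.2.2)).

Lemma opP_spec u v : okV u -> okV v -> okV (opP x u v) /\
  forall c, c \in C -> sem (opP x u v) c = sP (sem u) (sem v) c.
Proof.
move=> ou ov.
have h c : okn (pentry ((x, (u, v)), c)) /\ phi q (pentry ((x, (u, v)), c)) = sP (sem u) (sem v) c.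
  rewrite /pentry /sP /= hW; elim/last_ind: (W c.1) => [|s w [o e]].
    by rewrite big_nil; apply: (phi0 q_pr pq).
  rewrite foldl_rcons -cats1 big_cat big_seq1 /= -e /pstep /=.
  have [o1 e1] := phiM p2 q_pr pq (look x u (c.1, (c.2.1, rev w))) (okl (c.1, (w, c.2.2)) ov).
  by have [o2 e2] := phiD p2 q_pr pq o o1; rewrite e2 e1.
by split=> [|c hc]; [apply: okV_map => c _; case: (h c)|rewrite sem_map //; case: (h c)].
Qed.

Definition sgen (t : seq nat) (c : coord) : F :=
  (all (okrel (rA c.1)) (zip t (zip c.2.1 (rev c.2.2))))%:R.

Lemma gen_spec t : okV (gen x t) /\
  forall c, c \in C -> sem (gen x t) c = sgen t c.
Proof.
have [o0 e0] := phi0 q_pr pq; have [o1 e1] := phi1 p2 q_pr pq.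
split=> [|c hc]; first by apply: okV_map => c _; case: ifP.
rewrite sem_map // /sgen.
have -> : all (fun r => okr (cE x c.1) r) (zip t (zip c.2.1 (rev c.2.2))) =
          all (okrel (rA c.1)) (zip t (zip c.2.1 (rev c.2.2))); last by case: all.
apply: eq_in_all => -[i [a b]] hr; rewrite /okr /okrel /=; case: ifP => // _; case: ifP => // _.
move: hc; rewrite memC !mem_words => /andP[/andP[/eqP s1 l1] /andP[/eqP s2 l2]].
have hab : (a, b) \in zip c.2.1 (rev c.2.2).
  case/(nthP (0%N, (0%N, 0%N))): hr => j hj e.
  have hj2 : (j < size (zip c.2.1 (rev c.2.2)))%N.
    by move: hj; rewrite [size (zip t _)]size_zip leq_min => /andP[].
  have -> : (a, b) = nth (0%N, 0%N) (zip c.2.1 (rev c.2.2)) j.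
    by move: e; rewrite nth_zip_cond hj => -[].
  exact: mem_nth.
rewrite /rA hE //.
  by have := map_f fst hab; rewrite -/unzip1 unzip1_zip ?size_rev ?s1 ?s2 // => /(allP l1).
have := map_f snd hab; rewrite -/unzip2 unzip2_zip ?size_rev ?s1 ?s2 // mem_rev; exact: (allP l2).
Qed.

Lemma cands_okV Bs : all okV Bs -> all okV (cands x Bs).
Proof.
move=> /allP oB; rewrite /cands !all_cat; apply/and5P; split; apply/allP => v.
- by case/mapP => t _ ->; case: (gen_spec t).
- by case/mapP => b /oB ob ->; case: (opR_spec ob).
- by case/mapP => b /oB ob ->; case: (opE_spec ob).
- by case/mapP => b /oB ob ->; case: (opA_spec ob).
- by case/allpairsP => -[u w] /= [/oB ou /oB ow ->]; case: (opP_spec ou ow).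
Qed.

(** A subspace stable under the operations. [cl_0] and [cl_comb] also make membership depend on the
    values on [C] alone. *)
Record closedV (V : (coord -> F) -> Prop) : Prop := ClosedV {
  cl_0 : forall f, {in C, forall c, f c = 0} -> V f;
  cl_comb : forall a u v h, V u -> V v -> {in C, forall c, h c = a * u c + v c} -> V h;
  cl_gen : forall t, t \in words [:: 0; 1; 2]%N k -> V (sgen t);
  cl_R : forall f, V f -> V (fun c => f (rotc c));
  cl_E : forall f, V f -> V (mask (mpair rE) f);
  cl_A : forall f, V f -> V (mask (mpair rA) f);
  cl_P : forall u v, V u -> V v -> V (sP u v) }.

Section Span.
Variable S : (coord -> F) -> Prop.

Inductive span : (coord -> F) -> Prop :=
| sp0 f : {in C, forall c, f c = 0} -> span f
| spS a s f h : S s -> span f -> {in C, forall c, h c = a * s c + f c} -> span h.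

Lemma span_comb a u v h : span u -> span v -> {in C, forall c, h c = a * u c + v c} -> span h.
Proof.
move=> su; elim: su v h => {u} [u u0|b s f u Ss _ IH hu] v h sv hh.
  elim: sv h hh => {v} [v v0|b s f v Ss sf IH hv] h hh.
    by apply: sp0 => c hc; rewrite hh // u0 // v0 // mulr0 addr0.
  apply: (@spS b s f) => // c hc.
  by rewrite hh // u0 // mulr0 add0r hv.
apply: (@spS (a * b) s (fun c => a * f c + v c)) => //; first exact: (IH v).
by move=> c hc; rewrite hh // hu // mulrDr mulrA addrA.
Qed.

Lemma span_in s : S s -> span s.
Proof.
by move=> Ss; apply: (@spS 1 s (fun=> 0)) => // [|c _]; [apply: sp0|rewrite mul1r addr0].
Qed.

Lemma span_ext f g : {in C, f =1 g} -> span g -> span f.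
Proof.
move=> e sg; apply: (@span_comb 1 g (fun=> 0)) => //; first by apply: sp0.
by move=> c hc; rewrite e // mul1r addr0.
Qed.
End Span.

Definition linop (L : (coord -> F) -> (coord -> F)) :=
  (forall f, {in C, forall c, f c = 0} -> {in C, forall c, L f c = 0}) /\
  (forall a s f h, {in C, forall c, h c = a * s c + f c} ->
     {in C, forall c, L h c = a * L s c + L f c}).

Lemma span_lin S S' L : linop L -> (forall s, S s -> span S' (L s)) ->
  forall f, span S f -> span S' (L f).
Proof.
move=> [L0 LS] hL f; elim=> {f} [f f0|a s f h Ss _ IH hh]; first by apply: sp0; apply: L0.
exact: span_comb (hL _ Ss) IH (LS _ _ _ _ hh).
Qed.

Lemma linop_R : linop (fun f c => f (rotc c)).
Proof. by split=> [f f0 c hc|a s f h hh c hc]; [apply: f0|apply: hh]; apply: rotc_in. Qed.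

Lemma linop_mask mu : linop (mask mu).
Proof.
split=> [f f0 c hc|a s f h hh c hc]; rewrite /mask; case: ifP => // _.
- exact: f0.
- exact: hh.
- by rewrite mulr0 addr0.
Qed.

Lemma inC_l c w : c \in C -> w \in W c.1 -> (c.1, (c.2.1, rev w)) \in C.
Proof.
rewrite !memC /= => /andP[-> _]; rewrite /W !mem_words => /andP[hs hl].
by rewrite size_rev hs all_rev.
Qed.

Lemma inC_r c w : c \in C -> w \in W c.1 -> (c.1, (w, c.2.2)) \in C.
Proof. by rewrite !memC /= => /andP[_ ->] ->. Qed.

Lemma linop_Pl v : linop (fun u => sP u v).
Proof.
split=> [f f0 c hc|a s f h hh c hc]; rewrite /sP.
  by rewrite big_seq big1 // => w hw; rewrite f0 ?mul0r // inC_l.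
rewrite mulr_sumr -big_split /=; apply: eq_big_seq => w hw.
by rewrite hh ?inC_l // mulrDl mulrA.
Qed.

Lemma linop_Pr u : linop (fun v => sP u v).
Proof.
split=> [f f0 c hc|a s f h hh c hc]; rewrite /sP.
  by rewrite big_seq big1 // => w hw; rewrite f0 ?mulr0 // inC_r.
rewrite mulr_sumr -big_split /=; apply: eq_big_seq => w hw.
by rewrite hh ?inC_r // mulrDr mulrCA.
Qed.

(** By linearity the generators suffice; for the bilinear product this is applied to one argument at
    a time. *)
Lemma span_closed S :
  (forall t, t \in words [:: 0; 1; 2]%N k -> span S (sgen t)) ->
  (forall f, S f -> span S (fun c => f (rotc c))) ->
  (forall f, S f -> span S (mask (mpair rE) f)) ->
  (forall f, S f -> span S (mask (mpair rA) f)) ->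
  (forall u v, S u -> S v -> span S (sP u v)) -> closedV (span S).
Proof.
move=> hg hR hE' hA hP; split=> //.
- exact: sp0.
- exact: span_comb.
- exact: span_lin linop_R hR.
- exact: span_lin (linop_mask _) hE'.
- exact: span_lin (linop_mask _) hA.
- move=> u v su sv; apply: (span_lin (linop_Pl v) _ su) => s Ss.
  by apply: (span_lin (linop_Pr s) _ sv) => t St; apply: hP.
Qed.

Definition TF (Fg : bgraph) (c : coord) : F := (tens (Er c.1) Fg (cat2 c))%:R.
Definition SP (f : coord -> F) := exists2 Fg, Pk k Fg & {in C, forall c, f c = TF Fg c}.

Lemma Pk_wfb Fg : Pk k Fg -> wfb k Fg.
Proof.
elim=> {Fg} [Q /(QP_tens)[Eq [Ad [[]]]]|Q /(QS_tens)[Eq [Ad [[]]]]|A B _ wA _ wB|A Q _ wA hQ|A r _ wA] //.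
- exact: wfb_series.
- by apply: wfb_parallel => //; have [Eq [Ad [[]]]] := QP_tens hQ.
- exact: wfb_permute.
Qed.

Lemma lbl01 c : c \in C -> lbl c 0 = nth 0%N (cat2 c) 0 /\ lbl c 1 = nth 0%N (cat2 c) 1.
Proof.
move=> /sizeC; case: c => g [[|a0 a] b] /= [s1 s2]; first by move: k_gt0; rewrite -s1.
rewrite /lbl /cat2 /=; split=> //; case: a s1 => //= s1.
by move: s2; rewrite -s1; case: b => [|b0 [|]].
Qed.

(** Each operation of the algorithm is mirrored by one of the class, so the computed span cannot
    outgrow the tensors. *)
Lemma SP_closed : closedV (span SP).
Proof.
apply: span_closed.
- move=> t ht; apply: span_in.
  have st := size_mem_words ht.
  have [Q [hQ [wQ tQ]]] := QM_exists k_gt0 st.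
  exists Q; first exact: Pk_QS.
  move=> c; rewrite memC => /andP[h1 h2].
  by rewrite /TF /sgen /cat2 tQ.
(* A permuted graph has the old entry at the rotated word, so reading one rotation ahead takes the
   inverse rotation, by [2k - 1]. *)
- move=> f [Fg hF hf]; apply: span_in; exists (permute k k.*2.-1 Fg); first exact: Pk_perm.
  move=> c hc; rewrite hf ?rotc_in // /TF; congr (_%:R)%R.
  have wF := Pk_wfb hF; have [s1 s2] := sizeC hc.
  have sc : size (cat2 c) = k.*2 by rewrite size_cat s1 s2 addnn.
  rewrite -(tens_permute _ k.*2.-1 _ k_gt0 wF) cat2_rotc //; congr tens.
  rewrite modn_small; last lia.
  rewrite -rotD ?sc; last lia.
  by rewrite addn1 prednK ?rot_oversize ?sc //; lia.
- move=> f [Fg hF hf]; have [Q [hQ wQ tQ]] := QE_exists k_gt0.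
  apply: span_in; exists (parallel Fg Q); first exact: Pk_parallel.
  move=> c hc; rewrite /mask /TF (tens_parallel _ _ (Pk_wfb hF) wQ) natrM hf //.
  have := hc; rewrite memC => /andP[h1 h2]; rewrite /cat2 (tQ _ _ _ _ (@symE c.1) h1 h2) /= !andbT.
  have [e0 e1] := lbl01 hc; rewrite -/(lbl c) e0 e1 /mpair /rE.
  by case: eqP => _; rewrite ?mulr1 ?mulr0.
- move=> f [Fg hF hf]; have [Q [Ad [[hQ wQ tQ] hAd]]] := QA_exists k_gt0.
  apply: span_in; exists (parallel Fg Q); first exact: Pk_parallel.
  move=> c hc; rewrite /mask /TF (tens_parallel _ _ (Pk_wfb hF) wQ) natrM hf //.
  have := hc; rewrite memC => /andP[h1 h2]; rewrite /cat2 (tQ _ _ _ _ (@symE c.1) h1 h2) /=.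
  rewrite (eq_all_r hAd) /= andbT; have [e0 e1] := lbl01 hc.
  rewrite -/(lbl c) e0 e1 (natrel_sym (@symE c.1) (nth _ _ 1%N)) andbb /mpair /rA.
  by case: ifP => _; rewrite ?mulr1 ?mulr0.
- move=> u v [Fu hFu hu] [Fv hFv hv]; apply: span_in; exists (series Fu Fv); first exact: Pk_series.
  move=> c hc; have [s1 s2] := sizeC hc.
  rewrite /sP /TF /cat2 (tens_series _ _ (Pk_wfb hFu) (Pk_wfb hFv) s1) natr_sum.
  apply: eq_big_seq => w hw; rewrite natrM hu ?inC_l // hv ?inC_r //.
Qed.

(** * Every closed subspace contains all tensors of the class *)

Section Complete.
Variable V : (coord -> F) -> Prop.
Hypothesis clV : closedV V.

Lemma V_ext f g : {in C, f =1 g} -> V g -> V f.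
Proof.
move=> e vg; apply: (cl_comb clV (a := 1) (v := fun=> 0) vg); first exact: (cl_0 clV).
by move=> c hc; rewrite e // mul1r addr0.
Qed.

Lemma V_rot j f : V f -> V (fun c => f (iter j rotc c)).
Proof.
elim: j f => // j IH f /IH /(cl_R clV); apply: V_ext => c _.
by rewrite -iterSr.
Qed.

Lemma iter_rotc_in j c : c \in C -> iter j rotc c \in C.
Proof. by move=> hc; elim: j => // j IH; apply: rotc_in. Qed.

Lemma size_cat2 c : c \in C -> size (cat2 c) = k.*2.
Proof. by move=> hc; have [s1 s2] := sizeC hc; rewrite size_cat s1 s2 addnn. Qed.

Lemma cat2_iter j c : c \in C -> (j <= k.*2)%N -> cat2 (iter j rotc c) = rot j (cat2 c).
Proof.
move=> hc; elim: j => [|j IH] hj; first by rewrite rot0.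
by rewrite iterS cat2_rotc ?iter_rotc_in // IH ?(ltnW hj) // -rotS ?size_cat2.
Qed.

Lemma iter_rotc1 j c : (iter j rotc c).1 = c.1.
Proof. by elim: j. Qed.

Lemma cat2_inj (c d : coord) :
  c.1 = d.1 -> size c.2.1 = size d.2.1 -> cat2 c = cat2 d -> c = d.
Proof.
case: c d => g [a b] [g' [a' b']] /= -> s /eqP.
by rewrite /cat2 /= eqseq_cat // => /andP[/eqP -> /eqP ->].
Qed.

Lemma iter_rotc_id c : c \in C -> iter k.*2 rotc c = c.
Proof.
move=> hc; have [s1 _] := sizeC hc; have [t1 _] := sizeC (iter_rotc_in k.*2 hc).
apply: cat2_inj; rewrite ?iter_rotc1 ?s1 ?t1 //.
by rewrite cat2_iter // rot_oversize // size_cat2.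
Qed.

Section Relation.
Variable rho : bool -> rel nat.
Hypotheses (rho_sym : forall g, symmetric (rho g))
  (V_rho : forall f, V f -> V (mask (mpair rho) f)).

(** Conjugation by a rotation moves the mask from the first two positions to any consecutive
    pair. *)
Lemma V_pos r f : (r < k.*2)%N -> V f ->
  V (mask (fun c => rho c.1 (nth 0%N (cat2 c) r) (nth 0%N (cat2 c) (r.+1 %% k.*2)%N)) f).
Proof.
move=> hr /(V_rot (k.*2 - r)) /V_rho /(V_rot r); apply: V_ext => c hc.
rewrite /mask /mpair iter_rotc1 cat2_iter // ?(ltnW hr) // -iterD subnK ?(ltnW hr) // iter_rotc_id //.
rewrite !nth_rot_mod ?size_cat2 // ?(ltnW hr) //; try lia.
by rewrite add0n add1n (modn_small hr).
Qed.

(** From position [k] on, the cycle runs backwards through the out-labels: position [r] holds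
    [k + (2k - 1 - r)]. *)
Lemma nth_cyc r : (r < k.*2)%N -> nth 0%N (cyc k) r = if (r < k)%N then r else (3 * k - r.+1)%N.
Proof.
move=> hr; rewrite /cyc nth_cat size_iota; case: ltnP => hk; first by rewrite nth_iota.
rewrite nth_rev size_iota ?nth_iota; lia.
Qed.

Lemma lbl_cyc c r : c \in C -> (r < k.*2)%N -> nth 0%N (cat2 c) r = lbl c (nth 0%N (cyc k) r).
Proof.
move=> hc hr; have [s1 s2] := sizeC hc; rewrite nth_cyc // /lbl /cat2 !nth_cat s1.
case: ltnP => hk; first by rewrite hk.
rewrite ifF; last by apply/negP; lia.
rewrite nth_rev s2; last lia.
by congr nth; lia.
Qed.

(** Path edges among in-labels run forward along the cycle, those among out-labels backward; the two
    sides link position [2k - 1] to 0 and [k - 1] to [k]. *)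
Lemma C_edge_pos i j : bg_e (C_bg k) i j -> exists2 r, (r < k.*2)%N &
  (i = nth 0%N (cyc k) r /\ j = nth 0%N (cyc k) (r.+1 %% k.*2)%N) \/
  (j = nth 0%N (cyc k) r /\ i = nth 0%N (cyc k) (r.+1 %% k.*2)%N).
Proof.
have dir u v : (u < k.*2)%N -> (v < k.*2)%N ->
    [|| [&& v == u.+1, u != k.-1 & (u.+1 < k.*2)%N], (u == 0%N) && (v == k) | (u == k.-1) && (v == k.*2.-1)] ->
    exists2 r, (r < k.*2)%N &
    (u = nth 0%N (cyc k) r /\ v = nth 0%N (cyc k) (r.+1 %% k.*2)%N) \/
    (v = nth 0%N (cyc k) r /\ u = nth 0%N (cyc k) (r.+1 %% k.*2)%N).
  move=> hu hv /or3P[/and3P[/eqP -> h1 h2]|/andP[/eqP -> /eqP ->]|/andP[/eqP -> /eqP ->]].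
  - have [uk|uk] := ltnP u k.
      exists u => //; left; rewrite modn_small // !nth_cyc // uk.
      by rewrite ifT //; lia.
    exists (3 * k - u.+2)%N; first lia.
    right; rewrite modn_small; last lia.
    by rewrite !nth_cyc; [|lia..]; rewrite !ifF; [lia|apply/negP; lia..].
  - exists k.*2.-1; first lia.
    right; rewrite prednK ?modnn; last lia.
    by rewrite !nth_cyc ?k_gt0; [|lia..]; rewrite ifF; [lia|apply/negP; lia].
  - exists k.-1; first lia.
    left; rewrite prednK // modn_small; last lia.
    by rewrite !nth_cyc; [|lia..]; rewrite ifT ?ifF; [lia|apply/negP; lia|lia].
rewrite /= /sym_edges -!orbA => /andP[/andP[hi hj] h].
have : [|| [&& j == i.+1, i != k.-1 & (i.+1 < k.*2)%N], (i == 0%N) && (j == k) | (i == k.-1) && (j == k.*2.-1)]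
   \/ [|| [&& i == j.+1, j != k.-1 & (j.+1 < k.*2)%N], (j == 0%N) && (i == k) | (j == k.-1) && (i == k.*2.-1)].
  by apply/orP; move: h; rewrite -!andbA -!orbA.
case=> /dir [] // r hr h'; exists r => //; tauto.
Qed.

Lemma V_edges l f : {subset l <= bedges k (C_bg k)} -> V f ->
  V (mask (fun c => all (fun t => rho c.1 (lbl c t.1) (lbl c t.2)) l) f).
Proof.
elim: l => [|[i j] l IH] hl vf; first by apply: V_ext vf.
have /IH/(_ vf) vl : {subset l <= bedges k (C_bg k)}.
  by move=> t ht; apply: hl; rewrite inE ht orbT.
have : (i, j) \in bedges k (C_bg k) by apply: hl; rewrite mem_head.
rewrite mem_bedges; last exact: sym_edges_lt.
case/C_edge_pos => r hr hij; apply: V_ext (V_pos hr vl) => c hc.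
have hr1 : (r.+1 %% k.*2 < k.*2)%N by rewrite ltn_mod; lia.
rewrite /mask /= !lbl_cyc //.
have -> : rho c.1 (lbl c (nth 0%N (cyc k) r)) (lbl c (nth 0%N (cyc k) (r.+1 %% k.*2))) =
   rho c.1 (lbl c i) (lbl c j).
  by case: hij => -[-> ->] //; rewrite rho_sym.
by case: (rho _ _ _).
Qed.
End Relation.

Lemma rE_sym g : symmetric (rE g). Proof. by move=> a b; rewrite /rE eq_sym. Qed.
Lemma rA_sym g : symmetric (rA g). Proof. exact: natrel_sym (@symE g). Qed.

Lemma V_parQ Q f : QP k Q -> V f -> V (fun c => f c * TF Q c).
Proof.
move=> hQ vf; have [Eq [Ad [[_ _ tQ] hEq hAd]]] := QP_tens hQ.
have := V_edges rA_sym (cl_A clV) hAd (V_edges rE_sym (cl_E clV) hEq vf).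
apply: V_ext => c hc; have := hc; rewrite memC => /andP[h1 h2].
rewrite /TF /cat2 (tQ _ _ _ _ (@symE c.1) h1 h2) /mask -/(lbl c) /rE /rA.
by case: all; case: all; rewrite ?mulr1 ?mulr0.
Qed.

Lemma mem_words_sub (vs : seq nat) m t :
  size t = m -> {subset t <= vs} -> t \in words vs m.
Proof.
elim: m t => [|m IH] [|a t] //= [st] ht; rewrite wordsS; apply/allpairsP; exists (a, t).
split=> //=; first by apply: ht; rewrite mem_head.
by apply: IH => // u hu; apply: ht; rewrite inE hu orbT.
Qed.

(** Deleting every rung of M_k gives the all-one tensor, the unit of the entrywise product; [V_parQ]
    then yields the minors of C_k themselves. *)
Lemma V_one : V (fun=> 1).
Proof.
apply: V_ext (cl_gen clV (t := nseq k 0%N) _) => [c hc|].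
  rewrite /sgen; have -> // : all (okrel (rA c.1)) (zip (nseq k 0%N) (zip c.2.1 (rev c.2.2))).
  by elim: (k) (zip c.2.1 _) => [|m IH] [|y s] //=; apply: IH.
by apply: mem_words_sub; rewrite ?size_nseq // => t /nseqP[->].
Qed.

Lemma V_QS Q : QS k Q -> V (TF Q).
Proof.
move=> hQ; have [Eq [Ad [[_ _ tQ] hEq hAd]]] := QS_tens hQ.
pose onr (l : seq (nat * nat)) i := ((i, i + k)%N \in l) || ((i + k, i)%N \in l).
have rung t : t \in bedges k (M_bg k) -> exists2 i, (i < k)%N & t = (i, i + k)%N \/ t = (i + k, i)%N.
  case: t => u v; rewrite mem_bedges; last exact: sym_edges_lt.
  rewrite M_edge // => /orP[/andP[h /eqP ->]|/andP[h /eqP ->]]; [exists u|exists v] => //; tauto.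
have allr (l : seq (nat * nat)) (r : rel nat) c : {subset l <= bedges k (M_bg k)} -> symmetric r ->
   all (fun t => r (lbl c t.1) (lbl c t.2)) l =
   all (fun i => onr l i ==> r (lbl c i) (lbl c (i + k)%N)) (iota 0 k).
  move=> hl rS; apply/allP/allP => [H i _|H t ht].
    by apply/implyP => /orP[/H|/H] //=; rewrite rS.
  have [i hi ei] := rung _ (hl _ ht).
  have := H i; rewrite mem_iota hi => /(_ isT)/implyP; rewrite /onr.
  by case: ei ht => -> ht; rewrite ht ?orbT => /(_ isT) //=; rewrite rS.
have TQ c : c \in C -> TF Q c = (all (fun i => (onr Eq i ==> (lbl c i == lbl c (i + k)%N)) &&
     (onr Ad i ==> rA c.1 (lbl c i) (lbl c (i + k)%N))) (iota 0 k))%:R.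
  move=> hc; have := hc; rewrite memC => /andP[h1 h2].
  rewrite /TF /cat2 (tQ _ _ _ _ (@symE c.1) h1 h2) -/(lbl c).
  rewrite (allr _ (rE true) c hEq (@rE_sym _)) (allr _ (rA c.1) c hAd (@rA_sym _)).
  by rewrite -all_predI.
(* A rung listed both as contracted and as surviving would demand a loop, so the tensor is zero by
   irreflexivity. Otherwise one digit per rung describes the minor. *)
have [hb|hb] := boolP (has (fun i => onr Eq i && onr Ad i) (iota 0 k)).
  apply: (cl_0 clV) => c hc; rewrite TQ //; case/hasP: hb => i hi /andP[e1 e2].
  rewrite (_ : all _ _ = false) //; apply/negP => /allP/(_ i hi); rewrite e1 e2 /= => /andP[/eqP ->].
  rewrite /rA /natrel; case: insub => // j; by rewrite irrE.
pose t := [seq (if onr Eq i then 1 else if onr Ad i then 2 else 0)%N | i <- iota 0 k].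
have st : size t = k by rewrite size_map size_iota.
apply: V_ext (cl_gen clV (t := t) _) => [c hc|]; last first.
  by apply: mem_words_sub => // y /mapP[i _ ->]; case: ifP => // _; case: ifP.
have [s1 s2] := sizeC hc; rewrite TQ // /sgen (all_okrel (k := k)) //; congr (_%:R)%R; congr nat_of_bool.
apply: eq_in_all => i hi; have := hi; rewrite mem_iota add0n /= => hik.
rewrite /t (nth_map 0%N) ?size_iota // nth_iota // add0n /okrel -/(lbl c) /=.
have := hasPn hb _ hi; case: (onr Eq i) => /=; first by move=> /negbTE ->; rewrite andbT.
by move=> _; case: (onr Ad i).
Qed.

Lemma V_TF Fg : Pk k Fg -> V (TF Fg).
Proof.
elim=> {Fg} [Q hQ|Q hQ|A B hA vA hB vB|A Q hA vA hQ|A r hA vA].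
- by apply: V_ext (V_parQ hQ V_one) => c _; rewrite mul1r.
- exact: V_QS.
- apply: V_ext (cl_P clV vA vB) => c hc; have [s1 s2] := sizeC hc.
  rewrite /TF /cat2 (tens_series _ _ (Pk_wfb hA) (Pk_wfb hB) s1) natr_sum.
  by apply: eq_bigr => w _; rewrite natrM.
- have [Eq [Ad [[_ wQ _] _ _]]] := QP_tens hQ.
  by apply: V_ext (V_parQ hQ vA) => c _; rewrite /TF (tens_parallel _ _ (Pk_wfb hA) wQ) natrM.
have m2 : (r %% k.*2 < k.*2)%N by rewrite ltn_mod; lia.
(* The permuted graph at [c] is the old one at the word rotated back by [r], that is, forward by
   [2k - r] modulo [2k]. *)
apply: V_ext (V_rot (k.*2 - r %% k.*2) vA) => c hc; rewrite /TF iter_rotc1; congr (_%:R)%R.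
rewrite -(tens_permute _ r _ k_gt0 (Pk_wfb hA)) cat2_iter ?leq_subr //; congr tens.
rewrite -rotD ?size_cat2 ?subnKC ?(ltnW m2) //.
by rewrite rot_oversize ?size_cat2.
Qed.
End Complete.

(** * The computed basis and the decision *)

Lemma lincomb_span S (Bs : seq vec) f : (forall b, b \in Bs -> span S (sem b)) -> all okV Bs ->
  lincomb (q := q) x Bs f -> span S (fun c => f (index c C)).
Proof.
move=> hB /allP oB; elim=> {f} [f f0|a b f h hb _ IH hh].
  by apply: sp0 => c hc; apply: f0; rewrite index_mem.
apply: (span_comb (a := a) (hB _ hb) IH) => c hc.
by rewrite hh ?index_mem // (sem_nth q C_u (allP (introT allP oB) _ hb) hc).
Qed.

Lemma cands_span S (Bs : seq vec) : closedV (span S) -> all okV Bs -> (forall b, b \in Bs -> span S (sem b)) ->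
  forall c, c \in cands x Bs -> span S (sem c).
Proof.
move=> cl /allP oB hB v; rewrite /cands !mem_cat => /or4P[|||/orP[]].
- by case/mapP => t; rewrite hT => ht ->; apply: span_ext (cl_gen cl ht) => c hc; case: (gen_spec t) => _ ->.
- by case/mapP => b hb ->; apply: span_ext (cl_R cl (hB _ hb)) => c hc; case: (opR_spec (oB _ hb)) => _ ->.
- by case/mapP => b hb ->; apply: span_ext (cl_E cl (hB _ hb)) => c hc; case: (opE_spec (oB _ hb)) => _ ->.
- by case/mapP => b hb ->; apply: span_ext (cl_A cl (hB _ hb)) => c hc; case: (opA_spec (oB _ hb)) => _ ->.
- case/allpairsP => -[u w] /= [hu hw ->].
  by apply: span_ext (cl_P cl (hB _ hu) (hB _ hw)) => c hc; case: (opP_spec (oB _ hu) (oB _ hw)) => _ ->.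
Qed.

Definition SB (Bs : seq vec) (f : coord -> F) := exists2 b, b \in Bs & f = sem b.

Lemma basis_in_span b : b \in closure_basis x -> span SP (sem b).
Proof.
move: b; have := @rounds_inv x q p2 q_pr pq cands_okV ((true, ([::], [::])) :: C) (fun b => span SP (sem b)).
rewrite /rounds -/(closure_basis x) => H; case: H => // Bs c hB hS hc.
have [oB _ _] := hB.
have oc : okV c by apply: (allP (cands_okV oB)).
have [o1 _ _ [a [a0 [f lf ef]]]] := redall_spec p2 q_pr pq hB oc.
apply: (span_comb (a := a) (cands_span SP_closed oB hS hc) (lincomb_span hS oB lf)) => d hd.
by rewrite !(sem_nth q C_u) // ef ?index_mem.
Qed.

Lemma basis_closed : closedV (span (SB (closure_basis x))).
Proof.
have [hB hfix] := closure_basis_fix p2 q_pr pq cands_okV; set Bs := closure_basis x in hB hfix *.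
have [oB _ _] := hB.
have hS b : b \in Bs -> span (SB Bs) (sem b) by move=> hb; apply: span_in; exists b.
have cand c : c \in cands x Bs -> span (SB Bs) (sem c).
  move=> hc; have oc : okV c by apply: (allP (cands_okV oB)).
  have [o1 _ _ [a [a0 [f lf ef]]]] := redall_spec p2 q_pr pq hB oc.
  have z1 := nz_vec p2 q_pr pq o1 (hfix _ hc).
  have sf := lincomb_span hS oB lf.
  (* The residue [a * c + f] of a candidate [c] is zero, so [c] is [- a^-1] times a combination of
     the basis. The inverse occurs in the proof, not in the algorithm. *)
  apply: (span_comb (a := - a^-1) (v := fun=> 0) sf); first by apply: sp0.
  move=> d hd; rewrite addr0 (sem_nth q C_u) //.
  have := ef (index d C); rewrite z1 index_mem => /(_ hd) /esym /eqP.
  by rewrite addr_eq0 => /eqP e; rewrite -[f _]opprK -e mulrNN mulrA mulVf // mul1r.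
have okB b : b \in Bs -> okV b by apply: (allP oB).
apply: span_closed.
- move=> t ht; apply: (@span_ext _ _ (sem (gen x t))); first by move=> c hc; case: (gen_spec t) => _ ->.
  by apply: cand; rewrite /cands !mem_cat map_f // hT.
- move=> f [b hb ->]; apply: (@span_ext _ _ (sem (opR x b))).
    by move=> c hc; case: (opR_spec (okB _ hb)) => _ ->.
  by apply: cand; rewrite /cands !mem_cat (map_f (opR x)) // !orbT.
- move=> f [b hb ->]; apply: (@span_ext _ _ (sem (opE x b))).
    by move=> c hc; case: (opE_spec (okB _ hb)) => _ ->.
  by apply: cand; rewrite /cands !mem_cat (map_f (opE x)) // !orbT.
- move=> f [b hb ->]; apply: (@span_ext _ _ (sem (opA x b))).
    by move=> c hc; case: (opA_spec (okB _ hb)) => _ ->.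
  by apply: cand; rewrite /cands !mem_cat (map_f (opA x)) // !orbT.
- move=> u v [b hb ->] [b' hb' ->]; apply: (@span_ext _ _ (sem (opP x b b'))).
    by move=> c hc; case: (opP_spec (okB _ hb) (okB _ hb')) => _ ->.
  apply: cand; rewrite /cands !mem_cat; do 4!(apply/orP; right).
  by apply/allpairsP; exists (b, b').
Qed.

(** On the tensor of a graph this is the difference of its two homomorphism counts, and [tot]
    computes it on vectors. *)
Definition ell (f : coord -> F) : F := \sum_(c <- C) (if c.1 then f c else - f c).

Lemma ell_span S f : (forall s, S s -> ell s = 0) -> span S f -> ell f = 0.
Proof.
move=> hS; elim=> {f} [f f0|a s f h /hS es _ ef hh].
  by rewrite /ell big_seq big1 // => c hc; rewrite f0 // oppr0 if_same.
have -> : ell h = a * ell s + ell f; last by rewrite es ef mulr0 addr0.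
rewrite /ell mulr_sumr -big_split /=; apply: eq_big_seq => c hc; rewrite hh //.
by case: ifP => // _; rewrite opprD mulrN.
Qed.

Lemma ell_TF Fg : wfb k Fg -> ell (TF Fg) = (hom Fg (Er true))%:R - (hom Fg (Er false))%:R.
Proof.
move=> wF; rewrite /ell hC big_cat /= !(hom_tens _ wF) !natr_sum.
rewrite !big_allpairs_dep /=; congr (_ + _); rewrite -?sumrN; apply: eq_bigr => a _;
by rewrite natr_sum -?sumrN; apply: eq_bigr.
Qed.

(** A functional that vanishes on generators vanishes on their span. From left to right the
    generators are the basis vectors, whose span is closed and so contains all tensors; from right
    to left they are the tensors, whose span contains the basis. *)
Lemma answer_correct : answer x <-> Pk_hom_equiv_mod k q (Er true) (Er false).
Proof.
have [[oB _ _] _] := closure_basis_fix p2 q_pr pq cands_okV.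
have modE Fg : Pk k Fg -> (hom Fg (Er true) = hom Fg (Er false) %[mod q]) <-> ell (TF Fg) = 0.
  move=> /Pk_wfb wF; rewrite ell_TF //; split=> [e|/eqP].
    by rewrite -(Fp_nat_mod q_pr (hom Fg (Er true))) e Fp_nat_mod // subrr.
  rewrite subr_eq0 => /eqP /(congr1 val); rewrite /= !val_Fp_nat //.
have totE b : b \in closure_basis x -> nz (tot x b) = (ell (sem b) != 0).
  move=> hb; have [o e] := tot_spec p2 q_pr pq C_u (allP oB _ hb).
  by rewrite (phi_nz p2 q_pr pq o) e.
rewrite /answer; split=> [/allP hA Fg hF|H].
  apply/modE => //; apply: (ell_span _ (V_TF basis_closed hF)) => f [b hb ->].
  by apply/eqP; have := hA _ hb; rewrite totE // negbK.
apply/allP => b hb; rewrite totE // negbK; apply/eqP.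
apply: ell_span (basis_in_span hb) => f [Fg hF hf].
have -> : ell f = ell (TF Fg) by apply: eq_big_seq => c hc; rewrite hf.
by apply/modE => //; apply: H.
Qed.
End Closure.

(** * Parsing the input and the running time *)

Definition bitsE n (E : rel 'I_n) : seq bool :=
  flatten [seq [seq E i j | j <- enum 'I_n] | i <- enum 'I_n].

Lemma foldl_split_bits s c o :
  foldl splitstep (c, o) [seq [:: b] | b : bool <- s] = (catrev s c, o).
Proof. by elim: s c => //= b s IH c; rewrite IH. Qed.

Lemma sy_bits s : map sy (map bit s) = [seq [:: b] | b <- s].
Proof. by rewrite -map_comp; apply: eq_map => -[]. Qed.

Lemma sy_enc_graph n (E : rel 'I_n) : map sy (enc_graph E) =
  [seq [:: b] | b <- nseq n true] ++ [:: [::]] ++ [seq [:: b] | b <- bitsE E] ++ [:: [::]].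
Proof.
have e1 : nseq n c1 = map bit (nseq n true) by rewrite map_nseq.
have e2 : flatten [seq [seq bit (E i j) | j <- enum 'I_n] | i <- enum 'I_n] = map bit (bitsE E).
  rewrite /bitsE map_flatten -map_comp; congr flatten.
  by apply: eq_map => i /=; rewrite -map_comp.
by rewrite /enc_graph e1 e2 !map_cat !sy_bits.
Qed.

Lemma sy_enc_input nG (EG : rel 'I_nG) nH (EH : rel 'I_nH) k p :
  map sy (enc_input EG EH k p) =
  ([seq [:: b] | b <- nseq nG true] ++ [:: [::]] ++ [seq [:: b] | b <- bitsE EG] ++ [:: [::]]) ++
  ([seq [:: b] | b <- nseq nH true] ++ [:: [::]] ++ [seq [:: b] | b <- bitsE EH] ++ [:: [::]]) ++
  [seq [:: b] | b <- bin k] ++ [:: [::]] ++ [seq [:: b] | b <- bin p].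
Proof.
rewrite /enc_input map_cat sy_enc_graph map_cat sy_enc_graph map_cat -!sy_bits.
by rewrite [map sy ([:: csep] ++ _)]map_cat.
Qed.

Lemma fields_enc nG (EG : rel 'I_nG) nH (EH : rel 'I_nH) k p :
  fields (map sy (enc_input EG EH k p)) =
  [:: nseq nG true; bitsE EG; nseq nH true; bitsE EH; bin k; bin p].
Proof.
rewrite sy_enc_input /fields.
rewrite !foldl_cat; do 6! rewrite foldl_split_bits /splitstep /= -/splitstep.
by rewrite -!/(rev _) !revK.
Qed.

(** Two readings of one bit string: directly for [k], reversed and padded for the modulus. *)
Lemma bin_auxP f n : n <= f -> kval (bin_aux f n) = n /\ val2 (rev (bin_aux f n) ++ [:: false]) = n.
Proof.
elim: f n => [|f IH] n; first by rewrite leqn0 => /eqP ->.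
move=> hn /=; case: eqP => [->|n0] //.
have [|IH1 IH2] := IH n./2; first by have := odd_double_half n; lia.
have e := odd_double_half n.
by rewrite /kval foldl_rcons -/(kval _) IH1 rev_rcons /= IH2; lia.
Qed.

Lemma size_bin_aux f n : size (bin_aux f n) <= f.
Proof. by elim: f n => //= f IH n; case: eqP => // _; rewrite size_rcons ltnS. Qed.

Lemma val2_cat0 s : val2 (s ++ [:: false]) = val2 s.
Proof. by elim: s => //= b s ->. Qed.

Lemma size_bitsE n (E : rel 'I_n) : size (bitsE E) = n * n.
Proof. by rewrite size_allpairs size_enum_ord. Qed.

Lemma bitsE_natrel n (E : rel 'I_n) : bitsE E =
  [seq natrel E t.1 t.2 | t <- flatten [seq [seq (a, b) | b <- iota 0 n] | a <- iota 0 n]].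
Proof.
rewrite map_flatten -map_comp -val_enum_ord -map_comp; congr flatten.
apply: eq_map => i /=; rewrite -!map_comp; apply: eq_map => j /=.
by rewrite natrel_ord.
Qed.

Lemma adj_mkedges n (E : rel 'I_n) a b : a < n -> b < n ->
  adj (mkedges n (bitsE E)) a b = natrel E a b.
Proof.
move=> ha hb; rewrite /mkedges bitsE_natrel; set s := flatten _.
have -> : zip s [seq natrel E t.1 t.2 | t <- s] = [seq (t, natrel E t.1 t.2) | t <- s].
  by elim: s => //= t s ->.
rewrite /adj has_map; apply/hasP/idP => [[[u v] _ /=]|h].
  by move=> /and3P[h /eqP <- /eqP <-].
exists (a, b); last by rewrite /= h !eqxx.
by apply/allpairsP; exists (a, b); rewrite !mem_iota.
Qed.

Section Instance.
Variables (nG : nat) (EG : rel 'I_nG) (nH : nat) (EH : rel 'I_nH) (k p : nat).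
Hypotheses (sG : symmetric EG) (iG : irreflexive EG) (sH : symmetric EH) (iH : irreflexive EH)
  (k_gt0 : 0 < k) (p_pr : prime p).
Local Notation e := (map sy (enc_input EG EH k p)).

Lemma kin_enc : kin e = k.
Proof. by rewrite /kin /fld fields_enc /=; case: (@bin_auxP k k). Qed.

Lemma setup_correct : answer (setup e) <-> Pk_hom_equiv_mod k p EG EH.
Proof.
pose nv (g : bool) := if g then nG else nH.
pose Er : forall g, rel 'I_(nv g) := fun g => if g return rel 'I_(nv g) then EG else EH.
have pq : val2 (cP (setup e)) = p.
  by rewrite /cP /setup /mkctx /= /fld fields_enc /=; case: (@bin_auxP p p).
have p2 : (val2 (cP (setup e))).*2 <= 2 ^ size (cP (setup e)).
  rewrite /cP /setup /mkctx /= /fld fields_enc /= val2_cat0 size_cat addn1 expnS.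
  by have := val2_lt (rev (bin p)); lia.
have := @answer_correct (setup e) p k nv Er k_gt0 p2 p_pr pq.
apply; try by case.
- by rewrite /cC /setup /mkctx /= kin_enc /fld !fields_enc /= !size_nseq.
- by case; rewrite /cW /setup /mkctx /= kin_enc /fld !fields_enc /= !size_nseq.
- case=> a b ha hb; rewrite /cE /setup /mkctx /= /fld !fields_enc /= size_nseq;
  exact: adj_mkedges.
- by rewrite /cT /setup /mkctx /= kin_enc.
Qed.

Lemma input_size : size (enc_input EG EH k p) + budget e + 2 <=
  20 * maxn (maxn nG nH) 2 ^ (2 * k) * size (bin p).
Proof.
set m := maxn (maxn nG nH) 2; set L := size (bin p).
have hm : 1 < m by rewrite /m leq_max orbT.
have hG : nG <= m by rewrite /m !leq_max leqnn.
have hH : nH <= m by rewrite /m !leq_max leqnn orbT.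
have L0 : 0 < L.
  rewrite /L /bin; have := prime_gt0 p_pr; case: (p) => // p' _ /=.
  by rewrite size_rcons.
have sk : size (bin k) <= k by apply: size_bin_aux.
have -> : size (enc_input EG EH k p) =
    (nG + (nG * nG).+2) + (nH + (nH * nH).+2) + (size (bin k)).+1 + L.
  rewrite -(size_map sy) sy_enc_input !size_cat !size_map !size_nseq.
  by rewrite !size_bitsE /L /=; lia.
rewrite /budget kin_enc /fld !fields_enc /= !size_nseq.
set Z := m ^ (2 * k).
have mZ : m * m <= Z by rewrite -{2}[m]expn1 -expnS /Z leq_exp2l //; lia.
(* This is where the lower bound 2 on [m] counts: [m + 1] and 4 are at most [m ^ 2], so the powers
   in the budget are at most [m ^ (2 * k)]. *)
have m2 : m.+1 <= m ^ 2 by rewrite expnS expn1; nia.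
have pw a : a <= m ^ 2 -> a ^ k <= Z by move=> h; rewrite /Z expnM leq_exp2r.
have h1 : nG.+1 ^ k <= Z by apply: pw; lia.
have h2 : nH.+1 ^ k <= Z by apply: pw; lia.
have h3 : 4 ^ k <= Z by apply: pw; rewrite (leq_exp2r 2 m (isT : 0 < 2)).
have kZ : k <= Z by apply: leq_trans h3; apply: ltnW; apply: ltn_expl.
have g1 : nG * nG <= m * m by apply: leq_mul.
have g2 : nH * nH <= m * m by apply: leq_mul.
have mm : m <= m * m by nia.
have zl : Z <= Z * L by rewrite leq_pmulr.
have ll : L <= Z * L by rewrite leq_pmull //; lia.
rewrite -mulnA; lia.
Qed.
End Instance.

Theorem theorem5p1 :
  exists (M : TM) (c C : nat),
    forall (nG : nat) (EG : rel 'I_nG) (nH : nat) (EH : rel 'I_nH) (k p : nat),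
      symmetric EG -> irreflexive EG -> symmetric EH -> irreflexive EH ->
      0 < k -> prime p ->
      let T := C * (maxn (maxn nG nH) 2) ^ (c * k) * (k * size (bin p)) ^ c in
      let cf := run M (enc_input EG EH k p) T in
      halted cf /\ (c_state cf = tm_acc M <-> Pk_hom_equiv_mod k p EG EH).
Proof.
have [M [d hM]] := TB_decider (TB_comp PT_answer TB_setup).
(* The machine runs within the [d]-th power of the bound in [input_size]; its factors [20] and
   [m ^ (2 * k)] become [20 ^ d] and [m ^ (2 * d * k)]. *)
exists M, (2 * d), (20 ^ d) => nG EG nH EH k p sG iG sH iH k0 pp T.
have [|h1 h2] := hM (enc_input EG EH k p) T.
  apply: (@leq_trans ((20 * maxn (maxn nG nH) 2 ^ (2 * k) * size (bin p)) ^ d)).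
    by case: (d) => // d'; rewrite leq_exp2r // input_size.
  rewrite /T !expnMn -expnM -(mulnA 2 k d) (mulnC k d) mulnA leq_mul2l; apply/orP; right.
  have L0 : 0 < k * size (bin p).
    by rewrite muln_gt0 k0; have := prime_gt0 pp; rewrite /bin; case: (p) => //= p' _; rewrite size_rcons.
  rewrite -expnMn; apply: (@leq_trans ((k * size (bin p)) ^ d)).
    by case: (d) => // d'; rewrite leq_exp2r // leq_pmull.
  by rewrite leq_pexp2l //; lia.
split=> //; apply: (iff_trans h2); exact: setup_correct.
Qed.
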